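(* There are no minimal Wente tori with ends. That is: for every lattice $L\subset\mathbb{C}$ with real invariants $g_2,g_3$, every $b\in\mathbb{R}$ with $b^3-4g_2b-16g_3=1$, every $\hat g_0\in\mathbb{R}^+$ and every sub-lattice $\Lambda\subset L$, there is no conformal minimal immersion $\hat\Psi:(\mathbb{C}\setminus L)/\Lambda\to\mathbb{R}^3$ such that $\hat\Psi\circ\pi=\Psi_{L,b,\hat g_0}$, where $\pi:\mathbb{C}\setminus L\to(\mathbb{C}\setminus L)/\Lambda$ is the canonical projection and $\Psi_{L,b,\hat g_0}:\mathbb{C}\setminus L\to\mathbb{R}^3$ is the minimal immersion of Enneper type determined by $(L,b,\hat g_0)$.
   Context: Lattice and sub-lattice mean rank-two discrete subgroups of $\mathbb{C}$. For a lattice $L=\{2m\omega_1+2n\omega_2: m,n\in\mathbb{Z}\}$, $\wp(\cdot|L)$ is the Weierstrass function and $g_2=60\sum_{\Omega\in L\setminus\{0\}}\Omega^{-4}$, $g_3=140\sum_{\Omega\in L\setminus\{0\}}\Omega^{-6}$ are its invariants. Given $L$ with $g_2,g_3\in\mathbb{R}$, $b\in\mathbb{R}$ with $b^3-4g_2b-16g_3=1$, and $\hat g_0>0$, set $\phi(z)=b-4\wp(z|L)$ and $g(z)=\hat g_0\exp\left(\int_0^z\frac{d\nu}{\phi(\nu)}\right)$. The differential $d\nu/\phi$ has only simple poles with residues $\pm1$, so $g$ is a well-defined meromorphic function on $\mathbb{C}$. The Wente-Weierstrass data is $$\Phi_{L,b,\hat g_0}=\left(\tfrac12\left(\tfrac1g-g\right),\tfrac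 i2\left(\tfrac1g+g\right),1\right)\phi\,dz ,$$ and $\Psi_{L,b,\hat g_0}(z)=\mathrm{Re}\int_{z_0}^z\Phi_{L,b,\hat g_0}$ (with a fixed base point $z_0\in\mathbb{C}\setminus L$) is a well-defined complete conformal minimal immersion $\mathbb{C}\setminus L\to\mathbb{R}^3$. A map $\hat\Psi$ as in the claim is called a minimal Wente torus with ends of type $(L,b,\hat g_0,\Lambda)$. *)

(* Defs.v *)
(* Stdlib reals with Coquelicot's complex numbers [C]. *)
From Stdlib Require Export Reals ZArith List.
From Coquelicot Require Export Coquelicot.
Export Complex.
Open Scope R_scope.

Definition lattice (L : C -> Prop) : Prop :=
  exists w1 w2 : C,
    (forall s t : R, (s * w1 + t * w2 = 0)%C -> s = 0 /\ t = 0) /\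
    (forall z : C, L z <->
       exists m n : Z, z = (2 * IZR m * w1 + 2 * IZR n * w2)%C).

(* Unordered summation: the limit along the directed set of finite subsets
   of [A], a finite subset being a duplicate-free list. *)
Definition finite_in (A : C -> Prop) (l : list C) : Prop :=
  NoDup l /\ List.Forall A l.

Definition finite_sum (f : C -> C) (l : list C) : C :=
  fold_right (fun w s => (f w + s)%C) (RtoC 0) l.

Definition is_sum_over (A : C -> Prop) (f : C -> C) (S : C) : Prop :=
  forall eps : R, 0 < eps ->
    exists l0, finite_in A l0 /\
      forall l, finite_in A l -> incl l0 l ->
        Cmod (finite_sum f l - S)%C < eps.

Definition sum_over (A : C -> Prop) (f : C -> C) : C :=
  iota (T := C_R_CompleteNormedModule) (is_sum_over A f).

Definition nonzero_of (L : C -> Prop) (w : C) : Prop := L w /\ w <> 0.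

Definition g2 (L : C -> Prop) : C :=
  (60 * sum_over (nonzero_of L) (fun w => / w ^ 4))%C.

Definition g3 (L : C -> Prop) : C :=
  (140 * sum_over (nonzero_of L) (fun w => / w ^ 6))%C.

(* The value is meaningful for [z] outside [L] only. *)
Definition weierstrass_p (L : C -> Prop) (z : C) : C :=
  (/ z ^ 2 + sum_over (nonzero_of L) (fun w => / (z - w) ^ 2 - / w ^ 2))%C.

(* Requiring a path to be C^1 on all of [R] rather than on [0,1] loses no
   generality: a C^1 path on [0,1] extends to [R] by its tangent lines. *)
Definition C1_path (U : C -> Prop) (gam dgam : R -> C) (a c : C) : Prop :=
  (forall t : R, is_derive (V := C_R_NormedModule) gam t (dgam t)) /\
  (forall t : R, continuous dgam t) /\
  gam 0 = a /\ gam 1 = c /\ (forall t : R, 0 <= t <= 1 -> U (gam t)).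

(* [path_integral U f a c I]: [I] is the integral of [f(z) dz] along some
   piecewise C^1 path from [a] to [c] inside [U]. *)
Inductive path_integral (U : C -> Prop) (f : C -> C) : C -> C -> C -> Prop :=
| path_integral_nil (a : C) : U a -> path_integral U f a a (RtoC 0)
| path_integral_cons (a c d : C) (gam dgam : R -> C) (I J : C) :
    C1_path U gam dgam a c ->
    is_RInt (V := C_R_NormedModule)
      (fun t => (f (gam t) * dgam t)%C) 0 1 I ->
    path_integral U f c d J ->
    path_integral U f a d (I + J)%C.

Definition Cexp (z : C) : C :=
  (exp (Re z) * cos (Im z), exp (Re z) * sin (Im z)).

(* Removes removable singularities: [C_lim f z] does not depend on [f z], and is
   the limit of [f] at [z] whenever that limit exists (see [is_C_lim_unique]). *)
Definition removable_ext (f : C -> C) (z : C) : C := C_lim f z.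

Definition phi (L : C -> Prop) (b : R) (z : C) : C :=
  (b - 4 * weierstrass_p L z)%C.

(* Where [1/phi] is holomorphic; on [L], where [phi] has double poles, [1/phi]
   has a removable singularity. *)
Definition inv_phi_domain (L : C -> Prop) (b : R) (z : C) : Prop :=
  L z \/ phi L b z <> 0.

(* The integral depends on the path modulo [2 i pi Z], so its exponential does
   not.  The value at a zero of [phi], which is a zero or a pole of the
   meromorphic function, is unspecified. *)
Definition gauss (L : C -> Prop) (b g0 : R) (z : C) : C :=
  iota (T := C_R_CompleteNormedModule)
    (fun w => exists I : C,
       path_integral (inv_phi_domain L b)
         (removable_ext (fun nu => / phi L b nu)%C) 0 z I /\
       w = (g0 * Cexp I)%C).

(* Coefficients of [dz] in the Weierstrass data; the first two are extended
   holomorphically to the zeros of [phi]. *)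
Definition Phi1 (L : C -> Prop) (b g0 : R) : C -> C :=
  removable_ext (fun z =>
    / 2 * (/ gauss L b g0 z - gauss L b g0 z) * phi L b z)%C.

Definition Phi2 (L : C -> Prop) (b g0 : R) : C -> C :=
  removable_ext (fun z =>
    Ci / 2 * (/ gauss L b g0 z + gauss L b g0 z) * phi L b z)%C.

Definition Phi3 (L : C -> Prop) (b g0 : R) : C -> C := phi L b.

Definition Re_primitive (U : C -> Prop) (f : C -> C) (z0 z : C) : R :=
  iota (T := R_CompleteNormedModule)
    (fun x => exists I : C, path_integral U f z0 z I /\ x = Re I).

Definition R3 : Type := (R * R * R)%type.
Definition x1 (p : R3) : R := fst (fst p).
Definition x2 (p : R3) : R := snd (fst p).
Definition x3 (p : R3) : R := snd p.

Definition Psi (L : C -> Prop) (b g0 : R) (z0 z : C) : R3 :=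
  let U := fun w => ~ L w in
  (Re_primitive U (Phi1 L b g0) z0 z,
   Re_primitive U (Phi2 L b g0) z0 z,
   Re_primitive U (Phi3 L b g0) z0 z).

Definition dot (p q : R3) : R := x1 p * x1 q + x2 p * x2 q + x3 p * x3 q.

Definition cross (p q : R3) : R3 :=
  (x2 p * x3 q - x3 p * x2 q,
   x3 p * x1 q - x1 p * x3 q,
   x1 p * x2 q - x2 p * x1 q).

Definition scale (a : R) (p : R3) : R3 := (a * x1 p, a * x2 p, a * x3 p).

(* Partial derivatives in the real coordinates [z = u + i v]. *)
Definition d_u (f : C -> R) (z : C) : R :=
  Derive (fun t => f (t, Im z)) (Re z).
Definition d_v (f : C -> R) (z : C) : R :=
  Derive (fun t => f (Re z, t)) (Im z).

Fixpoint Cn_on (n : nat) (U : C -> Prop) (f : C -> R) : Prop :=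
  (forall z : C, U z -> continuous f z) /\
  match n with
  | O => True
  | S m =>
      (forall z : C, U z ->
         ex_derive (fun t => f (t, Im z)) (Re z) /\
         ex_derive (fun t => f (Re z, t)) (Im z)) /\
      Cn_on m U (d_u f) /\ Cn_on m U (d_v f)
  end.

Definition smooth_on (U : C -> Prop) (X : C -> R3) : Prop :=
  forall n : nat,
    Cn_on n U (fun z => x1 (X z)) /\ Cn_on n U (fun z => x2 (X z)) /\
    Cn_on n U (fun z => x3 (X z)).

Definition D_u (X : C -> R3) (z : C) : R3 :=
  (d_u (fun w => x1 (X w)) z, d_u (fun w => x2 (X w)) z,
   d_u (fun w => x3 (X w)) z).
Definition D_v (X : C -> R3) (z : C) : R3 :=
  (d_v (fun w => x1 (X w)) z, d_v (fun w => x2 (X w)) z,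
   d_v (fun w => x3 (X w)) z).

Definition unit_normal (X : C -> R3) (z : C) : R3 :=
  let n := cross (D_u X z) (D_v X z) in scale (/ sqrt (dot n n)) n.

Definition mean_curvature (X : C -> R3) (z : C) : R :=
  let E := dot (D_u X z) (D_u X z) in
  let F := dot (D_u X z) (D_v X z) in
  let G := dot (D_v X z) (D_v X z) in
  let N := unit_normal X z in
  let e := dot (D_u (D_u X) z) N in
  let f := dot (D_v (D_u X) z) N in
  let g := dot (D_v (D_v X) z) N in
  (e * G - 2 * f * F + g * E) / (2 * (E * G - F ^ 2)).

Definition conformal_minimal_immersion_on (U : C -> Prop) (X : C -> R3) : Prop :=
  smooth_on U X /\
  forall z : C, U z ->
    cross (D_u X z) (D_v X z) <> (0, 0, 0) /\
    dot (D_u X z) (D_u X z) = dot (D_v X z) (D_v X z) /\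
    dot (D_u X z) (D_v X z) = 0 /\
    mean_curvature X z = 0.

Definition punctured (L : C -> Prop) : Type := {z : C | ~ L z}.

(* Points of [(C \ L) / Lam] are the [Lam]-cosets contained in [C \ L]. *)
Definition coset (L Lam : C -> Prop) (z : punctured L) : punctured L -> Prop :=
  fun w => Lam (proj1_sig w - proj1_sig z)%C.

Definition quotient (L Lam : C -> Prop) : Type :=
  {A : punctured L -> Prop | exists z, A = coset L Lam z}.

Definition quotient_map (L Lam : C -> Prop) (z : punctured L) : quotient L Lam :=
  exist _ (coset L Lam z) (ex_intro _ z eq_refl).

(* The conformal structure of the quotient is given by the local inverses of
   the projection: each open [U] in [C \ L] on which the projection is injective
   is a coordinate domain, and [X] below is [Y] read in that coordinate. *)
Definition conformal_minimal_immersion_quotient (L Lam : C -> Prop)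
    (Y : quotient L Lam -> R3) : Prop :=
  forall (U : C -> Prop) (X : C -> R3),
    open U ->
    (forall z : C, U z -> ~ L z) ->
    (forall z w : punctured L, U (proj1_sig z) -> U (proj1_sig w) ->
       quotient_map L Lam z = quotient_map L Lam w ->
       proj1_sig z = proj1_sig w) ->
    (forall z : punctured L, U (proj1_sig z) ->
       X (proj1_sig z) = Y (quotient_map L Lam z)) ->
    conformal_minimal_immersion_on U X.

(* Main.v *)
(** Write [phi = b - 4 wp] and [F = b z + 4 zeta], so that [F' = phi]. The condition on [b]
    says that [phi' ^ 2] is a cubic in [phi] with constant term 1, so [1 / phi] has residue
    [+-1] at each zero of [phi], and [g phi dz], [phi / g dz] have explicit primitives
    [- g (2 (phi' + 1) / phi + A)] and [(A - 2 (phi' - 1) / phi) / g] with [A = - 3 b^2 + 4 g2].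

    Suppose that the immersion is invariant under [Lam]. Real invariants make [L] invariant
    under conjugation, hence [L] has a least positive real period [x], and [Lam] contains a
    multiple of it. The third coordinate gives [F (z + x) = F z], and the singular parts of
    the first two coordinates at the origin show that the multiplier of [g] along [x] is a
    root of unity. If [phi] has no zero in [(0, x)], that multiplier is the exponential of the
    integral of the real function [1 / phi] of constant sign, a contradiction. Otherwise
    [phi] has a zero [y] in [(0, x / 2)]; integrating
    [1 / phi = (F (z - a) - F (z + a) + 2 F a) / 4], [a = +- y], along a horizontal period shows
    that the multiplier is [exp (x F a / 2)]. Hence [F y = 0]; but [F (x / 2) = 0] because [F]
    is odd and periodic, so [phi = F'] vanishes between [y] and [x / 2], where it has no zero. *)

Require Import Defs.
From Stdlib Require Import Lra Lia Psatz Permutation.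
From Stdlib Require Import Classical ClassicalEpsilon FunctionalExtensionality
  PropExtensionality ProofIrrelevance.

(** No Cauchy integral theory is used: every holomorphic function that occurs comes with an explicit
    derivative, and the mean value inequality together with the mean value property over circles
    replaces contour integrals. Two facts ask for a substitute of classical theory. That real
    invariants force conjugation symmetry means that [g2] and [g3] determine the lattice; this is
    proved by comparing two Weierstrass functions on a ray through a primitive lattice point, where
    their difference solves a singular linear equation and vanishes to too high an order at the
    origin. That the Gauss map does not depend on the path is seen on finite products whose
    logarithmic derivatives converge to [1 / phi]. Descent to the quotient gives less than
    periodicity along [x]: it concerns the multiple [n * x] and only real parts. For the increment
    of [F] along [x], the real part vanishes after division by [n] and the imaginary part by
    conjugation. For the multiplier a root of unity is as good as 1, because only its modulus
    enters: both final contradictions compare the real part of a logarithm with 0. *)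

Lemma Cmod_minus_sym (z w : C) : Cmod (z - w) = Cmod (w - z).
Proof. rewrite <- Cmod_opp. f_equal. ring. Qed.

Lemma Cmod_triangle_inv (z w : C) : Cmod z - Cmod w <= Cmod (z - w).
Proof.
  pose proof (Cmod_triangle (z - w) w) as H.
  replace (z - w + w)%C with z in H by ring. lra.
Qed.

Lemma Cmod_triangle_minus (z w : C) : Cmod (z - w) <= Cmod z + Cmod w.
Proof.
  pose proof (Cmod_triangle z (- w)) as H. rewrite Cmod_opp in H. exact H.
Qed.

Lemma Cminus_neq_0 (z w : C) : z <> w -> (z - w <> 0)%C.
Proof. intros H E. apply H. replace z with (z - w + w)%C by ring. rewrite E. ring. Qed.

Lemma Cmod_eq_of_le (z w : C) : (forall e, 0 < e -> Cmod (z - w) <= e) -> z = w.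
Proof.
  intros H. destruct (Req_dec (Cmod (z - w)) 0) as [E|E].
  - apply Cmod_eq_0 in E. replace z with (z - w + w)%C by ring. rewrite E. ring.
  - pose proof (Cmod_ge_0 (z - w)). specialize (H (Cmod (z - w) / 2)). lra.
Qed.

(** * Punctured limits of complex functions *)

Definition clim (f : C -> C) (z l : C) : Prop :=
  forall e, 0 < e -> exists d, 0 < d /\
    forall w, w <> z -> Cmod (w - z) < d -> Cmod (f w - l) < e.

Definition ccont (f : C -> C) (z : C) : Prop := clim f z (f z).

Definition near (z : C) (P : C -> Prop) : Prop :=
  exists d, 0 < d /\ forall w, w <> z -> Cmod (w - z) < d -> P w.

Lemma near_and z (P Q : C -> Prop) : near z P -> near z Q -> near z (fun w => P w /\ Q w).
Proof.
  intros (d1 & H1 & K1) (d2 & H2 & K2). exists (Rmin d1 d2).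
  split. { now apply Rmin_pos. }
  intros w Hw Hd. pose proof (Rmin_l d1 d2). pose proof (Rmin_r d1 d2).
  split; [apply K1 | apply K2]; auto; lra.
Qed.

Lemma near_mono z (P Q : C -> Prop) : near z P -> (forall w, w <> z -> P w -> Q w) -> near z Q.
Proof. intros (d & H & K) HPQ. exists d. split; auto. Qed.

Lemma near_neq (z : C) : near z (fun w => w <> z).
Proof. exists 1. split; [lra|]. auto. Qed.

Lemma clim_ext_near f g z l : near z (fun w => f w = g w) -> clim f z l -> clim g z l.
Proof.
  intros (d1 & H1 & K1) Hf e He. destruct (Hf e He) as (d2 & H2 & K2).
  exists (Rmin d1 d2). split. { now apply Rmin_pos. }
  intros w Hw Hd. pose proof (Rmin_l d1 d2). pose proof (Rmin_r d1 d2).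
  rewrite <- K1; auto; try lra. apply K2; auto; lra.
Qed.

Lemma clim_ext f g z l : (forall w, w <> z -> f w = g w) -> clim f z l -> clim g z l.
Proof. intros H. apply clim_ext_near. exists 1. split; [lra|auto]. Qed.

Lemma clim_near f z l e : clim f z l -> 0 < e -> near z (fun w => Cmod (f w - l) < e).
Proof. intros H He. exact (H e He). Qed.

Lemma clim_eq f z l m : clim f z l -> l = m -> clim f z m.
Proof. now intros H <-. Qed.

Lemma clim_const a z : clim (fun _ => a) z a.
Proof.
  intros e He. exists 1. split; [lra|]. intros. replace (a - a)%C with (RtoC 0) by ring.
  now rewrite Cmod_0.
Qed.

Lemma clim_id z : clim (fun w => w) z z.
Proof. intros e He. exists e. auto. Qed.

Lemma clim_plus f g z l m : clim f z l -> clim g z m -> clim (fun w => f w + g w)%C z (l + m)%C.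
Proof.
  intros Hf Hg e He.
  destruct (near_and _ _ _ (clim_near _ _ _ (e/2) Hf ltac:(lra)) (clim_near _ _ _ (e/2) Hg ltac:(lra)))
    as (d & Hd & K).
  exists d. split; auto. intros w Hw Hwd. destruct (K w Hw Hwd).
  replace (f w + g w - (l + m))%C with ((f w - l) + (g w - m))%C by ring.
  pose proof (Cmod_triangle (f w - l) (g w - m)). lra.
Qed.

Lemma clim_opp f z l : clim f z l -> clim (fun w => - f w)%C z (- l)%C.
Proof.
  intros Hf e He. destruct (Hf e He) as (d & Hd & K). exists d. split; auto.
  intros w Hw Hwd. replace (- f w - - l)%C with (- (f w - l))%C by ring.
  rewrite Cmod_opp. auto.
Qed.

Lemma clim_minus f g z l m : clim f z l -> clim g z m -> clim (fun w => f w - g w)%C z (l - m)%C.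
Proof. intros Hf Hg. apply clim_plus; auto. now apply clim_opp. Qed.

Lemma clim_bounded f z l : clim f z l -> near z (fun w => Cmod (f w) <= Cmod l + 1).
Proof.
  intros Hf. apply (near_mono _ _ _ (clim_near _ _ _ 1 Hf ltac:(lra))).
  intros w _ H. pose proof (Cmod_triangle_inv (f w) l). lra.
Qed.

Lemma clim_mult f g z l m : clim f z l -> clim g z m -> clim (fun w => f w * g w)%C z (l * m)%C.
Proof.
  intros Hf Hg e He.
  set (K := Cmod l + Cmod m + 2).
  assert (HK : 0 < K) by (unfold K; pose proof (Cmod_ge_0 l); pose proof (Cmod_ge_0 m); lra).
  assert (He' : 0 < e / K) by now apply Rdiv_lt_0_compat.
  destruct (near_and _ _ _ (clim_bounded _ _ _ Hg)
     (near_and _ _ _ (clim_near _ _ _ (e/K) Hf He') (clim_near _ _ _ (e/K) Hg He')))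
    as (d & Hd & KK).
  exists d. split; auto. intros w Hw Hwd. destruct (KK w Hw Hwd) as (A & B & D).
  replace (f w * g w - l * m)%C with ((f w - l) * g w + l * (g w - m))%C by ring.
  eapply Rle_lt_trans. { apply Cmod_triangle. }
  rewrite !Cmod_mult.
  apply Rle_lt_trans with (e / K * (Cmod m + 1) + Cmod l * (e / K)).
  - apply Rplus_le_compat.
    + apply Rmult_le_compat; auto using Cmod_ge_0; lra.
    + apply Rmult_le_compat_l; auto using Cmod_ge_0; lra.
  - apply Rlt_le_trans with (e / K * K); [assert (EK : K = Cmod l + Cmod m + 2) by reflexivity; nra|].
    right. field. lra.
Qed.

Lemma clim_neq_0 f z l : clim f z l -> l <> 0 -> near z (fun w => f w <> 0).
Proof.
  intros Hf Hl. apply Cmod_gt_0 in Hl.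
  apply (near_mono _ _ _ (clim_near _ _ _ _ Hf Hl)).
  intros w _ H E. rewrite E in H. replace (0 - l)%C with (- l)%C in H by ring.
  rewrite Cmod_opp in H. lra.
Qed.

Lemma clim_inv f z l : clim f z l -> l <> 0 -> clim (fun w => / f w)%C z (/ l)%C.
Proof.
  intros Hf Hl e He. pose proof (proj1 (Cmod_gt_0 l) Hl) as Hl'.
  set (M := Cmod l) in *.
  assert (He' : 0 < Rmin (M / 2) (e * (M * M) / 4)).
  { apply Rmin_pos; [lra|]. apply Rdiv_lt_0_compat; [|lra]. apply Rmult_lt_0_compat; nra. }
  destruct (clim_near _ _ _ _ Hf He') as (d & Hd & K).
  exists d. split; auto. intros w Hw Hwd. specialize (K w Hw Hwd).
  pose proof (Rmin_l (M / 2) (e * (M * M) / 4)). pose proof (Rmin_r (M / 2) (e * (M * M) / 4)).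
  assert (Hfw : M / 2 <= Cmod (f w)).
  { pose proof (Cmod_triangle_inv l (f w)) as T. rewrite Cmod_minus_sym in T. fold M in T. lra. }
  assert (f w <> 0). { apply Cmod_gt_0. lra. }
  replace (/ f w - / l)%C with ((l - f w) / (f w * l))%C by (field; auto).
  rewrite Cmod_div by (now apply Cmult_neq_0). rewrite Cmod_mult, Cmod_minus_sym. fold M.
  apply Rlt_div_l; [nra|].
  apply Rlt_le_trans with (e * (M * M) / 4 * 2); [|nra]. nra.
Qed.

Lemma clim_div f g z l m : clim f z l -> clim g z m -> m <> 0 ->
  clim (fun w => f w / g w)%C z (l / m)%C.
Proof. intros. apply clim_mult; auto. now apply clim_inv. Qed.

Lemma clim_pow f z l n : clim f z l -> clim (fun w => f w ^ n)%C z (l ^ n)%C.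
Proof.
  intros H. induction n as [|n IH]; simpl. { apply clim_const. }
  now apply clim_mult.
Qed.

(** Limits ignore the value at the point itself, so a composition needs either that [g] avoids [l]
    nearby or that [f] is continuous at [l]. *)
Lemma clim_comp f g z l m : clim g z l -> clim f l m -> (near z (fun w => g w <> l) \/ f l = m) ->
  clim (fun w => f (g w)) z m.
Proof.
  intros Hg Hf Hc e He. destruct (Hf e He) as (d & Hd & K).
  destruct Hc as [Hc | Hc].
  - destruct (near_and _ _ _ Hc (clim_near _ _ _ d Hg Hd)) as (d' & Hd' & K').
    exists d'. split; auto. intros w Hw Hwd. destruct (K' w Hw Hwd). apply K; auto.
  - destruct (clim_near _ _ _ d Hg Hd) as (d' & Hd' & K').
    exists d'. split; auto. intros w Hw Hwd. specialize (K' w Hw Hwd).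
    destruct (classic (g w = l)) as [E|E].
    + rewrite E, Hc. replace (m - m)%C with (RtoC 0) by ring. now rewrite Cmod_0.
    + apply K; auto.
Qed.

Lemma near_exists z (P : C -> Prop) : near z P -> exists w, w <> z /\ P w.
Proof.
  intros (d & Hd & K). exists (z + (d / 2)%R)%C.
  assert (E : (z + (d / 2)%R - z)%C = RtoC (d / 2)) by ring.
  assert (N : (z + (d / 2)%R)%C <> z).
  { intros F. rewrite F in E. replace (z - z)%C with (RtoC 0) in E by ring.
    apply RtoC_inj in E. lra. }
  split; auto. apply K; auto. rewrite E, Cmod_R, Rabs_pos_eq; lra.
Qed.

Lemma clim_unique f z l m : clim f z l -> clim f z m -> l = m.
Proof.
  intros Hl Hm. apply Cmod_eq_of_le. intros e He.
  destruct (near_exists _ _ (near_and _ _ _ (clim_near _ _ _ (e/2) Hl ltac:(lra))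
    (clim_near _ _ _ (e/2) Hm ltac:(lra)))) as (w & _ & A & B).
  replace (l - m)%C with ((f w - m) - (f w - l))%C by ring.
  pose proof (Cmod_triangle_minus (f w - m) (f w - l)). lra.
Qed.

Lemma clim_0_bound f g z : near z (fun w => Cmod (f w) <= Cmod (g w)) -> clim g z 0 -> clim f z 0.
Proof.
  intros Hb Hg e He. destruct (near_and _ _ _ Hb (clim_near _ _ _ _ Hg He)) as (d & Hd & K).
  exists d. split; auto. intros w Hw Hwd. destruct (K w Hw Hwd) as [A B].
  replace (f w - 0)%C with (f w) by ring. replace (g w - 0)%C with (g w) in B by ring. lra.
Qed.

(** ** Complex derivatives *)

Definition cder (f : C -> C) (z l : C) : Prop :=
  clim (fun w => (f w - f z) / (w - z))%C z l.

Lemma cder_ext_near f g z l : near z (fun w => f w = g w) -> f z = g z -> cder f z l -> cder g z l.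
Proof.
  intros H Hz. apply clim_ext_near. apply (near_mono _ _ _ H). intros w _ E. now rewrite E, Hz.
Qed.

Lemma cder_ext f g z l : (forall w, f w = g w) -> cder f z l -> cder g z l.
Proof. intros H. apply cder_ext_near; auto. exists 1. split; [lra|auto]. Qed.

Lemma cder_cont f z l : cder f z l -> ccont f z.
Proof.
  intros H. unfold ccont.
  apply clim_ext with (fun w => f z + (f w - f z) / (w - z) * (w - z))%C.
  { intros w Hw. field. now apply Cminus_neq_0. }
  eapply clim_eq.
  - apply clim_plus; [apply clim_const|]. apply clim_mult; [exact H|].
    apply clim_minus; [apply clim_id|apply clim_const].
  - ring.
Qed.

Lemma cder_const a z : cder (fun _ => a) z 0.
Proof.
  apply clim_ext with (fun _ => RtoC 0); [|apply clim_const].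
  intros w Hw. field. now apply Cminus_neq_0.
Qed.

Lemma cder_id z : cder (fun w => w) z 1.
Proof.
  apply clim_ext with (fun _ => RtoC 1); [|apply clim_const].
  intros w Hw. field. now apply Cminus_neq_0.
Qed.

Lemma cder_plus f g z l m : cder f z l -> cder g z m -> cder (fun w => f w + g w)%C z (l + m)%C.
Proof.
  intros Hf Hg. eapply clim_ext; [|exact (clim_plus _ _ _ _ _ Hf Hg)].
  intros w Hw. cbv beta. field. now apply Cminus_neq_0.
Qed.

Lemma cder_opp f z l : cder f z l -> cder (fun w => - f w)%C z (- l)%C.
Proof.
  intros Hf. eapply clim_ext; [|exact (clim_opp _ _ _ Hf)].
  intros w Hw. cbv beta. field. now apply Cminus_neq_0.
Qed.

Lemma cder_minus f g z l m : cder f z l -> cder g z m -> cder (fun w => f w - g w)%C z (l - m)%C.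
Proof. intros. apply cder_plus; auto. now apply cder_opp. Qed.

Lemma cder_mult f g z l m : cder f z l -> cder g z m ->
  cder (fun w => f w * g w)%C z (l * g z + f z * m)%C.
Proof.
  intros Hf Hg.
  apply clim_ext with (fun w => (f w - f z) / (w - z) * g w + f z * ((g w - g z) / (w - z)))%C.
  { intros w Hw. field. now apply Cminus_neq_0. }
  apply clim_plus; apply clim_mult; auto. { exact (cder_cont _ _ _ Hg). } apply clim_const.
Qed.

Lemma cder_inv f z l : cder f z l -> f z <> 0 -> cder (fun w => / f w)%C z (- l / f z ^ 2)%C.
Proof.
  intros Hf Hz. pose proof (cder_cont _ _ _ Hf) as Hc.
  apply clim_ext_near with (fun w => - ((f w - f z) / (w - z)) / (f w * f z))%C.
  { apply (near_mono _ _ _ (clim_neq_0 _ _ _ Hc Hz)). intros w Hw H. field.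
    repeat split; auto. now apply Cminus_neq_0. }
  replace (f z ^ 2)%C with (f z * f z)%C by ring.
  apply clim_div. { now apply clim_opp. }
  - apply clim_mult; [exact Hc | apply clim_const].
  - now apply Cmult_neq_0.
Qed.

Lemma cder_comp f g z l m : cder g z m -> cder f (g z) l -> cder (fun w => f (g w)) z (l * m)%C.
Proof.
  intros Hg Hf.
  (* Caratheodory's difference quotient, filled in with [l] at [g z]: it is continuous there, and
     the points where [g w = g z] cause no division by zero. *)
  set (q := fun y => if excluded_middle_informative (y = g z) then l
                     else ((f y - f (g z)) / (y - g z))%C).
  assert (Hq : q (g z) = l).
  { unfold q. destruct (excluded_middle_informative _); tauto. }
  apply clim_ext with (fun w => q (g w) * ((g w - g z) / (w - z)))%C.
  { intros w Hw. pose proof (Cminus_neq_0 _ _ Hw). unfold q.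
    destruct (excluded_middle_informative (g w = g z)) as [E|E].
    - rewrite E. field. auto.
    - pose proof (Cminus_neq_0 _ _ E). field. auto. }
  apply clim_mult; auto.
  apply clim_comp with (g z); [exact (cder_cont _ _ _ Hg)| |now right].
  eapply clim_ext; [|exact Hf].
  intros w Hw. unfold q. destruct (excluded_middle_informative (w = g z)); tauto.
Qed.

Lemma cder_eq f z l m : cder f z l -> l = m -> cder f z m.
Proof. now intros H <-. Qed.

Lemma cder_scal a f z l : cder f z l -> cder (fun w => a * f w)%C z (a * l)%C.
Proof.
  intros H. eapply cder_eq. { apply cder_mult; [apply cder_const | exact H]. } cbv beta. ring.
Qed.

Lemma cder_pow f z l n : cder f z l -> cder (fun w => f w ^ n)%C z (INR n * l * f z ^ (pred n))%C.
Proof.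
  intros H. induction n as [|n IH].
  - eapply cder_eq. { exact (cder_const 1 z). } simpl. ring.
  - eapply cder_eq. { apply (cder_mult f (fun w => f w ^ n)%C); [exact H | exact IH]. }
    rewrite S_INR, RtoC_plus. destruct n; simpl; ring.
Qed.

Lemma cder_eps f z l e : cder f z l -> 0 < e ->
  exists d, 0 < d /\ forall h, Cmod h < d -> Cmod (f (z + h) - f z - l * h)%C <= e * Cmod h.
Proof.
  intros H He. destruct (H e He) as (d & Hd & K). exists d. split; auto.
  intros h Hh. destruct (classic (h = 0)) as [E|E].
  - rewrite E. replace (z + 0)%C with z by ring.
    replace (f z - f z - l * 0)%C with (RtoC 0) by ring. rewrite Cmod_0. lra.
  - assert (A : (z + h)%C <> z).
    { intros F. apply E. replace h with (z + h - z)%C by ring. rewrite F. ring. }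
    specialize (K (z + h)%C A). replace (z + h - z)%C with h in K by ring.
    specialize (K Hh).
    replace (f (z + h) - f z - l * h)%C with (((f (z + h) - f z) / h - l) * h)%C by (field; auto).
    rewrite Cmod_mult. apply Rmult_le_compat_r; auto using Cmod_ge_0. lra.
Qed.

Lemma cder_of_eps f z l :
  (forall e, 0 < e -> exists d, 0 < d /\
     forall h, Cmod h < d -> Cmod (f (z + h) - f z - l * h)%C <= e * Cmod h) -> cder f z l.
Proof.
  intros H e He. destruct (H (e / 2) ltac:(lra)) as (d & Hd & K). exists d. split; auto.
  intros w Hw Hwd. specialize (K (w - z)%C Hwd). replace (z + (w - z))%C with w in K by ring.
  pose proof (Cminus_neq_0 _ _ Hw) as N. pose proof (proj1 (Cmod_gt_0 _) N).
  replace ((f w - f z) / (w - z) - l)%C with ((f w - f z - l * (w - z)) / (w - z))%C by (field; auto).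
  rewrite Cmod_div by auto. apply Rlt_div_l; nra.
Qed.

(** Quadratic remainder bounds survive summation, which makes this criterion the tool for
    differentiating series term by term; it also gives the derivative of the exponential. *)
Lemma cder_of_quadratic f z l d M :
  0 < d -> (forall h, Cmod h < d -> Cmod (f (z + h) - f z - l * h)%C <= M * Cmod h ^ 2) ->
  cder f z l.
Proof.
  intros Hd H. apply cder_of_eps. intros e He.
  exists (Rmin d (e / (Rabs M + 1))). pose proof (Rabs_pos M). split.
  { apply Rmin_pos; auto. apply Rdiv_lt_0_compat; lra. }
  intros h Hh. pose proof (Rmin_l d (e / (Rabs M + 1))). pose proof (Rmin_r d (e / (Rabs M + 1))).
  eapply Rle_trans. { apply H. lra. }
  pose proof (Cmod_ge_0 h). pose proof (Rle_abs M).
  assert (Cmod h * (Rabs M + 1) <= e).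
  { apply Rle_div_r; lra. }
  apply Rle_trans with ((Rabs M + 1) * Cmod h ^ 2); [|nra].
  apply Rmult_le_compat_r; nra.
Qed.

Lemma ccont_const a z : ccont (fun _ => a) z.
Proof. apply clim_const. Qed.
Lemma ccont_id z : ccont (fun w => w) z.
Proof. apply clim_id. Qed.
Lemma ccont_plus f g z : ccont f z -> ccont g z -> ccont (fun w => f w + g w)%C z.
Proof. apply clim_plus. Qed.
Lemma ccont_opp f z : ccont f z -> ccont (fun w => - f w)%C z.
Proof. apply clim_opp. Qed.
Lemma ccont_minus f g z : ccont f z -> ccont g z -> ccont (fun w => f w - g w)%C z.
Proof. apply clim_minus. Qed.
Lemma ccont_mult f g z : ccont f z -> ccont g z -> ccont (fun w => f w * g w)%C z.
Proof. apply clim_mult. Qed.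
Lemma ccont_inv f z : ccont f z -> f z <> 0 -> ccont (fun w => / f w)%C z.
Proof. apply clim_inv. Qed.
Lemma ccont_pow f z n : ccont f z -> ccont (fun w => f w ^ n)%C z.
Proof. apply clim_pow. Qed.
Lemma ccont_eps f z e : ccont f z -> 0 < e ->
  exists d, 0 < d /\ forall w, Cmod (w - z) < d -> Cmod (f w - f z) < e.
Proof.
  intros H He. destruct (H e He) as (d & Hd & K). exists d. split; auto. intros w Hw.
  destruct (classic (w = z)) as [->|E]; auto.
  replace (f z - f z)%C with (RtoC 0) by ring. now rewrite Cmod_0.
Qed.

(** ** Functions of a real variable *)

(** Componentwise, so that theorems on real functions apply to each part; [rder_eps] recovers the
    form with the modulus. *)
Definition rder (g : R -> C) (t : R) (l : C) : Prop :=
  is_derive (fun s => Re (g s)) t (Re l) /\ is_derive (fun s => Im (g s)) t (Im l).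

Definition rcont (g : R -> C) (t : R) : Prop :=
  continuous (fun s => Re (g s)) t /\ continuous (fun s => Im (g s)) t.

Lemma Cmod_le_components (z : C) : Cmod z <= Rabs (Re z) + Rabs (Im z).
Proof.
  replace z with (RtoC (Re z) + Ci * RtoC (Im z))%C at 1.
  - eapply Rle_trans. { apply Cmod_triangle. }
    rewrite Cmod_mult, Cmod_Ci, !Cmod_R. lra.
  - destruct z. unfold RtoC, Ci, Cplus, Cmult. simpl. f_equal; ring.
Qed.

Lemma im_le_Cmod (z : C) : Rabs (Im z) <= Cmod z.
Proof. eapply Rle_trans; [apply Rmax_r | apply Rmax_Cmod]. Qed.

Lemma is_derive_eps (f : R -> R) t l :
  is_derive f t l <-> forall e, 0 < e -> exists d, 0 < d /\
    forall h, Rabs h < d -> Rabs (f (t + h) - f t - l * h) <= e * Rabs h.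
Proof.
  split.
  - intros H e He. apply is_derive_Reals in H. destruct (H e He) as (d & K).
    exists d. split. { apply cond_pos. } intros h Hh.
    destruct (Req_dec h 0) as [->|E].
    { rewrite Rplus_0_r. replace (f t - f t - l * 0) with 0 by ring. rewrite Rabs_R0. lra. }
    specialize (K h E Hh).
    replace (f (t + h) - f t - l * h) with (((f (t + h) - f t) / h - l) * h) by (field; auto).
    rewrite Rabs_mult. apply Rmult_le_compat_r; [apply Rabs_pos|lra].
  - intros H. apply is_derive_Reals. intros e He.
    destruct (H (e / 2) ltac:(lra)) as (d & Hd & K).
    exists (mkposreal d Hd). simpl. intros h Eh Hh. specialize (K h Hh).
    replace ((f (t + h) - f t) / h - l) with ((f (t + h) - f t - l * h) / h) by (field; auto).
    pose proof (Rabs_pos_lt h Eh).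
    rewrite Rabs_div by auto. apply Rlt_div_l; nra.
Qed.

Lemma rder_eps g t l : rder g t l <-> forall e, 0 < e -> exists d, 0 < d /\
    forall h : R, Rabs h < d -> Cmod (g (t + h)%R - g t - l * h)%C <= e * Rabs h.
Proof.
  assert (ER : forall h, Re (g (t + h)%R - g t - l * h)%C = Re (g (t + h)%R) - Re (g t) - Re l * h).
  { intros. unfold Cminus, Cplus, Copp, Cmult, Re, RtoC. simpl. ring. }
  assert (EI : forall h, Im (g (t + h)%R - g t - l * h)%C = Im (g (t + h)%R) - Im (g t) - Im l * h).
  { intros. unfold Cminus, Cplus, Copp, Cmult, Im, RtoC. simpl. ring. }
  split.
  - intros [H1 H2] e He. apply is_derive_eps with (e := e/2) in H1; [|lra].
    apply is_derive_eps with (e := e/2) in H2; [|lra].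
    destruct H1 as (d1 & Hd1 & K1). destruct H2 as (d2 & Hd2 & K2).
    exists (Rmin d1 d2). split. { now apply Rmin_pos. }
    intros h Hh. pose proof (Rmin_l d1 d2). pose proof (Rmin_r d1 d2).
    eapply Rle_trans. { apply Cmod_le_components. } rewrite ER, EI.
    specialize (K1 h ltac:(lra)). specialize (K2 h ltac:(lra)). lra.
  - intros H. split; apply is_derive_eps; intros e He; destruct (H e He) as (d & Hd & K);
      exists d; (split; [auto|]); intros h Hh; eapply Rle_trans; [|apply (K h Hh)| |apply (K h Hh)].
    + rewrite <- ER. apply re_le_Cmod.
    + rewrite <- EI. apply im_le_Cmod.
Qed.

Lemma rder_comp f g t l m : rder g t m -> cder f (g t) l -> rder (fun s => f (g s)) t (l * m)%C.
Proof.
  intros Hg Hf. apply rder_eps. intros e He.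
  set (Km := Cmod m + 1). set (Kl := Cmod l + 1).
  pose proof (Cmod_ge_0 m). pose proof (Cmod_ge_0 l).
  destruct (cder_eps _ _ _ (e / (2 * Km)) Hf) as (d1 & Hd1 & K1).
  { apply Rdiv_lt_0_compat; unfold Km; lra. }
  destruct (proj1 (rder_eps _ _ _) Hg (Rmin 1 (e / (2 * Kl)))) as (d2 & Hd2 & K2).
  { apply Rmin_pos; [lra|]. apply Rdiv_lt_0_compat; unfold Kl; lra. }
  exists (Rmin d2 (d1 / Km)). split.
  { apply Rmin_pos; auto. apply Rdiv_lt_0_compat; unfold Km; lra. }
  intros h Hh.
  pose proof (Rmin_l d2 (d1/Km)). pose proof (Rmin_r d2 (d1/Km)).
  pose proof (Rmin_l 1 (e / (2 * Kl))). pose proof (Rmin_r 1 (e / (2 * Kl))).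
  specialize (K2 h ltac:(lra)). pose proof (Rabs_pos h).
  set (k := (g (t + h)%R - g t)%C).
  assert (Hk : Cmod k <= Km * Rabs h).
  { unfold k. replace (g (t + h)%R - g t)%C with ((g (t + h)%R - g t - m * h) + m * h)%C by ring.
    eapply Rle_trans. { apply Cmod_triangle. } rewrite Cmod_mult, Cmod_R.
    unfold Km. nra. }
  assert (Hk' : Cmod k < d1).
  { apply Rle_lt_trans with (1 := Hk).
    apply Rlt_le_trans with (Km * (d1 / Km)).
    - apply Rmult_lt_compat_l; unfold Km in *; lra.
    - right. field. unfold Km; lra. }
  specialize (K1 k Hk').
  replace (g (t + h)%R) with (g t + k)%C by (unfold k; ring).
  replace (f (g t + k) - f (g t) - l * m * h)%C
    with ((f (g t + k) - f (g t) - l * k) + l * (k - m * h))%C by ring.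
  eapply Rle_trans. { apply Cmod_triangle. } rewrite Cmod_mult. fold k in K2.
  apply Rle_trans with (e / (2 * Km) * (Km * Rabs h) + Kl * (e / (2 * Kl) * Rabs h)).
  - apply Rplus_le_compat.
    + eapply Rle_trans; [exact K1|]. apply Rmult_le_compat_l; auto.
      left. apply Rdiv_lt_0_compat; unfold Km; lra.
    + apply Rmult_le_compat; auto using Cmod_ge_0; [unfold Kl; lra|].
      eapply Rle_trans; [exact K2|]. apply Rmult_le_compat_r; lra.
  - right. field. unfold Km, Kl. lra.
Qed.

Lemma rcont_eps g t : rcont g t <-> forall e, 0 < e -> exists d, 0 < d /\
  forall s, Rabs (s - t) < d -> Cmod (g s - g t) < e.
Proof.
  assert (ER : forall s, Re (g s - g t)%C = Re (g s) - Re (g t)) by reflexivity.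
  assert (EI : forall s, Im (g s - g t)%C = Im (g s) - Im (g t)) by reflexivity.
  split.
  - intros [H1 H2] e He.
    destruct (proj1 (filterlim_locally _ _) H1 (mkposreal (e/2) ltac:(lra))) as (d1 & K1).
    destruct (proj1 (filterlim_locally _ _) H2 (mkposreal (e/2) ltac:(lra))) as (d2 & K2).
    exists (Rmin d1 d2). split. { apply Rmin_pos; apply cond_pos. }
    intros s Hs. pose proof (Rmin_l d1 d2). pose proof (Rmin_r d1 d2).
    specialize (K1 s ltac:(apply Rlt_le_trans with (1 := Hs); auto)).
    specialize (K2 s ltac:(apply Rlt_le_trans with (1 := Hs); auto)).
    eapply Rle_lt_trans. { apply Cmod_le_components. } rewrite ER, EI.
    cbv in K1, K2 |- *. unfold Rminus in *. cbv in K1, K2. lra.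
  - intros H. split; apply filterlim_locally; intros [e He]; destruct (H e He) as (d & Hd & K);
      exists (mkposreal d Hd); intros s Hs; specialize (K s Hs);
      (eapply Rle_lt_trans; [|exact K]).
    + apply (re_le_Cmod (g s - g t)).
    + apply (im_le_Cmod (g s - g t)).
Qed.

Lemma rcont_comp f g t : rcont g t -> ccont f (g t) -> rcont (fun s => f (g s)) t.
Proof.
  intros Hg Hf. apply rcont_eps. intros e He.
  destruct (ccont_eps _ _ _ Hf He) as (d & Hd & K).
  destruct (proj1 (rcont_eps _ _) Hg d Hd) as (d' & Hd' & K').
  exists d'. split; auto.
Qed.

Lemma rder_rcont g t l : rder g t l -> rcont g t.
Proof.
  intros [H1 H2]; split.
  - apply (ex_derive_continuous (V := R_NormedModule) (fun s => Re (g s))). now exists (Re l).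
  - apply (ex_derive_continuous (V := R_NormedModule) (fun s => Im (g s))). now exists (Im l).
Qed.

Lemma rcont_mult f g t : rcont f t -> rcont g t -> rcont (fun s => f s * g s)%C t.
Proof.
  intros [F1 F2] [G1 G2]. split.
  - apply (continuous_minus (fun s => Re (f s) * Re (g s)) (fun s => Im (f s) * Im (g s)));
      apply (continuous_mult (K := R_AbsRing)); auto.
  - apply (continuous_plus (fun s => Re (f s) * Im (g s)) (fun s => Im (f s) * Re (g s)));
      apply (continuous_mult (K := R_AbsRing)); auto.
Qed.

Lemma rder_ext g h t l : (forall s, g s = h s) -> rder g t l -> rder h t l.
Proof.
  intros E [H1 H2]. split; [apply (is_derive_ext (fun s => Re (g s)))
    | apply (is_derive_ext (fun s => Im (g s)))]; auto; intros; now rewrite E.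
Qed.

Lemma rder_plus f g t l m : rder f t l -> rder g t m -> rder (fun s => f s + g s)%C t (l + m)%C.
Proof. intros [F1 F2] [G1 G2]. split; apply (is_derive_plus (V := R_NormedModule)); auto. Qed.

Lemma rder_const a t : rder (fun _ => a) t 0.
Proof. split; apply (is_derive_const (V := R_NormedModule)). Qed.

Lemma rder_mult f g t l m : rder f t l -> rder g t m ->
  rder (fun s => f s * g s)%C t (l * g t + f t * m)%C.
Proof.
  intros [F1 F2] [G1 G2].
  pose proof (fun a b u v x y => is_derive_mult (K := R_AbsRing) a b t u v x y Rmult_comm) as HM.
  split.
  - apply (is_derive_ext (fun s => Re (f s) * Re (g s) - Im (f s) * Im (g s))); [reflexivity|].
    pose proof (is_derive_minus (V := R_NormedModule) _ _ _ _ _ (HM _ _ _ _ F1 G1) (HM _ _ _ _ F2 G2)) as H.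
    match type of H with is_derive _ _ ?v =>
      replace (Re (l * g t + f t * m)%C) with v; [exact H|] end.
    unfold minus, plus, opp, mult, Re, Im; simpl. ring.
  - apply (is_derive_ext (fun s => Re (f s) * Im (g s) + Im (f s) * Re (g s))); [reflexivity|].
    pose proof (is_derive_plus (V := R_NormedModule) _ _ _ _ _ (HM _ _ _ _ F1 G2) (HM _ _ _ _ F2 G1)) as H.
    match type of H with is_derive _ _ ?v =>
      replace (Im (l * g t + f t * m)%C) with v; [exact H|] end.
    unfold plus, mult, Re, Im; simpl. ring.
Qed.

Lemma rder_eq g t l m : rder g t l -> l = m -> rder g t m.
Proof. now intros H <-. Qed.

Lemma rder_RtoC t : rder RtoC t 1.
Proof. split; simpl; [apply (is_derive_id (K := R_AbsRing)) | apply (is_derive_const (V := R_NormedModule))]. Qed.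

Definition seg (a b : C) (t : R) : C := (a + t * (b - a))%C.

Lemma rder_seg a b t : rder (seg a b) t (b - a)%C.
Proof.
  eapply rder_eq.
  - apply rder_plus; [apply rder_const|].
    apply rder_mult; [apply rder_RtoC | apply rder_const].
  - cbv beta. ring.
Qed.

Lemma mean_value_rder (g dg : R -> C) (M a b : R) :
  a <= b ->
  (forall t, a <= t <= b -> rder g t (dg t)) ->
  (forall t, a <= t <= b -> Cmod (dg t) <= M) ->
  Cmod (g b - g a) <= M * (b - a).
Proof.
  intros Hab Hd HM.
  (* Multiplication by the conjugate of the increment turns the increment into the square of its
     modulus, so the real mean value theorem applies to one real function and no factor 2 is lost on
     the components. *)
  set (u := Cconj (g b - g a)%C).
  assert (HuR : forall w, Re (u * w)%C <= Cmod u * Cmod w).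
  { intros w. rewrite <- Cmod_mult. eapply Rle_trans; [apply Rle_abs | apply re_le_Cmod]. }
  destruct (MVT_gen (fun t => Re (u * g t)%C) a b (fun t => Re (u * dg t)%C)) as (c & Hc & E).
  - intros x Hx. rewrite Rmin_left, Rmax_right in Hx by auto.
    assert (H : rder (fun s => u * g s)%C x (u * dg x)%C).
    { eapply rder_eq; [apply rder_mult; [apply rder_const | apply Hd; lra]|]. cbv beta. ring. }
    exact (proj1 H).
  - intros x Hx. rewrite Rmin_left, Rmax_right in Hx by auto.
    apply continuity_pt_filterlim.
    destruct (rder_rcont _ _ _ (rder_mult (fun _ => u) g x 0 (dg x) (rder_const _ _) (Hd x Hx))) as [H _].
    exact H.
  - rewrite Rmin_left, Rmax_right in Hc by auto.
    assert (E2 : Re (u * g b)%C - Re (u * g a)%C = Cmod u * Cmod u).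
    { replace (Re (u * g b)%C - Re (u * g a)%C) with (Re (u * (g b - g a))%C)
        by (unfold Re, Cmult, Cminus, Cplus, Copp; simpl; ring).
      unfold u. rewrite Cmult_comm, <- Cmod2_conj, Cmod_conj. simpl. ring. }
    rewrite E2 in E. pose proof (HuR (dg c)). specialize (HM c Hc).
    assert (Eu : Cmod u = Cmod (g b - g a)) by apply Cmod_conj. rewrite <- Eu.
    pose proof (Cmod_ge_0 u). pose proof (Cmod_ge_0 (dg c)).
    destruct (Req_dec (Cmod u) 0) as [Z|Z]. { rewrite Z. apply Rmult_le_pos; lra. }
    apply Rmult_le_reg_l with (Cmod u); [lra|].
    rewrite E. apply Rle_trans with (Cmod u * Cmod (dg c) * (b - a)); [nra|].
    assert (Cmod u * Cmod (dg c) <= Cmod u * M) by nra. nra.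
Qed.

Lemma mean_value_seg (f f' : C -> C) (a b : C) (M : R) :
  (forall t, 0 <= t <= 1 -> cder f (seg a b t) (f' (seg a b t))) ->
  (forall t, 0 <= t <= 1 -> Cmod (f' (seg a b t)) <= M) ->
  Cmod (f b - f a) <= M * Cmod (b - a).
Proof.
  intros Hf HM.
  pose proof (mean_value_rder (fun t => f (seg a b t)) (fun t => f' (seg a b t) * (b - a))%C
    (M * Cmod (b - a)) 0 1 ltac:(lra)) as H. cbv beta in H.
  replace (seg a b 1) with b in H by (unfold seg; ring).
  replace (seg a b 0) with a in H by (unfold seg; ring).
  replace (M * Cmod (b - a) * (1 - 0)) with (M * Cmod (b - a)) in H by ring.
  apply H.
  - intros t Ht. apply rder_comp; auto. apply rder_seg.
  - intros t Ht. rewrite Cmod_mult. apply Rmult_le_compat_r; auto using Cmod_ge_0.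
Qed.

Lemma seg_in_ball (a b : C) (t : R) : 0 <= t <= 1 -> Cmod (seg a b t - a) <= Cmod (b - a).
Proof.
  intros Ht. unfold seg. replace (a + t * (b - a) - a)%C with (t * (b - a))%C by ring.
  rewrite Cmod_mult, Cmod_R, Rabs_pos_eq by lra. pose proof (Cmod_ge_0 (b - a)). nra.
Qed.

(** The mean value inequality for [f1] bounds the derivative of [w => f w - f1 z * w] by
    [M * Cmod h]; applied again to that function it gives the claim. *)
Lemma quadratic_remainder (f f1 f2 : C -> C) (z h : C) (M : R) :
  0 <= M ->
  (forall k, Cmod k <= Cmod h -> cder f (z + k)%C (f1 (z + k)%C)) ->
  (forall k, Cmod k <= Cmod h -> cder f1 (z + k)%C (f2 (z + k)%C)) ->
  (forall k, Cmod k <= Cmod h -> Cmod (f2 (z + k)%C) <= M) ->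
  Cmod (f (z + h) - f z - f1 z * h)%C <= M * Cmod h ^ 2.
Proof.
  intros HM Hf Hf1 Hf2.
  assert (S : forall k t, 0 <= t <= 1 -> exists k', seg z (z + k)%C t = (z + k')%C /\ Cmod k' <= Cmod k).
  { intros k t Ht. exists (seg z (z + k) t - z)%C. split; [ring|].
    replace k with (z + k - z)%C at 2 by ring. now apply seg_in_ball. }
  assert (B : forall k, Cmod k <= Cmod h -> Cmod (f1 (z + k)%C - f1 z)%C <= M * Cmod h).
  { intros k Hk. eapply Rle_trans. { apply (mean_value_seg f1 f2 z (z + k)%C M).
    - intros t Ht. destruct (S k t Ht) as (k' & -> & Hk'). apply Hf1. lra.
    - intros t Ht. destruct (S k t Ht) as (k' & -> & Hk'). apply Hf2. lra. }
    replace (z + k - z)%C with k by ring. nra. }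
  pose proof (mean_value_seg (fun w => f w - f1 z * w)%C (fun w => f1 w - f1 z)%C z (z + h)%C (M * Cmod h)) as H.
  replace (f (z + h) - f z - f1 z * h)%C
    with (f (z + h) - f1 z * (z + h) - (f z - f1 z * z))%C by ring.
  eapply Rle_trans. { apply H.
    - intros t Ht. destruct (S h t Ht) as (k' & -> & Hk'). eapply cder_eq.
      { apply cder_minus; [apply Hf; lra|]. apply cder_scal. apply cder_id. } cbv beta. ring.
    - intros t Ht. destruct (S h t Ht) as (k' & -> & Hk'). apply B. lra. }
  replace (z + h - z)%C with h by ring. right. ring.
Qed.

(** ** The complex exponential *)

Lemma Cexp_plus (z w : C) : Cexp (z + w) = (Cexp z * Cexp w)%C.
Proof.
  unfold Cexp, Cmult, Cplus, Re, Im; simpl.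
  rewrite exp_plus, cos_plus, sin_plus. f_equal; ring.
Qed.

Lemma Cexp_0 : Cexp 0 = 1.
Proof. unfold Cexp, Re, Im; simpl. rewrite exp_0, cos_0, sin_0. unfold RtoC. f_equal; ring. Qed.

Lemma Cmod_Cexp (z : C) : Cmod (Cexp z) = exp (Re z).
Proof.
  unfold Cexp, Cmod; simpl.
  pose proof (sin2_cos2 (Im z)) as H. unfold Rsqr in H.
  replace (_ + _) with (exp (Re z) * exp (Re z)).
  - apply sqrt_square. left. apply exp_pos.
  - transitivity (exp (Re z) * exp (Re z) * (sin (Im z) * sin (Im z) + cos (Im z) * cos (Im z))).
    { rewrite H. ring. } ring.
Qed.

Lemma Cexp_neq_0 (z : C) : Cexp z <> 0.
Proof. apply Cmod_gt_0. rewrite Cmod_Cexp. apply exp_pos. Qed.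

Lemma Cexp_opp (z : C) : Cexp (- z) = (/ Cexp z)%C.
Proof.
  assert (H : (Cexp (- z) * Cexp z)%C = 1).
  { rewrite <- Cexp_plus, <- Cexp_0. f_equal. ring. }
  pose proof (Cexp_neq_0 z).
  replace (Cexp (- z)) with (Cexp (- z) * Cexp z * / Cexp z)%C by (field; auto).
  rewrite H. ring.
Qed.

(** Both bounds come from [1 + x <= exp x], used at [x] and at [- x]. *)
Lemma exp_remainder x : Rabs x <= 1 / 2 -> Rabs (exp x - 1 - x) <= 2 * x ^ 2.
Proof.
  intros H. apply Rabs_le_between in H.
  pose proof (exp_ineq1_le x). pose proof (exp_ineq1_le (- x)) as H1.
  rewrite exp_Ropp in H1. pose proof (exp_pos x).
  assert (H3 : exp x * (1 - x) <= 1).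
  { apply Rmult_le_reg_l with (/ exp x). { now apply Rinv_0_lt_compat. }
    rewrite <- Rmult_assoc, Rinv_l by lra. lra. }
  apply Rabs_le. split; [nra|]. 
  apply Rmult_le_reg_r with (1 - x); [lra|]. nra.
Qed.

Lemma cos_remainder y : Rabs (cos y - 1) <= y ^ 2 / 2.
Proof.
  replace y with (2 * (y / 2)) at 1 by field. rewrite cos_2a_sin.
  pose proof (Rsqr_le_abs_1 (sin (y / 2)) (y / 2)) as H. unfold Rsqr in H.
  assert (Rabs (sin (y / 2)) <= Rabs (y / 2)).
  { destruct (Rle_dec 0 (y / 2)) as [P|P].
    - rewrite (Rabs_pos_eq (y / 2)) by auto. apply Rabs_le.
      destruct (Rle_lt_or_eq_dec _ _ P) as [P'|<-]; [|rewrite sin_0; lra].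
      split; [|left; now apply sin_lt_x]. destruct (Rle_dec (y / 2) 1) as [Q|Q].
      + assert (0 <= sin (y / 2)); [|lra]. apply sin_ge_0; auto. pose proof PI2_1. lra.
      + pose proof (SIN_bound (y / 2)). lra.
    - rewrite (Rabs_left (y / 2)) by lra. apply Rabs_le.
      pose proof (sin_lt_x (- (y / 2)) ltac:(lra)) as S. rewrite sin_neg in S.
      split; [lra|]. destruct (Rle_dec (-1) (y / 2)) as [Q|Q].
      + assert (0 <= sin (- (y / 2))) as T; [|rewrite sin_neg in T; lra].
        apply sin_ge_0; [lra|]. pose proof PI2_1. lra.
      + pose proof (SIN_bound (y / 2)). lra. }
  apply Rsqr_le_abs_1 in H0. unfold Rsqr in H0.
  apply Rabs_le. nra.
Qed.

Lemma sin_remainder y : Rabs y <= 1 -> Rabs (sin y - y) <= y ^ 2.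
Proof.
  intros Hy.
  destruct (MVT_gen (fun t => sin t - t) 0 y (fun t => cos t - 1)) as (c & Hc & E).
  - intros x _. auto_derive; auto. ring.
  - intros x _. apply continuity_pt_minus; [apply continuity_sin|].
    apply continuity_pt_id.
  - rewrite sin_0 in E. replace (sin y - y) with ((cos c - 1) * y) by lra.
    rewrite Rabs_mult. pose proof (cos_remainder c).
    assert (Rabs c <= Rabs y).
    { revert Hc. unfold Rmin, Rmax. destruct (Rle_dec 0 y); intros Hc.
      - rewrite !Rabs_pos_eq; lra.
      - rewrite (Rabs_left y) by lra. apply Rabs_le. lra. }
    assert (c ^ 2 <= Rabs y).
    { rewrite <- pow2_abs. pose proof (Rabs_pos c). nra. }
    rewrite <- (pow2_abs y). pose proof (Rabs_pos y). pose proof (Rabs_pos (cos c - 1)). nra.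
Qed.

Lemma cder_Cexp z : cder Cexp z (Cexp z).
Proof.
  (* By the addition theorem it suffices to differentiate at 0, where the remainders of [exp], [cos]
     and [sin] combine to a quadratic bound; 20 is a crude constant. *)
  assert (H0 : cder (fun h => Cexp (z + h)) 0 (Cexp z)).
  { apply cder_ext with (fun h => Cexp z * Cexp h)%C. { intros; now rewrite Cexp_plus. }
    eapply cder_eq; [apply (cder_scal _ Cexp 0 1)|ring].
    apply cder_of_quadratic with (d := 1 / 2) (M := 20); [lra|].
    intros h Hh. rewrite Cexp_0. replace (0 + h)%C with h by ring.
    destruct h as [x y].
    pose proof (re_le_Cmod (x, y)) as Rx. pose proof (im_le_Cmod (x, y)) as Ry.
    unfold Re, Im in Rx, Ry; simpl in Rx, Ry. set (m := Cmod (x, y)) in *.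
    pose proof (exp_remainder x ltac:(lra)) as E. pose proof (cos_remainder y) as F.
    pose proof (sin_remainder y ltac:(lra)) as G.
    eapply Rle_trans. { apply Cmod_le_components. }
    unfold Cexp, Re, Im; simpl.
    assert (X : exp x <= 2).
    { apply Rabs_le_between in E. apply Rabs_le_between in Rx. nra. }
    pose proof (exp_pos x).
    assert (x ^ 2 <= m ^ 2 /\ y ^ 2 <= m ^ 2) as [X2 Y2].
    { rewrite <- (pow2_abs x), <- (pow2_abs y). pose proof (Rabs_pos x). pose proof (Rabs_pos y).
      split; apply pow_incr; lra. }
    replace (exp x * cos y + - (1) + - (1 * x - 0 * y)) with ((exp x - 1 - x) + exp x * (cos y - 1)) by ring.
    replace (exp x * sin y + - 0 + - (1 * y + 0 * x)) with ((exp x - 1 - x) * sin y + x * sin y + (sin y - y)) by ring.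
    assert (S : Rabs (sin y) <= 2 * m).
    { replace (sin y) with (sin y - y + y) by ring.
      eapply Rle_trans; [apply Rabs_triang|]. pose proof (Cmod_ge_0 (x, y)). fold m in H0.
      assert (m ^ 2 <= m) by nra. lra. }
    pose proof (Rabs_pos (sin y)). pose proof (Rabs_pos x). pose proof (Rabs_pos (exp x - 1 - x)).
    assert (P1 : Rabs (exp x - 1 - x + exp x * (cos y - 1)) <= 4 * m ^ 2).
    { eapply Rle_trans; [apply Rabs_triang|]. rewrite Rabs_mult, (Rabs_pos_eq (exp x)) by lra. nra. }
    assert (P2 : Rabs ((exp x - 1 - x) * sin y + x * sin y + (sin y - y)) <= 10 * m ^ 2).
    { eapply Rle_trans; [apply Rabs_triang|].
      assert (Rabs ((exp x - 1 - x) * sin y + x * sin y) <= 2 * m ^ 2 * 1 + m * (2 * m)).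
      { eapply Rle_trans; [apply Rabs_triang|]. rewrite !Rabs_mult.
        assert (m <= 1/2) by lra.
        apply Rplus_le_compat; apply Rmult_le_compat; lra. }
      nra. }
    nra. }
  apply cder_ext with (fun w => Cexp (z + (w - z))). { intros; f_equal; ring. }
  eapply cder_eq; [apply (cder_comp (fun h => Cexp (z + h)) (fun w => w - z)%C z (Cexp z) 1)|ring].
  - eapply cder_eq; [apply cder_minus; [apply cder_id|apply cder_const]|ring].
  - now replace (z - z)%C with (RtoC 0) by ring.
Qed.

(** ** Path integrals *)

Lemma is_derive_C_rder (g : R -> C) t l :
  is_derive (V := C_R_NormedModule) g t l <-> rder g t l.
Proof.
  split.
  - intros H. split.
    + apply (is_derive_ext (fun s => fst (g s))); [reflexivity|].
      apply (filterdiff_comp g fst _ fst) in H.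
      2:{ apply filterdiff_linear. apply is_linear_fst. }
      eapply filterdiff_ext_lin. { exact H. } reflexivity.
    + apply (is_derive_ext (fun s => snd (g s))); [reflexivity|].
      apply (filterdiff_comp g snd _ snd) in H.
      2:{ apply filterdiff_linear. apply is_linear_snd. }
      eapply filterdiff_ext_lin. { exact H. } reflexivity.
  - intros [H1 H2].
    apply (is_derive_ext (V := C_R_NormedModule) (fun s => (Re (g s), Im (g s)))).
    { intros s. now destruct (g s). }
    eapply filterdiff_ext_lin.
    + apply (filterdiff_comp_2 (T := AbsRing_NormedModule R_AbsRing) (U := R_NormedModule)
        (V := R_NormedModule) (W := C_R_NormedModule) (fun s => Re (g s)) (fun s => Im (g s)) (fun x y => (x, y))
        _ _ (fun x y => (x, y)) H1 H2).
      apply filterdiff_linear.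
      split; try reflexivity.
      exists 1. split; [lra|]. intros [x y]. rewrite Rmult_1_l. apply Rle_refl.
    + intros y. destruct l. reflexivity.
Qed.

Lemma continuous_C_rcont (g : R -> C) t : continuous g t <-> rcont g t.
Proof.
  split.
  - intros H. split; apply filterlim_locally; intros e;
      destruct (proj1 (filterlim_locally _ _) H e) as (d & K); exists d; intros s Hs;
      apply (K s Hs).
  - intros [H1 H2]. apply filterlim_locally. intros e.
    destruct (proj1 (filterlim_locally _ _) H1 e) as (d1 & K1).
    destruct (proj1 (filterlim_locally _ _) H2 e) as (d2 & K2).
    assert (P : 0 < Rmin d1 d2) by (apply Rmin_pos; apply cond_pos).
    exists (mkposreal _ P). intros s Hs. simpl in Hs. split; [apply K1 | apply K2];
      apply Rlt_le_trans with (1 := Hs); [apply Rmin_l | apply Rmin_r].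
Qed.

Notation is_RIntC := (is_RInt (V := C_R_NormedModule)).

Lemma is_RIntC_unique f a b I J : is_RIntC f a b I -> is_RIntC f a b J -> I = J.
Proof.
  intros HI HJ.
  rewrite <- (is_RInt_unique (V := C_R_CompleteNormedModule) _ _ _ _ HI).
  exact (is_RInt_unique (V := C_R_CompleteNormedModule) _ _ _ _ HJ).
Qed.

Lemma rcont_primitive (h : R -> C) : (forall t, rcont h t) ->
  exists J : R -> C, J 0 = RtoC 0 /\ (forall t, rder J t (h t)) /\
    forall a b, is_RIntC h a b (J b - J a)%C.
Proof.
  intros Hh.
  assert (HC : forall t, continuous (U := C_R_NormedModule) h t).
  { intros t. apply continuous_C_rcont, Hh. }
  assert (HI : forall a b, is_RIntC h a b (RInt (V := C_R_CompleteNormedModule) h a b)).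
  { intros a b. apply (RInt_correct (V := C_R_CompleteNormedModule)).
    apply (ex_RInt_continuous (V := C_R_CompleteNormedModule)). intros; apply HC. }
  set (J := fun t => RInt (V := C_R_CompleteNormedModule) h 0 t).
  assert (HJ : forall t, rder J t (h t)).
  { intros t. apply is_derive_C_rder.
    apply (is_derive_RInt (V := C_R_NormedModule) h J 0 t); [|apply HC].
    exists (mkposreal 1 Rlt_0_1). intros y _. apply HI. }
  assert (H0 : J 0 = RtoC 0).
  { unfold J. rewrite (RInt_point (V := C_R_CompleteNormedModule)). reflexivity. }
  exists J. split; [exact H0|]. split; [exact HJ|].
  intros a b.
  replace (J b - J a)%C with (- J a + J b)%C by ring.
  apply (is_RInt_Chasles (V := C_R_NormedModule) h a 0 b (- J a)%C (J b)).
  - apply (is_RInt_swap (V := C_R_NormedModule)). apply HI.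
  - apply HI.
Qed.

(** A path stays in [U] only for parameters in [0, 1], while a primitive is wanted on the whole
    line. Composing the integrand with [clamp] makes it continuous everywhere without changing it on
    [0, 1]. *)
Definition clamp (t : R) : R := Rmax 0 (Rmin 1 t).

Lemma clamp_in t : 0 <= clamp t <= 1.
Proof. unfold clamp, Rmax, Rmin. repeat destruct (Rle_dec _ _); lra. Qed.

Lemma clamp_id t : 0 <= t <= 1 -> clamp t = t.
Proof. unfold clamp, Rmax, Rmin. repeat destruct (Rle_dec _ _); lra. Qed.

Lemma rcont_clamp (g : R -> C) t : rcont g (clamp t) -> rcont (fun s => g (clamp s)) t.
Proof.
  intros H. apply rcont_eps. intros e He.
  destruct (proj1 (rcont_eps _ _) H e He) as (d & Hd & K). exists d. split; auto.
  intros s Hs. apply K. apply Rle_lt_trans with (2 := Hs).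
  unfold clamp, Rmax, Rmin, Rabs.
  repeat destruct (Rle_dec _ _); repeat destruct (Rcase_abs _); lra.
Qed.

Lemma C1_path_primitive U f gam dgam a c :
  C1_path U gam dgam a c -> (forall z, U z -> ccont f z) ->
  exists J : R -> C, J 0 = RtoC 0 /\
    (forall t, 0 <= t <= 1 -> rder J t (f (gam t) * dgam t)%C) /\
    is_RIntC (fun t => f (gam t) * dgam t)%C 0 1 (J 1).
Proof.
  intros (H1 & H2 & H3 & H4 & H5) Hf.
  set (h := fun t => (f (gam t) * dgam t)%C).
  assert (Hh : forall t, 0 <= t <= 1 -> rcont h t).
  { intros t Ht. apply rcont_mult.
    - apply rcont_comp; [|apply Hf; auto].
      eapply rder_rcont. apply is_derive_C_rder. apply H1.
    - apply continuous_C_rcont, H2. }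
  destruct (rcont_primitive (fun t => h (clamp t))) as (J & J0 & J1 & J2).
  { intros t. apply rcont_clamp. apply Hh, clamp_in. }
  exists J. split; [exact J0|]. split.
  - intros t Ht. rewrite <- (clamp_id t Ht) at 2 3. apply J1.
  - replace (J 1) with (J 1 - J 0)%C by (rewrite J0; ring).
    apply (is_RInt_ext (V := C_R_NormedModule) (fun t => h (clamp t))); [|apply J2].
    intros t Ht. rewrite Rmin_left, Rmax_right in Ht by lra. rewrite clamp_id by lra. reflexivity.
Qed.

(** On each smooth piece, [P (gam t) * Cexp (- K t)] has derivative zero, where [K] is the running
    integral. No logarithm of [P] has to be chosen. *)
Lemma path_integral_log U f P a c I :
  (forall z, U z -> ccont f z) -> (forall z, U z -> cder P z (f z * P z)%C) ->
  path_integral U f a c I -> P c = (P a * Cexp I)%C.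
Proof.
  intros Hf HP HI. induction HI as [a Ha | a c d gam dgam I J Hgam HI _ IH].
  - rewrite Cexp_0. ring.
  - rewrite IH, Cexp_plus.
    destruct (C1_path_primitive _ _ _ _ _ _ Hgam Hf) as (K & K0 & K1 & K2).
    destruct Hgam as (H1 & H2 & H3 & H4 & H5).
    rewrite (is_RIntC_unique _ _ _ _ _ HI K2).
    set (Q := fun t => (P (gam t) * Cexp (- K t))%C).
    assert (E : Cmod (Q 1 - Q 0)%C <= 0 * (1 - 0)).
    { apply (mean_value_rder Q (fun _ => RtoC 0)); [lra| |].
      - intros t Ht. eapply rder_eq.
        + apply rder_mult.
          * apply rder_comp; [apply is_derive_C_rder, H1 | apply HP, H5, Ht].
          * apply (rder_comp Cexp (fun s => - K s)%C).
            -- apply rder_ext with (fun s => -1 * K s)%C. { intros; ring. }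
               apply rder_mult; [apply rder_const | apply K1, Ht].
            -- apply cder_Cexp.
        + cbv beta. ring.
      - intros. rewrite Cmod_0. lra. }
    replace (0 * (1 - 0)) with 0 in E by ring.
    assert (E' : Q 1 = Q 0) by (apply Cmod_eq_of_le; intros; lra).
    unfold Q in E'. rewrite K0, H3, H4 in E'.
    replace (- 0)%C with (RtoC 0) in E' by ring. rewrite Cexp_0, Cmult_1_r, Cexp_opp in E'.
    rewrite <- E'. field. apply Cexp_neq_0.
Qed.

Lemma path_integral_primitive U f F a c I :
  (forall z, U z -> ccont f z) -> (forall z, U z -> cder F z (f z)) ->
  path_integral U f a c I -> I = (F c - F a)%C.
Proof.
  intros Hf HF HI. induction HI as [a Ha | a c d gam dgam I J Hgam HI _ IH].
  - ring.
  - destruct (C1_path_primitive _ _ _ _ _ _ Hgam Hf) as (K & K0 & K1 & K2).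
    destruct Hgam as (H1 & H2 & H3 & H4 & H5).
    rewrite (is_RIntC_unique _ _ _ _ _ HI K2), IH.
    set (Q := fun t => (F (gam t) + -1 * K t)%C).
    assert (E : Cmod (Q 1 - Q 0)%C <= 0 * (1 - 0)).
    { apply (mean_value_rder Q (fun _ => RtoC 0)); [lra| |].
      - intros t Ht. eapply rder_eq.
        + apply rder_plus.
          * apply rder_comp; [apply is_derive_C_rder, H1 | apply HF, H5, Ht].
          * apply rder_mult; [apply rder_const | apply K1, Ht].
        + cbv beta. ring.
      - intros. rewrite Cmod_0. lra. }
    replace (0 * (1 - 0)) with 0 in E by ring.
    assert (E' : Q 1 = Q 0) by (apply Cmod_eq_of_le; intros; lra).
    unfold Q in E'. rewrite K0, H3, H4 in E'.
    replace (K 1) with (F c - (F c + -1 * K 1))%C by ring. rewrite E'. ring.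
Qed.

Lemma path_integral_start U f a c I : path_integral U f a c I -> U a.
Proof.
  intros [b Hb | b d e gam dgam J K (H1 & H2 & H3 & H4 & H5) _ _]; auto.
  rewrite <- H3. apply H5. lra.
Qed.

Lemma path_integral_app U f a c d I J :
  path_integral U f a c I -> path_integral U f c d J -> path_integral U f a d (I + J)%C.
Proof.
  intros H. revert d J. induction H as [a Ha | a c d gam dgam I K Hgam HI _ IH]; intros e J HJ.
  - replace (0 + J)%C with J by ring. exact HJ.
  - replace (I + K + J)%C with (I + (K + J))%C by ring.
    eapply path_integral_cons; eauto.
Qed.

Lemma path_integral_ext (U : C -> Prop) (f g : C -> C) a c I : (forall z, U z -> f z = g z) ->
  path_integral U f a c I -> path_integral U g a c I.
Proof.
  intros E H. induction H as [a Ha | a c d gam dgam I K Hgam HI _ IH].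
  - now constructor.
  - eapply path_integral_cons; eauto.
    apply (is_RInt_ext (V := C_R_NormedModule) (fun t => f (gam t) * dgam t)%C); auto.
    intros t Ht. rewrite Rmin_left, Rmax_right in Ht by lra. rewrite E; auto.
    apply Hgam. lra.
Qed.

Lemma path_integral_shift (U : C -> Prop) (f : C -> C) a c I w : (forall z, U z -> U (z + w)%C) ->
  (forall z, U z -> f (z + w)%C = f z) ->
  path_integral U f a c I -> path_integral U f (a + w)%C (c + w)%C I.
Proof.
  intros HU E H. induction H as [a Ha | a c d gam dgam I K Hgam HI _ IH].
  - constructor. auto.
  - destruct Hgam as (H1 & H2 & H3 & H4 & H5).
    apply path_integral_cons with (c + w)%C (fun t => gam t + w)%C dgam; auto.
    + split; [|split; [exact H2|split; [congruence|split; [congruence|auto]]]].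
      intros t. apply is_derive_C_rder. eapply rder_eq.
      { apply rder_plus; [apply is_derive_C_rder, H1 | apply rder_const]. } ring.
    + apply (is_RInt_ext (V := C_R_NormedModule) (fun t => f (gam t) * dgam t)%C); auto.
      intros t Ht. rewrite Rmin_left, Rmax_right in Ht by lra. rewrite E; auto.
      apply H5. lra.
Qed.

Lemma C1_path_seg (U : C -> Prop) a c : (forall t, 0 <= t <= 1 -> U (seg a c t)) ->
  C1_path U (seg a c) (fun _ => (c - a)%C) a c.
Proof.
  intros HU. split; [|split; [|split; [|split]]]; auto.
  - intros t. apply is_derive_C_rder, rder_seg.
  - intros t. apply continuous_const.
  - unfold seg. ring.
  - unfold seg. ring.
Qed.

Lemma path_integral_seg (U : C -> Prop) (f : C -> C) a c :
  (forall t, 0 <= t <= 1 -> U (seg a c t)) ->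
  (forall z, U z -> ccont f z) ->
  exists J : R -> C, J 0 = RtoC 0 /\
    (forall t, 0 <= t <= 1 -> rder J t (f (seg a c t) * (c - a))%C) /\
    path_integral U f a c (J 1).
Proof.
  intros HU Hf. assert (E1 : seg a c 1 = c) by (unfold seg; ring).
  destruct (C1_path_primitive U f _ _ _ _ (C1_path_seg U a c HU) Hf) as (J & J0 & J1 & J2).
  exists J. split; [exact J0|]. split; [exact J1|].
  replace (J 1) with (J 1 + 0)%C by ring.
  eapply path_integral_cons; [exact (C1_path_seg U a c HU) | exact J2 |].
  constructor. rewrite <- E1. apply HU. lra.
Qed.

(** * Paths that avoid a locally finite set *)

Definition locally_finite (S : C -> Prop) : Prop :=
  forall r : R, exists l : list C, forall w, S w -> Cmod w <= r -> In w l.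

Lemma exists_not_in_list (l : list R) : forall a b, a < b -> exists s, a <= s <= b /\ ~ In s l.
Proof.
  induction l as [|x l IH]; intros a b Hab.
  - exists a. split; [lra|auto].
  - destruct (Rle_dec x ((a + b) / 2)) as [H|H].
    + destruct (IH ((a + 3 * b) / 4) b ltac:(lra)) as (s & Hs & Ns).
      exists s. split; [lra|]. intros [E|E]; [lra|auto].
    + destruct (IH a ((a + b) / 2) ltac:(lra)) as (s & Hs & Ns).
      exists s. split; [lra|]. intros [E|E]; [lra|auto].
Qed.

(** The corner [m] moves on the perpendicular bisector of [a] and [b]. Each point of [S] in a large
    ball rules out at most one position for each leg, and finitely many exclusions leave a position
    free. *)
Lemma two_segments (S : C -> Prop) a b : locally_finite S -> ~ S a -> ~ S b ->
  exists m, (forall t, 0 <= t <= 1 -> ~ S (seg a m t)) /\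
            (forall t, 0 <= t <= 1 -> ~ S (seg m b t)).
Proof.
  intros HS Ha Hb. destruct (classic (a = b)) as [->|N].
  { exists b. assert (forall t, seg b b t = b) by (intros; unfold seg; ring).
    split; intros t _; now rewrite H. }
  assert (Nd : (b - a <> 0)%C) by (apply Cminus_neq_0; auto).
  destruct (HS (Cmod a + 10 * Cmod (b - a))) as (l & Hl).
  (* [f1 w] and [f2 w] are the parameters [s] for which the first or the second leg would pass
     through [w]. *)
  set (f1 := fun w => let q := ((w - a) / (b - a))%C in Im q / (2 * Re q)).
  set (f2 := fun w => let q := ((w - b) / (b - a))%C in - Im q / (2 * Re q)).
  destruct (exists_not_in_list (map f1 l ++ map f2 l) 0 1 Rlt_0_1) as (s & Hs & Ns).
  assert (N1 : forall w, In w l -> f1 w <> s).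
  { intros w Hw E. apply Ns, in_or_app. left. rewrite <- E. now apply in_map. }
  assert (N2 : forall w, In w l -> f2 w <> s).
  { intros w Hw E. apply Ns, in_or_app. right. rewrite <- E. now apply in_map. }
  set (k := ((1 / 2)%R, s) : C).
  assert (Hk : Cmod k <= 2).
  { eapply Rle_trans; [apply Cmod_le_components|]. unfold k, Re, Im; simpl.
    rewrite !Rabs_pos_eq; lra. }
  pose proof (Cmod_ge_0 (b - a)).
  set (m := (a + k * (b - a))%C). exists m.
  assert (Hma : Cmod (m - a) <= 2 * Cmod (b - a)).
  { unfold m. replace (a + k * (b - a) - a)%C with (k * (b - a))%C by ring.
    rewrite Cmod_mult. nra. }
  assert (Hmb : Cmod (b - m) <= 3 * Cmod (b - a)).
  { replace (b - m)%C with ((b - a) - (m - a))%C by ring.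
    pose proof (Cmod_triangle_minus (b - a) (m - a)). lra. }
  split; intros t Ht HSt.
  - apply (N1 (seg a m t)).
    + apply Hl; auto. pose proof (seg_in_ball a m t Ht).
      pose proof (Cmod_triangle_inv (seg a m t) a). lra.
    + assert (t <> 0).
      { intros ->. apply Ha. now replace a with (seg a m 0) by (unfold seg; ring). }
      unfold f1. replace ((seg a m t - a) / (b - a))%C with (t * k)%C.
      * unfold k, Re, Im; simpl. field. auto.
      * unfold seg, m. field. auto.
  - apply (N2 (seg m b t)).
    + apply Hl; auto. pose proof (seg_in_ball m b t Ht).
      pose proof (Cmod_triangle_inv (seg m b t) m). pose proof (Cmod_triangle_inv m a). lra.
    + assert (t <> 1).
      { intros ->. apply Hb. now replace b with (seg m b 1) by (unfold seg; ring). }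
      unfold f2. replace ((seg m b t - b) / (b - a))%C with ((1 - t)%R * (k - 1))%C.
      * unfold k, Re, Im, Cminus, RtoC; simpl. field. lra.
      * unfold seg, m. rewrite RtoC_minus. field. auto.
Qed.

Lemma path_integral_exists (S : C -> Prop) (f : C -> C) a b : locally_finite S -> ~ S a -> ~ S b ->
  (forall z, ~ S z -> ccont f z) -> exists I, path_integral (fun w => ~ S w) f a b I.
Proof.
  intros HS Ha Hb Hf. destruct (two_segments S a b HS Ha Hb) as (m & H1 & H2).
  destruct (path_integral_seg (fun w => ~ S w) f a m H1 Hf) as (J & _ & _ & HJ).
  destruct (path_integral_seg (fun w => ~ S w) f m b H2 Hf) as (K & _ & _ & HK).
  exists (J 1 + K 1)%C. eapply path_integral_app; eauto.
Qed.

(** The complement of a locally finite set is connected by pairs of segments, and on each of them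
    the mean value inequality holds with bound 0. *)
Lemma constant_of_cder_0 (S : C -> Prop) (F : C -> C) a b : locally_finite S -> ~ S a -> ~ S b ->
  (forall z, ~ S z -> cder F z 0) -> F a = F b.
Proof.
  intros HS Ha Hb HF. destruct (two_segments S a b HS Ha Hb) as (m & H1 & H2).
  assert (K : forall c d, (forall t, 0 <= t <= 1 -> ~ S (seg c d t)) -> F d = F c).
  { intros c d H. apply Cmod_eq_of_le. intros e He.
    pose proof (mean_value_seg F (fun _ => RtoC 0) c d 0 (fun t Ht => HF _ (H t Ht))) as M.
    rewrite Rmult_0_l in M. eapply Rle_trans; [apply M|lra].
    intros. rewrite Cmod_0. lra. }
  rewrite (K m b H2). symmetry. auto.
Qed.

(** ** Unordered sums *)

Fixpoint lsum {T : Type} (f : T -> R) (l : list T) : R :=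
  match l with nil => 0 | x :: l => f x + lsum f l end.

Lemma lsum_app {T} (f : T -> R) l l' : lsum f (l ++ l') = lsum f l + lsum f l'.
Proof. induction l as [|x l IH]; simpl; [ring|rewrite IH; ring]. Qed.

Lemma lsum_nonneg {T} (f : T -> R) l : (forall x, In x l -> 0 <= f x) -> 0 <= lsum f l.
Proof.
  induction l as [|x l IH]; simpl; intros H; [lra|].
  apply Rplus_le_le_0_compat; auto.
Qed.

Lemma lsum_le {T} (f g : T -> R) l : (forall x, In x l -> f x <= g x) -> lsum f l <= lsum g l.
Proof.
  induction l as [|x l IH]; simpl; intros H; [lra|]. apply Rplus_le_compat; auto.
Qed.

Lemma lsum_scal {T} (f : T -> R) a l : lsum (fun x => a * f x) l = a * lsum f l.
Proof. induction l as [|x l IH]; simpl; [ring|rewrite IH; ring]. Qed.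

Lemma lsum_map {T U} (f : U -> R) (g : T -> U) l : lsum f (map g l) = lsum (fun x => f (g x)) l.
Proof. induction l as [|x l IH]; simpl; [auto|now rewrite IH]. Qed.

Lemma lsum_incl {T} (f : T -> R) l l' : (forall x, 0 <= f x) -> NoDup l -> incl l l' ->
  lsum f l <= lsum f l'.
Proof.
  intros Hf. revert l'. induction l as [|x l IH]; simpl; intros l' Hl Hi.
  - apply lsum_nonneg. auto.
  - inversion Hl; subst. destruct (in_split x l' (Hi x (or_introl eq_refl))) as (l1 & l2 & ->).
    rewrite lsum_app. simpl. specialize (IH (l1 ++ l2) H2). rewrite lsum_app in IH.
    enough (lsum f l <= lsum f l1 + lsum f l2) by lra.
    apply IH. intros y Hy. pose proof (Hi y (or_intror Hy)) as Hy'.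
    apply in_app_or in Hy'. apply in_or_app. destruct Hy' as [|[->|]]; tauto.
Qed.

Lemma lsum_list_prod {T U} (f : T -> R) (g : U -> R) l l' :
  lsum (fun p => f (fst p) * g (snd p)) (list_prod l l') = lsum f l * lsum g l'.
Proof.
  induction l as [|x l IH]; simpl; [ring|].
  rewrite lsum_app, IH, lsum_map. simpl. rewrite lsum_scal. ring.
Qed.

Definition summable (A : C -> Prop) (m : C -> R) : Prop :=
  (forall w, A w -> 0 <= m w) /\ exists B, forall l, finite_in A l -> lsum m l <= B.

Lemma summable_scal A m K : 0 <= K -> summable A m -> summable A (fun w => K * m w).
Proof.
  intros HK [H0 [B HB]]. split.
  - intros. apply Rmult_le_pos; auto.
  - exists (K * B). intros l Hl. rewrite lsum_scal. apply Rmult_le_compat_l; auto.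
Qed.

Lemma finite_in_app A l l' : finite_in A l -> finite_in A l' ->
  (forall w, In w l -> ~ In w l') -> finite_in A (l ++ l').
Proof.
  intros [H1 H2] [H3 H4] D. split.
  - apply NoDup_app; auto.
  - apply Forall_app; auto.
Qed.

Lemma finite_in_In A l w : finite_in A l -> In w l -> A w.
Proof. intros [_ H] Hw. rewrite Forall_forall in H. auto. Qed.

(** A finite subset whose sum is within [e] of the supremum of all finite sums leaves at most [e]
    for any subset disjoint from it. *)
Lemma summable_tail A m e : summable A m -> 0 < e ->
  exists l0, finite_in A l0 /\
    forall l, finite_in A l -> (forall w, In w l -> ~ In w l0) -> lsum m l <= e.
Proof.
  intros [H0 [B HB]] He.
  destruct (completeness (fun x => exists l, finite_in A l /\ x = lsum m l)) as (s & Hs1 & Hs2).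
  - exists B. intros x (l & Hl & ->). auto.
  - exists 0. exists nil. split; [split; constructor|reflexivity].
  - destruct (classic (exists l0, finite_in A l0 /\ s - e < lsum m l0)) as [(l0 & Hl0 & K)|N].
    + exists l0. split; auto. intros l Hl D.
      assert (lsum m (l ++ l0) <= s).
      { apply Hs1. exists (l ++ l0). split; auto. now apply finite_in_app. }
      rewrite lsum_app in H. lra.
    + assert (s <= s - e); [|lra]. apply Hs2. intros x (l & Hl & ->).
      apply Rnot_lt_le. intros K. apply N. eauto.
Qed.

Lemma finite_sum_app f l l' : finite_sum f (l ++ l') = (finite_sum f l + finite_sum f l')%C.
Proof. induction l as [|x l IH]; simpl; [ring|]. rewrite IH. ring. Qed.

Lemma finite_sum_perm f l l' : Permutation l l' -> finite_sum f l = finite_sum f l'.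
Proof.
  induction 1; simpl; try reflexivity.
  - now rewrite IHPermutation.
  - ring.
  - congruence.
Qed.

Lemma finite_sum_bound f m l : (forall w, In w l -> Cmod (f w) <= m w) ->
  Cmod (finite_sum f l) <= lsum m l.
Proof.
  induction l as [|x l IH]; simpl; intros H.
  - rewrite Cmod_0. lra.
  - eapply Rle_trans; [apply Cmod_triangle|]. apply Rplus_le_compat; auto.
Qed.

Lemma finite_sum_plus f g l :
  finite_sum (fun w => f w + g w)%C l = (finite_sum f l + finite_sum g l)%C.
Proof. induction l as [|x l IH]; simpl; [ring|]. rewrite IH. ring. Qed.

Lemma finite_sum_scal a f l : finite_sum (fun w => a * f w)%C l = (a * finite_sum f l)%C.
Proof. induction l as [|x l IH]; simpl; [ring|]. rewrite IH. ring. Qed.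

Lemma finite_sum_ext f g l : (forall w, In w l -> f w = g w) -> finite_sum f l = finite_sum g l.
Proof. induction l as [|x l IH]; simpl; intros H; [auto|]. rewrite H, IH; auto. Qed.

Lemma finite_sum_map f (s : C -> C) l : finite_sum f (map s l) = finite_sum (fun w => f (s w)) l.
Proof. induction l as [|x l IH]; simpl; [auto|]. now rewrite IH. Qed.

Lemma finite_sum_conj f l : finite_sum (fun w => Cconj (f w)) l = Cconj (finite_sum f l).
Proof.
  induction l as [|x l IH]; simpl.
  - unfold Cconj, RtoC; simpl. f_equal; ring.
  - rewrite IH. symmetry. apply Cplus_conj.
Qed.

Lemma finite_in_split A l0 l : finite_in A l0 -> finite_in A l -> incl l0 l ->
  exists r, finite_in A r /\ (forall w, In w r -> ~ In w l0) /\ Permutation l (l0 ++ r).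
Proof.
  intros [N0 F0] [N F] Hi.
  set (p := fun w => if excluded_middle_informative (In w l0) then false else true).
  assert (Hp : forall w, In w (filter p l) <-> In w l /\ ~ In w l0).
  { intros w. rewrite filter_In. unfold p. destruct (excluded_middle_informative _);
      intuition congruence. }
  exists (filter p l). split; [|split].
  - split; [now apply NoDup_filter|]. apply Forall_forall. intros w Hw.
    apply Hp in Hw. rewrite Forall_forall in F. now apply F.
  - intros w Hw. now apply Hp.
  - apply NoDup_Permutation; auto.
    + apply NoDup_app; auto. { now apply NoDup_filter. }
      intros w H1 H2. apply Hp in H2. tauto.
    + intros w. rewrite in_app_iff, Hp. destruct (classic (In w l0)); intuition.
Qed.

Lemma finite_in_union A l l' : finite_in A l -> finite_in A l' ->
  exists l'', finite_in A l'' /\ incl l l'' /\ incl l' l''.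
Proof.
  intros H H'. exists (nodup (fun x y => excluded_middle_informative (x = y)) (l ++ l')).
  split; [split|split].
  - apply NoDup_nodup.
  - apply Forall_forall. intros w Hw. apply nodup_In, in_app_or in Hw.
    destruct Hw; [apply (finite_in_In A l)|apply (finite_in_In A l')]; auto.
  - intros w Hw. apply nodup_In, in_or_app. auto.
  - intros w Hw. apply nodup_In, in_or_app. auto.
Qed.

Lemma finite_sum_tail A f m e l0 : 
  (forall l, finite_in A l -> (forall w, In w l -> ~ In w l0) -> lsum m l <= e) ->
  (forall w, A w -> ~ In w l0 -> Cmod (f w) <= m w) ->
  forall l l', finite_in A l -> finite_in A l' -> incl l0 l -> incl l l' ->
  Cmod (finite_sum f l' - finite_sum f l) <= e.
Proof.
  intros H Hf l l' Hl Hl' I0 I.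
  destruct (finite_in_split A l l' Hl Hl' I) as (r & Hr & Dr & P).
  rewrite (finite_sum_perm f _ _ P), finite_sum_app.
  replace (finite_sum f l + finite_sum f r - finite_sum f l)%C with (finite_sum f r) by ring.
  eapply Rle_trans; [|apply (H r); auto].
  - apply finite_sum_bound. intros w Hw. apply Hf.
    + now apply (finite_in_In A r).
    + intros Hw0. apply (Dr w); auto.
  - intros w Hw Hw0. apply (Dr w); auto.
Qed.

Lemma is_sum_over_exists A f m : summable A m -> (forall w, A w -> Cmod (f w) <= m w) ->
  exists S, is_sum_over A f S.
Proof.
  intros Hm Hf.
  (* The filter of the families of finite subsets that contain all those above a given one;
     unordered summability is convergence along it, so completeness of the complex numbers
     applies. *)
  set (F := fun P : list C -> Prop => exists l0, finite_in A l0 /\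
     forall l, finite_in A l -> incl l0 l -> P l).
  assert (FF : ProperFilter F).
  { split.
    - intros P (l0 & H0 & HP). exists l0. apply HP; auto. intros w; auto.
    - split.
      + exists nil. split; [split; constructor|auto].
      + intros P Q (l1 & H1 & HP) (l2 & H2 & HQ).
        destruct (finite_in_union A l1 l2 H1 H2) as (l & Hl & I1 & I2).
        exists l. split; auto. intros l' Hl' I. split; [apply HP|apply HQ]; auto.
        * intros w Hw. auto.
        * intros w Hw. auto.
      + intros P Q HPQ (l1 & H1 & HP). exists l1. split; auto. }
  destruct (proj1 (filterlim_locally_cauchy (F := F) (U := C_R_CompleteNormedModule) (finite_sum f)))
    as (S & HS).
  - intros [e He]. destruct (summable_tail A m (e / 4) Hm ltac:(lra)) as (l0 & Hl0 & T).
    exists (fun l => finite_in A l /\ incl l0 l). split.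
    + exists l0. split; auto.
    + intros u v [Hu Iu] [Hv Iv]. apply C_NormedModule_mixin_compat1. simpl.
      assert (K : forall l, finite_in A l -> incl l0 l ->
        Cmod (finite_sum f l - finite_sum f l0) <= e / 4).
      { intros l Hl Il. apply (finite_sum_tail A f m (e/4) l0); auto. intros w; auto. }
      pose proof (K u Hu Iu). pose proof (K v Hv Iv).
      change (minus (finite_sum f v) (finite_sum f u)) with (finite_sum f v - finite_sum f u)%C.
      replace (finite_sum f v - finite_sum f u)%C
        with ((finite_sum f v - finite_sum f l0) - (finite_sum f u - finite_sum f l0))%C by ring.
      eapply Rle_lt_trans; [apply Cmod_triangle_minus|]. lra.
  - exists S. intros e He.
    (* Balls of the product uniform structure compare with [Cmod] up to the factor [sqrt 2], which
       halving [e] absorbs. *)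
    assert (He' : 0 < e / 2) by lra.
    destruct (proj1 (filterlim_locally _ _) HS (mkposreal _ He')) as (l0 & Hl0 & K).
    exists l0. split; auto. intros l Hl I. specialize (K l Hl I).
    apply C_NormedModule_mixin_compat2 in K. simpl in K.
    apply Rlt_le_trans with (1 := K).
    assert (sqrt 2 <= 2). { rewrite <- (sqrt_square 2) at 2 by lra. apply sqrt_le_1; lra. }
    nra.
Qed.

Lemma is_sum_over_le A f S l0 T M : is_sum_over A f S -> finite_in A l0 ->
  (forall l, finite_in A l -> incl l0 l -> Cmod (finite_sum f l - T) <= M) ->
  Cmod (S - T) <= M.
Proof.
  intros HS Hl0 H. apply Rnot_lt_le. intros K.
  destruct (HS (Cmod (S - T) - M) ltac:(lra)) as (l1 & Hl1 & K1).
  destruct (finite_in_union A l0 l1 Hl0 Hl1) as (l & Hl & I0 & I1).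
  specialize (K1 l Hl I1). specialize (H l Hl I0).
  pose proof (Cmod_triangle_minus (finite_sum f l - T) (finite_sum f l - S)) as E.
  replace (finite_sum f l - T - (finite_sum f l - S))%C with (S - T)%C in E by ring. lra.
Qed.

Lemma finite_in_nil A : finite_in A nil.
Proof. split; constructor. Qed.

Lemma is_sum_over_unique A f S S' : is_sum_over A f S -> is_sum_over A f S' -> S = S'.
Proof.
  intros H H'. apply Cmod_eq_of_le. intros e He.
  destruct (H' e He) as (l0 & Hl0 & K).
  apply (is_sum_over_le A f S l0); auto. intros l Hl I. left. auto.
Qed.

Lemma sum_over_eq A f S : is_sum_over A f S -> sum_over A f = S.
Proof.
  intros H. apply (iota_unique (V := C_R_CompleteNormedModule) (is_sum_over A f) S); auto.
  intros y Hy. eapply is_sum_over_unique; eauto.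
Qed.

Lemma sum_over_correct A f m : summable A m -> (forall w, A w -> Cmod (f w) <= m w) ->
  is_sum_over A f (sum_over A f).
Proof.
  intros Hm Hf. destruct (is_sum_over_exists A f m Hm Hf) as (S & HS).
  now rewrite (sum_over_eq _ _ _ HS).
Qed.

Lemma is_sum_over_plus A f g S T : is_sum_over A f S -> is_sum_over A g T ->
  is_sum_over A (fun w => f w + g w)%C (S + T)%C.
Proof.
  intros Hf Hg e He. destruct (Hf (e/2) ltac:(lra)) as (l1 & H1 & K1).
  destruct (Hg (e/2) ltac:(lra)) as (l2 & H2 & K2).
  destruct (finite_in_union A l1 l2 H1 H2) as (l0 & H0 & I1 & I2).
  exists l0. split; auto. intros l Hl I. rewrite finite_sum_plus.
  replace (finite_sum f l + finite_sum g l - (S + T))%C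
    with ((finite_sum f l - S) + (finite_sum g l - T))%C by ring.
  eapply Rle_lt_trans; [apply Cmod_triangle|].
  specialize (K1 l Hl (fun w Hw => I w (I1 w Hw))).
  specialize (K2 l Hl (fun w Hw => I w (I2 w Hw))). lra.
Qed.

Lemma is_sum_over_scal A f S a : is_sum_over A f S -> is_sum_over A (fun w => a * f w)%C (a * S)%C.
Proof.
  intros Hf e He. pose proof (Cmod_ge_0 a).
  destruct (Hf (e / (Cmod a + 1))) as (l0 & H0 & K). { apply Rdiv_lt_0_compat; lra. }
  exists l0. split; auto. intros l Hl I. rewrite finite_sum_scal.
  replace (a * finite_sum f l - a * S)%C with (a * (finite_sum f l - S))%C by ring.
  rewrite Cmod_mult. specialize (K l Hl I). apply Rlt_div_r in K; [|lra].
  pose proof (Cmod_ge_0 (finite_sum f l - S)). nra.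
Qed.

Lemma is_sum_over_ext A f g S : (forall w, A w -> f w = g w) -> is_sum_over A f S ->
  is_sum_over A g S.
Proof.
  intros E H e He. destruct (H e He) as (l0 & H0 & K). exists l0. split; auto.
  intros l Hl I. rewrite <- (finite_sum_ext f g); auto. intros w Hw.
  apply E. now apply (finite_in_In A l).
Qed.

Lemma is_sum_over_conj A f S : is_sum_over A f S -> is_sum_over A (fun w => Cconj (f w)) (Cconj S).
Proof.
  intros H e He. destruct (H e He) as (l0 & H0 & K). exists l0. split; auto.
  intros l Hl I. rewrite finite_sum_conj, <- Cminus_conj, Cmod_conj. auto.
Qed.

Lemma is_sum_over_reindex (A B : C -> Prop) f S (s t : C -> C) :
  (forall w, B w -> A (s w)) -> (forall w, A w -> B (t w)) ->
  (forall w, t (s w) = w) -> (forall w, s (t w) = w) ->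
  is_sum_over A f S -> is_sum_over B (fun w => f (s w)) S.
Proof.
  intros HB HA ts st H e He. destruct (H e He) as (l0 & [N0 F0] & K).
  rewrite Forall_forall in F0.
  exists (map t l0). split.
  - split.
    + apply NoDup_map_NoDup_ForallPairs; auto. intros x y _ _ E.
      rewrite <- (st x), <- (st y). now f_equal.
    + apply Forall_forall. intros w Hw. apply in_map_iff in Hw. destruct Hw as (x & <- & Hx). auto.
  - intros l [N F] I. rewrite Forall_forall in F. rewrite <- finite_sum_map. apply K.
    + split.
      * apply NoDup_map_NoDup_ForallPairs; auto. intros x y _ _ E.
        rewrite <- (ts x), <- (ts y). now f_equal.
      * apply Forall_forall. intros w Hw. apply in_map_iff in Hw. destruct Hw as (x & <- & Hx). auto.
    + intros w Hw. rewrite <- (st w). apply in_map. apply I. now apply in_map.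
Qed.

(** The second derivatives of the terms are dominated by the summable [m], so the term at [w] has
    first order remainder at most [m w * Cmod h ^ 2], and these remainders add up to at most
    [B * Cmod h ^ 2]. *)
Lemma cder_sum (A : C -> Prop) (F F1 F2 : C -> C -> C) (m : C -> R) (S : C -> C) (z S1 : C) (d : R) :
  summable A m -> 0 < d ->
  (forall h w, Cmod h < d -> A w -> cder (fun x => F x w) (z + h)%C (F1 (z + h)%C w)) ->
  (forall h w, Cmod h < d -> A w -> cder (fun x => F1 x w) (z + h)%C (F2 (z + h)%C w)) ->
  (forall h w, Cmod h < d -> A w -> Cmod (F2 (z + h)%C w) <= m w) ->
  (forall h, Cmod h < d -> is_sum_over A (F (z + h)%C) (S (z + h)%C)) ->
  is_sum_over A (F1 z) S1 ->
  cder S z S1.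
Proof.
  intros [Hm [B HB]] Hd HF HF1 HF2 HS HS1.
  apply cder_of_quadratic with d B; auto.
  intros h Hh.
  assert (HSz : is_sum_over A (F z) (S z)).
  { replace z with (z + 0)%C by ring. apply HS. now rewrite Cmod_0. }
  assert (HSum : is_sum_over A (fun w => F (z + h)%C w + (-1 * F z w + (- h) * F1 z w))%C
     (S (z + h) + (-1 * S z + (- h) * S1))%C).
  { apply is_sum_over_plus; [auto|]. apply is_sum_over_plus; now apply is_sum_over_scal. }
  replace (S (z + h) - S z - S1 * h)%C with (S (z + h) + (-1 * S z + (- h) * S1) - 0)%C by ring.
  apply (is_sum_over_le _ _ _ nil 0 _ HSum (finite_in_nil A)).
  intros l Hl _.
  assert (Z0 : forall x : C, (x - 0)%C = x) by (intros; ring). rewrite Z0.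
  apply Rle_trans with (lsum (fun w => Cmod h ^ 2 * m w) l).
  - apply finite_sum_bound. intros w Hw. pose proof (finite_in_In A l w Hl Hw) as Aw.
    replace (F (z + h)%C w + (-1 * F z w + (- h) * F1 z w))%C
      with (F (z + h)%C w - F z w - F1 z w * h)%C by ring.
    rewrite Rmult_comm.
    apply (quadratic_remainder (fun x => F x w) (fun x => F1 x w) (fun x => F2 x w)); auto.
    + intros k Hk. apply HF; auto. lra.
    + intros k Hk. apply HF1; auto. lra.
    + intros k Hk. apply HF2; auto. lra.
  - rewrite lsum_scal. rewrite Rmult_comm. apply Rmult_le_compat_r; auto.
    apply pow2_ge_0.
Qed.

(** ** Lattices *)

(** Cramer's rule: the coordinates are quotients by the determinant [D] of linear expressions in the
    real and imaginary parts. If [D] were 0, its minors would give linear relations between the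
    generators. *)
Lemma lattice_coordinates_bound (w1 w2 : C) :
  (forall s t : R, (s * w1 + t * w2 = 0)%C -> s = 0 /\ t = 0) ->
  exists c, 0 < c /\ forall s t : R, c * (Rabs s + Rabs t) <= Cmod (2 * s * w1 + 2 * t * w2)%C.
Proof.
  intros H. destruct w1 as [x1 y1], w2 as [x2 y2].
  assert (HC : forall s t : R, (s * (x1, y1) + t * (x2, y2))%C = (s * x1 + t * x2, s * y1 + t * y2)).
  { intros. unfold Cmult, Cplus, RtoC; simpl. f_equal; ring. }
  set (D := x1 * y2 - y1 * x2).
  assert (HD : D <> 0).
  { intros E. unfold D in E.
    destruct (H y2 (- y1)) as [Y2 Y1]. { rewrite HC. unfold RtoC. f_equal; nra. }
    destruct (H x2 (- x1)) as [X2 X1]. { rewrite HC. unfold RtoC. f_equal; nra. }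
    destruct (H 1 0) as [F _]; [|lra]. rewrite HC. unfold RtoC. f_equal; nra. }
  set (K := Rabs x1 + Rabs x2 + Rabs y1 + Rabs y2 + 1).
  pose proof (Rabs_pos x1). pose proof (Rabs_pos x2). pose proof (Rabs_pos y1). pose proof (Rabs_pos y2).
  pose proof (Rabs_pos_lt D HD).
  exists (2 * Rabs D / K). split. { apply Rdiv_lt_0_compat; unfold K; lra. }
  intros s t. set (z := (2 * s * (x1, y1) + 2 * t * (x2, y2))%C).
  assert (HR : Re z = 2 * s * x1 + 2 * t * x2) by (unfold z, Re, Cplus, Cmult, RtoC; simpl; ring).
  assert (HI : Im z = 2 * s * y1 + 2 * t * y2) by (unfold z, Im, Cplus, Cmult, RtoC; simpl; ring).
  assert (E1 : 2 * s * D = Re z * y2 - Im z * x2) by (rewrite HR, HI; unfold D; ring).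
  assert (E2 : 2 * t * D = Im z * x1 - Re z * y1) by (rewrite HR, HI; unfold D; ring).
  pose proof (re_le_Cmod z). pose proof (im_le_Cmod z). pose proof (Cmod_ge_0 z).
  assert (B : forall a b, Rabs (Re z * a - Im z * b) <= Cmod z * (Rabs a + Rabs b)).
  { intros a b. eapply Rle_trans; [apply Rabs_triang|]. rewrite Rabs_Ropp, !Rabs_mult.
    pose proof (Rabs_pos a). pose proof (Rabs_pos b). nra. }
  assert (B1 : 2 * Rabs s * Rabs D <= Cmod z * (Rabs y2 + Rabs x2)).
  { rewrite <- (Rabs_pos_eq 2) at 1 by lra. rewrite <- !Rabs_mult, E1. apply B. }
  assert (B2 : 2 * Rabs t * Rabs D <= Cmod z * (Rabs y1 + Rabs x1)).
  { rewrite <- (Rabs_pos_eq 2) at 1 by lra. rewrite <- !Rabs_mult, E2.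
    rewrite Rabs_minus_sym. apply B. }
  apply Rmult_le_reg_r with K; [unfold K; lra|].
  replace (2 * Rabs D / K * (Rabs s + Rabs t) * K)
    with (2 * Rabs s * Rabs D + 2 * Rabs t * Rabs D) by (field; unfold K; lra).
  unfold K. nra.
Qed.

Fixpoint zrange (n : nat) : list Z :=
  match n with
  | O => 0%Z :: nil
  | S k => Z.of_nat (S k) :: (- Z.of_nat (S k))%Z :: zrange k
  end.

Lemma zrange_In n k : (Z.abs k <= Z.of_nat n)%Z -> In k (zrange n).
Proof.
  induction n as [|n IH]; intros H.
  - left. lia.
  - simpl zrange. destruct (Z.eq_dec k (Z.of_nat (S n))) as [->|N1]; [now left|].
    destruct (Z.eq_dec k (- Z.of_nat (S n))) as [->|N2]; [right; now left|].
    right. right. apply IH. lia.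
Qed.

(** The exponent is 3/2: the product of two weights then dominates the inverse cube of
    [1 + |m| + |n|], while each weight alone is summable over the integers. This splits the double
    sum over the lattice into a product of two single sums. *)
Definition weight (k : Z) : R := / ((1 + Rabs (IZR k)) * sqrt (1 + Rabs (IZR k))).

Lemma weight_pos k : 0 < weight k.
Proof.
  pose proof (Rabs_pos (IZR k)). apply Rinv_0_lt_compat, Rmult_lt_0_compat; [lra|].
  apply sqrt_lt_R0. lra.
Qed.

(** The subtracted term [4 / sqrt (INR n + 1)] is what makes the induction telescope: the two new
    indices together contribute at most its decrease. *)
Lemma lsum_weight_zrange n : lsum weight (zrange n) <= 5 - 4 / sqrt (INR n + 1).
Proof.
  induction n as [|n IH].
  - simpl. unfold weight. rewrite Rabs_R0. replace (1 + 0) with 1 by ring. replace (0 + 1) with 1 by ring.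
    rewrite sqrt_1, Rmult_1_l, Rinv_1. lra.
  - change (lsum weight (zrange (S n))) with
      (weight (Z.of_nat (S n)) + (weight (- Z.of_nat (S n)) + lsum weight (zrange n))).
    rewrite S_INR.
    assert (HN : 0 <= INR n) by apply pos_INR.
    assert (W : forall k, Rabs (IZR k) = INR n + 1 ->
      weight k = / ((INR n + 2) * sqrt (INR n + 1 + 1))).
    { intros k E. unfold weight. rewrite E. f_equal. f_equal; [ring|]. f_equal. ring. }
    assert (E : IZR (Z.of_nat (S n)) = INR n + 1) by now rewrite <- INR_IZR_INZ, S_INR.
    rewrite (W (Z.of_nat (S n))), (W (- Z.of_nat (S n))%Z).
    2:{ rewrite opp_IZR, Rabs_Ropp, E, Rabs_pos_eq; lra. }
    2:{ rewrite E, Rabs_pos_eq; lra. }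
    set (s := sqrt (INR n + 1)) in *. set (t := sqrt (INR n + 1 + 1)) in *.
    assert (Hs : 0 < s) by (apply sqrt_lt_R0; lra).
    assert (Ht : s <= t) by (apply sqrt_le_1; lra).
    assert (Es : s * s = INR n + 1) by (apply sqrt_sqrt; lra).
    assert (Et : t * t = INR n + 2) by (unfold t; rewrite sqrt_sqrt; lra).
    rewrite <- Et.
    assert (K : / (t * t * t) <= 2 * (/ s - / t)).
    { replace (/ s - / t) with ((t - s) / (s * t)) by (field; lra).
      apply Rmult_le_reg_r with (s * t * t * t); [assert (0 < t) by lra; repeat apply Rmult_lt_0_compat; assumption|].
      replace (/ (t * t * t) * (s * t * t * t)) with s by (field; lra).
      replace (2 * ((t - s) / (s * t)) * (s * t * t * t)) with (2 * (t - s) * (t * t)) by (field; lra).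
      assert ((t - s) * (t + s) = 1) by lra.
      assert (1 <= (t - s) * (2 * t)) by nra. nra. }
    unfold Rdiv in *. lra.
Qed.

Lemma lsum_weight_bound l : NoDup l -> lsum weight l <= 5.
Proof.
  intros Hl.
  set (n := list_max (map Z.abs_nat l)).
  apply Rle_trans with (lsum weight (zrange n)).
  - apply lsum_incl; auto. { intros. left. apply weight_pos. }
    intros k Hk. apply zrange_In.
    assert (K : List.Forall (fun x => (x <= n)%nat) (map Z.abs_nat l)) by now apply list_max_le.
    rewrite Forall_forall in K. specialize (K _ (in_map Z.abs_nat _ _ Hk)). lia.
  - pose proof (lsum_weight_zrange n). pose proof (pos_INR n).
    assert (0 < / sqrt (INR n + 1)) by (apply Rinv_0_lt_compat, sqrt_lt_R0; lra).
    unfold Rdiv in *. lra.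
Qed.

Lemma weight_mult_le (m n : Z) :
  let N := 1 + Rabs (IZR m) + Rabs (IZR n) in / N ^ 3 <= weight m * weight n.
Proof.
  intros N. unfold weight.
  pose proof (Rabs_pos (IZR m)). pose proof (Rabs_pos (IZR n)).
  set (x := 1 + Rabs (IZR m)) in *. set (y := 1 + Rabs (IZR n)) in *.
  assert (Hx : 1 <= x) by (unfold x; lra). assert (Hy : 1 <= y) by (unfold y; lra).
  assert (EN : N = x + y - 1) by (unfold N, x, y; ring).
  assert (HN : 1 <= N) by lra.
  assert (HN2 : x * y <= N * N) by nra.
  assert (HN1 : sqrt x * sqrt y <= N).
  { rewrite <- sqrt_mult by lra. rewrite <- (sqrt_square N) by lra. apply sqrt_le_1; nra. }
  assert (Sx : 0 < sqrt x) by (apply sqrt_lt_R0; lra).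
  assert (Sy : 0 < sqrt y) by (apply sqrt_lt_R0; lra).
  rewrite <- Rinv_mult. apply Rinv_le_contravar.
  - repeat apply Rmult_lt_0_compat; lra.
  - replace (N ^ 3) with ((N * N) * N) by ring.
    replace (x * sqrt x * (y * sqrt y)) with ((x * y) * (sqrt x * sqrt y)) by ring.
    apply Rmult_le_compat; nra.
Qed.

Section Lattice.

Variable L : C -> Prop.
Hypothesis HL : lattice L.

Lemma lattice_0 : L 0.
Proof.
  destruct HL as (w1 & w2 & _ & H). apply H. exists 0%Z, 0%Z. ring.
Qed.

Lemma lattice_plus z w : L z -> L w -> L (z + w)%C.
Proof.
  destruct HL as (w1 & w2 & _ & H). rewrite !H. intros (m & n & ->) (m' & n' & ->).
  exists (m + m')%Z, (n + n')%Z. rewrite !plus_IZR, !RtoC_plus. ring.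
Qed.

Lemma lattice_opp z : L z -> L (- z)%C.
Proof.
  destruct HL as (w1 & w2 & _ & H). rewrite !H. intros (m & n & ->).
  exists (- m)%Z, (- n)%Z. rewrite !opp_IZR, !RtoC_opp. ring.
Qed.

Lemma lattice_minus z w : L z -> L w -> L (z - w)%C.
Proof. intros. apply lattice_plus; auto. now apply lattice_opp. Qed.

Lemma lattice_shift z w : L w -> L (z + w)%C <-> L z.
Proof.
  intros Hw. split; intros H; [|now apply lattice_plus].
  replace z with (z + w - w)%C by ring. now apply lattice_minus.
Qed.

Lemma lattice_opp_iff z : L (- z)%C <-> L z.
Proof.
  split; intros H; [|now apply lattice_opp].
  replace z with (- - z)%C by ring. now apply lattice_opp.
Qed.

Lemma lattice_mult_nat z n : L z -> L (INR n * z)%C.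
Proof.
  intros Hz. induction n as [|n IH].
  - replace (INR 0 * z)%C with (RtoC 0) by (simpl; ring). apply lattice_0.
  - rewrite S_INR, RtoC_plus. replace ((INR n + 1) * z)%C with (INR n * z + z)%C by ring.
    now apply lattice_plus.
Qed.

Lemma lattice_locally_finite : locally_finite L.
Proof.
  destruct HL as (w1 & w2 & Hi & H).
  destruct (lattice_coordinates_bound w1 w2 Hi) as (c & Hc & Hb).
  intros r. destruct (nfloor_ex (Rmax 0 (r / c)) (Rmax_l _ _)) as (n & _ & Hn).
  exists (map (fun p => 2 * IZR (fst p) * w1 + 2 * IZR (snd p) * w2)%C
     (list_prod (zrange (S n)) (zrange (S n)))).
  intros w Hw Hr. apply H in Hw. destruct Hw as (p & q & ->).
  apply (in_map (fun p => 2 * IZR (fst p) * w1 + 2 * IZR (snd p) * w2)%C _ (p, q)).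
  specialize (Hb (IZR p) (IZR q)).
  pose proof (Rabs_pos (IZR p)). pose proof (Rabs_pos (IZR q)).
  assert (Hrc : Rabs (IZR p) + Rabs (IZR q) <= r / c) by (apply Rle_div_r; lra).
  pose proof (Rmax_r 0 (r / c)).
  assert (K : forall k, Rabs (IZR k) <= r / c -> (Z.abs k <= Z.of_nat (S n))%Z).
  { intros k Hk. apply le_IZR. rewrite abs_IZR, <- INR_IZR_INZ, S_INR. lra. }
  apply in_prod; apply zrange_In; apply K; lra.
Qed.

Lemma lattice_map_coordinates w1 w2 l :
  List.Forall (fun z => exists m n : Z, z = (2 * IZR m * w1 + 2 * IZR n * w2)%C) l ->
  exists lp, map (fun p => 2 * IZR (fst p) * w1 + 2 * IZR (snd p) * w2)%C lp = l.
Proof.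
  induction 1 as [|x l (m & n & ->) _ (lp & IH)].
  - now exists nil.
  - exists ((m, n) :: lp). simpl. now rewrite IH.
Qed.

(** A nonzero lattice point has a nonzero integer coordinate, so its modulus is at least [c * N / 2]
    with [N] one more than the sum of the absolute coordinates. The cube of 2 gives the 8, and the
    two sums of weights give [5 * 5]. *)
Lemma lattice_summable : summable (nonzero_of L) (fun w => / Cmod w ^ 3).
Proof.
  split.
  { intros w [_ Hw]. apply Cmod_gt_0 in Hw. left. apply Rinv_0_lt_compat, pow_lt, Hw. }
  destruct HL as (w1 & w2 & Hi & H).
  destruct (lattice_coordinates_bound w1 w2 Hi) as (c & Hc & Hb).
  exists ((8 / c ^ 3) * (5 * 5)). intros l [Nl Fl].
  destruct (lattice_map_coordinates w1 w2 l) as (lp & El).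
  { revert Fl. apply Forall_impl. intros z [Hz _]. now apply H. }
  rewrite <- El in *. pose proof (NoDup_map_inv _ _ Nl) as Np.
  rewrite lsum_map.
  assert (C3 : 0 < c ^ 3) by now apply pow_lt.
  apply Rle_trans with (lsum (fun p => (8 / c ^ 3) * (weight (fst p) * weight (snd p))) lp).
  - apply lsum_le. intros [m n] Hp. cbn [fst snd].
    rewrite Forall_forall in Fl. destruct (Fl _ (in_map _ _ _ Hp)) as [_ N0]. cbn [fst snd] in N0.
    specialize (Hb (IZR m) (IZR n)). pose proof (weight_mult_le m n) as HW. cbv zeta in HW.
    pose proof (Rabs_pos (IZR m)). pose proof (Rabs_pos (IZR n)).
    assert (M1 : 1 <= Rabs (IZR m) + Rabs (IZR n)).
    { rewrite <- !abs_IZR, <- plus_IZR. apply IZR_le.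
      destruct (Z.eq_dec m 0) as [->|]; [|lia]. destruct (Z.eq_dec n 0) as [->|]; [|lia].
      exfalso. apply N0. ring. }
    set (N := 1 + Rabs (IZR m) + Rabs (IZR n)) in *.
    set (z := (2 * IZR m * w1 + 2 * IZR n * w2)%C) in *.
    assert (HN : c * N / 2 <= Cmod z) by (unfold N; nra).
    assert (N1 : 1 <= N) by (unfold N; lra).
    apply Rle_trans with (/ (c * N / 2) ^ 3).
    + apply Rinv_le_contravar; [apply pow_lt; nra|]. apply pow_incr. nra.
    + replace (/ (c * N / 2) ^ 3) with (8 / c ^ 3 * / N ^ 3) by (field; lra).
      apply Rmult_le_compat_l; auto. left. apply Rdiv_lt_0_compat; lra.
  - rewrite lsum_scal. apply Rmult_le_compat_l. { left. apply Rdiv_lt_0_compat; lra. }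
    set (eqz := Z.eq_dec).
    apply Rle_trans with (lsum (fun p => weight (fst p) * weight (snd p))
       (list_prod (nodup eqz (map fst lp)) (nodup eqz (map snd lp)))).
    + apply lsum_incl; auto.
      { intros p. left. apply Rmult_lt_0_compat; apply weight_pos. }
      intros [m n] Hp. apply in_prod; apply nodup_In.
      * now apply (in_map fst) in Hp.
      * now apply (in_map snd) in Hp.
    + rewrite lsum_list_prod.
      apply Rmult_le_compat; try (apply lsum_weight_bound, NoDup_nodup);
        apply lsum_nonneg; intros; left; apply weight_pos.
Qed.

End Lattice.

Lemma Ceq_opp_0 (a : C) : a = (- a)%C -> a = 0.
Proof.
  intros H. assert (E : (a + a)%C = 0) by (rewrite H at 1; ring).
  replace a with (/ 2 * (a + a))%C by (field; intros F; apply RtoC_inj in F; lra).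
  rewrite E. ring.
Qed.

Lemma locally_finite_gap (S : C -> Prop) z : locally_finite S ->
  exists d, 0 < d /\ forall w, S w -> w <> z -> d <= Cmod (z - w).
Proof.
  intros HS. destruct (HS (Cmod z + 1)) as (l & Hl).
  assert (H : exists d, 0 < d /\ forall w, In w l -> w <> z -> d <= Cmod (z - w)).
  { clear Hl. induction l as [|x l (d & Hd & K)].
    - exists 1. split; [lra|]. intros w [].
    - destruct (classic (x = z)) as [->|N].
      + exists d. split; auto. intros w [->|Hw] Hz; [tauto|auto].
      + assert (P : 0 < Cmod (z - x)) by (apply Cmod_gt_0, Cminus_neq_0; auto).
        exists (Rmin d (Cmod (z - x))). split; [now apply Rmin_pos|].
        intros w [<-|Hw] Hz; [apply Rmin_r|]. eapply Rle_trans; [apply Rmin_l|auto]. }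
  destruct H as (d & Hd & K). exists (Rmin d 1). split; [apply Rmin_pos; lra|].
  intros w Hw Hz. destruct (Rle_dec (Cmod w) (Cmod z + 1)) as [Hr|Hr].
  - eapply Rle_trans; [apply Rmin_l|auto].
  - eapply Rle_trans; [apply Rmin_r|]. pose proof (Cmod_triangle_inv w z).
    rewrite Cmod_minus_sym. lra.
Qed.

Lemma locally_finite_near (S : C -> Prop) z : locally_finite S -> near z (fun w => ~ S w).
Proof.
  intros HS. destruct (locally_finite_gap S z HS) as (d & Hd & K).
  exists d. split; auto. intros w Hw Hwd HSw. specialize (K w HSw Hw).
  rewrite Cmod_minus_sym in K. lra.
Qed.

Lemma locally_finite_mono (S S' : C -> Prop) : locally_finite S -> (forall z, S' z -> S z) ->
  locally_finite S'.
Proof. intros H I r. destruct (H r) as (l & Hl). exists l. auto. Qed.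

Lemma locally_finite_union (S S' : C -> Prop) : locally_finite S -> locally_finite S' ->
  locally_finite (fun z => S z \/ S' z).
Proof.
  intros H H' r. destruct (H r) as (l & Hl). destruct (H' r) as (l' & Hl').
  exists (l ++ l'). intros w [Hw|Hw] Hr; apply in_or_app; auto.
Qed.

Lemma locally_finite_translate (S : C -> Prop) a : locally_finite S ->
  locally_finite (fun z => S (z - a)%C).
Proof.
  intros H r. destruct (H (r + Cmod a)) as (l & Hl). exists (map (fun w => w + a)%C l).
  intros w Hw Hr. replace w with (w - a + a)%C by ring.
  apply (in_map (fun w => w + a)%C). apply Hl; auto.
  pose proof (Cmod_triangle_minus w a). lra.
Qed.

(* Up to a factor, [mittag_leffler k] is the derivative of order [k - 1] of the terms of
   the series for the zeta function; for [k = 0] the value is not meaningful. *)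
Definition mittag_leffler (k : nat) (z w : C) : C :=
  match k with
  | 1 => / (z - w) + / w + z / w ^ 2
  | 2 => / (z - w) ^ 2 - / w ^ 2
  | _ => / (z - w) ^ k
  end%C.

Definition lattice_series (L : C -> Prop) (k : nat) (z : C) : C :=
  sum_over (nonzero_of L) (mittag_leffler k z).

(* [pole_series L 1] is the Weierstrass zeta function, [pole_series L 2] is [wp],
   and [pole_series L 3] is [- wp' / 2]. *)
Definition pole_series (L : C -> Prop) (k : nat) (z : C) : C :=
  (/ z ^ k + lattice_series L k z)%C.

Lemma mittag_leffler_ge_3 k z w : (3 <= k)%nat -> mittag_leffler k z w = (/ (z - w) ^ k)%C.
Proof. intros H. do 3 (destruct k as [|k]; [lia|]). reflexivity. Qed.

Lemma cder_inv_pow (a z : C) (k : nat) : z <> a -> (1 <= k)%nat ->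
  cder (fun x => / (x - a) ^ k)%C z (- INR k * / (z - a) ^ S k)%C.
Proof.
  intros Hz Hk. pose proof (Cminus_neq_0 _ _ Hz) as N.
  eapply cder_eq.
  - apply (cder_inv (fun x => (x - a) ^ k)%C).
    + apply (cder_pow (fun x => x - a)%C z (1 - 0)%C k).
      apply cder_minus; [apply cder_id | apply cder_const].
    + now apply Cpow_nz.
  - destruct k as [|n]; [lia|]. cbn [pred Cpow].
    pose proof (Cpow_nz (z - a)%C n N). set (p := ((z - a) ^ n)%C) in *. field. auto.
Qed.

Lemma cder_mittag_leffler k (z w : C) : (1 <= k)%nat -> z <> w -> w <> 0 ->
  cder (fun x => mittag_leffler k x w) z (- INR k * mittag_leffler (S k) z w)%C.
Proof.
  intros Hk Hz Hw. pose proof (Cminus_neq_0 _ _ Hz) as N.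
  destruct k as [|[|[|k]]]; [lia| | |].
  - apply cder_ext with (fun x => / (x - w) ^ 1 + (/ w + / w ^ 2 * x))%C.
    { intros x. unfold mittag_leffler, Cdiv. simpl. rewrite Cmult_1_r. ring. }
    eapply cder_eq.
    + apply cder_plus; [now apply cder_inv_pow|]. apply cder_plus; [apply cder_const|].
      apply cder_scal, cder_id.
    + unfold mittag_leffler. simpl INR. simpl Cpow. field. auto.
  - eapply cder_eq.
    + apply cder_minus; [now apply cder_inv_pow|apply cder_const].
    + unfold mittag_leffler. ring.
  - eapply cder_eq.
    + apply cder_inv_pow; auto.
    + reflexivity.
Qed.

Lemma mittag_leffler_opp k (z w : C) : z <> w -> w <> 0 -> (1 <= k)%nat ->
  mittag_leffler k (- z) (- w) = ((-1) ^ k * mittag_leffler k z w)%C.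
Proof.
  intros Hz Hw Hk. pose proof (Cminus_neq_0 _ _ Hz) as N.
  assert (N' : (- z - - w <> 0)%C).
  { replace (- z - - w)%C with (- (z - w))%C by ring. intros E. apply N.
    replace (z - w)%C with (- - (z - w))%C by ring. rewrite E. ring. }
  assert (M1 : RtoC (-1) <> 0) by (intros E; apply RtoC_inj in E; lra).
  destruct k as [|[|[|k]]]; [lia| | |].
  - unfold mittag_leffler. simpl Cpow. field. repeat split; auto.
  - unfold mittag_leffler. simpl Cpow. field. repeat split; auto.
  - rewrite !mittag_leffler_ge_3 by lia. set (n := S (S (S k))).
    replace (- z - - w)%C with (-1 * (z - w))%C by ring.
    rewrite Cpow_mult_l.
    assert (E : ((-1) ^ n * (-1) ^ n)%C = 1).
    { rewrite <- Cpow_mult_l. replace (-1 * -1)%C with (RtoC 1) by ring. apply Cpow_1_l. }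
    pose proof (Cpow_nz _ n N). pose proof (Cpow_nz _ n M1).
    replace (/ ((-1) ^ n * (z - w) ^ n))%C
      with (((-1) ^ n * (-1) ^ n) * / ((-1) ^ n * (z - w) ^ n))%C by (rewrite E; ring).
    field. auto.
Qed.

Lemma Cinv_conj' (z : C) : Cconj (/ z) = (/ Cconj z)%C.
Proof.
  destruct (classic (z = 0)) as [->|N]; [|now apply Cinv_conj].
  unfold Cconj, Cinv, RtoC; simpl. f_equal; unfold Rdiv; ring.
Qed.

Lemma mittag_leffler_conj k z w :
  mittag_leffler k (Cconj z) (Cconj w) = Cconj (mittag_leffler k z w).
Proof.
  destruct k as [|[|[|k]]]; unfold mittag_leffler, Cdiv;
    rewrite ?Cplus_conj, ?Cminus_conj, ?Cmult_conj, ?Cinv_conj', ?Cpow_conj, ?Cminus_conj;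
    reflexivity.
Qed.

(** * The Weierstrass series: convergence, derivatives, periods, expansion at the origin *)

Section LatticeSeries.

Variable L : C -> Prop.
Hypothesis HL : lattice L.

Lemma nonzero_of_locally_finite : locally_finite (nonzero_of L).
Proof. apply locally_finite_mono with L; [now apply lattice_locally_finite|]. now intros z []. Qed.

Lemma not_nonzero_of_0 : ~ nonzero_of L 0.
Proof. now intros []. Qed.

Lemma not_lattice_not_nonzero_of z : ~ L z -> ~ nonzero_of L z.
Proof. intros H []. auto. Qed.

Lemma nonzero_of_opp w : nonzero_of L w -> nonzero_of L (- w)%C.
Proof.
  intros [H N]. split; [now apply lattice_opp|]. intros E. apply N.
  replace w with (- - w)%C by ring. rewrite E. ring.
Qed.

(** For [w] of modulus at least [2 * Cmod z + 2] half of the modulus survives the subtraction. The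
    other [w] have bounded modulus and stay at distance at least [d / 2] because they are isolated.
    The bound is uniform in [h], as termwise differentiation requires. *)
Lemma lattice_distance_bound z : ~ nonzero_of L z -> exists c d, 0 < c /\ 0 < d <= 1 /\
  forall h w, Cmod h < d -> nonzero_of L w -> c * Cmod w <= Cmod (z + h - w).
Proof.
  intros Hz. destruct (locally_finite_gap _ z nonzero_of_locally_finite) as (d & Hd & K).
  pose proof (Cmod_ge_0 z).
  exists (Rmin (1 / 2) (d / (4 * Cmod z + 4))), (Rmin 1 (d / 2)).
  split. { apply Rmin_pos; [lra|]. apply Rdiv_lt_0_compat; lra. }
  split. { split; [apply Rmin_pos; lra | apply Rmin_l]. }
  intros h w Hh Hw. pose proof (Cmod_ge_0 w).
  pose proof (Rmin_l (1 / 2) (d / (4 * Cmod z + 4))) as C1.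
  pose proof (Rmin_r (1 / 2) (d / (4 * Cmod z + 4))) as C2.
  pose proof (Rmin_l 1 (d / 2)). pose proof (Rmin_r 1 (d / 2)).
  set (c := Rmin (1 / 2) (d / (4 * Cmod z + 4))) in *.
  assert (N : w <> z) by congruence.
  specialize (K w Hw N).
  destruct (Rle_dec (2 * Cmod z + 2) (Cmod w)) as [G|G].
  - pose proof (Cmod_triangle_inv w (z + h)). pose proof (Cmod_triangle z h).
    rewrite Cmod_minus_sym. nra.
  - pose proof (Cmod_triangle_inv (z - w) (- h)) as T. rewrite Cmod_opp in T.
    replace (z - w - - h)%C with (z + h - w)%C in T by ring.
    apply Rle_trans with (d / (4 * Cmod z + 4) * (2 * Cmod z + 2)).
    + apply Rmult_le_compat; try lra. unfold c. apply Rmin_glb; [lra|].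
      left. apply Rdiv_lt_0_compat; lra.
    + replace (d / (4 * Cmod z + 4) * (2 * Cmod z + 2)) with (d / 2) by (field; lra). lra.
Qed.

Lemma nonzero_of_lower_bound : exists d, 0 < d /\ forall w, nonzero_of L w -> d <= Cmod w.
Proof.
  destruct (locally_finite_gap _ 0 nonzero_of_locally_finite) as (d & Hd & K).
  exists d. split; auto. intros w Hw. specialize (K w Hw (proj2 Hw)).
  replace (0 - w)%C with (- w)%C in K by ring. now rewrite Cmod_opp in K.
Qed.

(** The correcting terms reduce the summand to [z ^ 2 / (w ^ 2 * (z - w))], which is of order -3 in
    [w]. *)
Lemma mittag_leffler_1_bound (c r : R) (z w : C) : 0 < c -> w <> 0 -> c * Cmod w <= Cmod (z - w) ->
  Cmod z <= r -> Cmod (mittag_leffler 1 z w) <= r ^ 2 / c * / Cmod w ^ 3.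
Proof.
  intros Hc Hw Hcw Hr. pose proof (proj1 (Cmod_gt_0 w) Hw) as W.
  assert (N : (z - w)%C <> 0) by (apply Cmod_gt_0; nra).
  replace (mittag_leffler 1 z w) with (z ^ 2 / (w ^ 2 * (z - w)))%C
    by (unfold mittag_leffler; field; auto).
  rewrite Cmod_div by (apply Cmult_neq_0; [now apply Cpow_nz|auto]).
  rewrite Cmod_mult, !Cmod_pow.
  replace (r ^ 2 / c * / Cmod w ^ 3) with (r ^ 2 / (Cmod w ^ 2 * (c * Cmod w))) by (field; lra).
  assert (0 < Cmod w ^ 2) by now apply pow_lt.
  pose proof (Cmod_ge_0 z).
  apply Rmult_le_compat.
  - apply pow2_ge_0.
  - left. apply Rinv_0_lt_compat, Rmult_lt_0_compat; nra.
  - apply pow_incr. lra.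
  - apply Rinv_le_contravar; [apply Rmult_lt_0_compat; nra|]. apply Rmult_le_compat_l; lra.
Qed.

(** One majorant serves all orders. For [k > 3] the surplus powers of [Cmod w] are absorbed by the
    positive lower bound [d] for nonzero lattice points. *)
Lemma mittag_leffler_bound k c r : 0 < c -> (1 <= k)%nat -> exists K, 0 <= K /\
  forall z w, nonzero_of L w -> c * Cmod w <= Cmod (z - w) -> Cmod z <= r ->
    Cmod (mittag_leffler k z w) <= K * / Cmod w ^ 3.
Proof.
  intros Hc Hk. destruct nonzero_of_lower_bound as (d & Hd & Hl).
  destruct k as [|[|[|k]]]; [lia| | |].
  - exists (r ^ 2 / c). split.
    { apply Rmult_le_pos; [apply pow2_ge_0 | left; now apply Rinv_0_lt_compat]. }
    intros z w [_ Hw] Hcw Hr. now apply mittag_leffler_1_bound.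
  - exists (Rabs r * (2 + Rabs r / d) / c ^ 2). 
    assert (C2 : 0 < c ^ 2) by now apply pow_lt. pose proof (Rabs_pos r).
    assert (0 <= Rabs r / d). { apply Rmult_le_pos; auto. left. now apply Rinv_0_lt_compat. }
    split. { apply Rmult_le_pos; [|left; now apply Rinv_0_lt_compat]. apply Rmult_le_pos; lra. }
    intros z w Hw Hcw Hr. pose proof (Hl w Hw) as Hdw. destruct Hw as [_ Hw].
    assert (N : (z - w)%C <> 0) by (apply Cmod_gt_0; nra).
    replace (mittag_leffler 2 z w) with (z * (2 * w - z) / (w ^ 2 * (z - w) ^ 2))%C
      by (unfold mittag_leffler; field; auto).
    rewrite Cmod_div by (apply Cmult_neq_0; now apply Cpow_nz).
    rewrite !Cmod_mult, !Cmod_pow.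
    assert (W2 : 0 < Cmod w ^ 2) by (apply pow_lt; lra).
    replace (Rabs r * (2 + Rabs r / d) / c ^ 2 * / Cmod w ^ 3)
      with (Rabs r * ((2 + Rabs r / d) * Cmod w) / (Cmod w ^ 2 * (c * Cmod w) ^ 2)) by (field; lra).
    pose proof (Cmod_ge_0 z). pose proof (Rle_abs r).
    apply Rmult_le_compat.
    + apply Rmult_le_pos; apply Cmod_ge_0.
    + left. apply Rinv_0_lt_compat, Rmult_lt_0_compat; [lra|]. apply pow_lt. nra.
    + apply Rmult_le_compat; auto using Cmod_ge_0; [lra|].
      eapply Rle_trans; [apply Cmod_triangle_minus|]. rewrite Cmod_mult, Cmod_R, Rabs_pos_eq by lra.
      assert (Cmod z <= Rabs r / d * Cmod w); [|lra].
      apply Rle_trans with (Rabs r / d * d).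
      { replace (Rabs r / d * d) with (Rabs r) by (field; lra). lra. }
      apply Rmult_le_compat_l; lra.
    + apply Rinv_le_contravar.
      * apply Rmult_lt_0_compat; [lra|]. apply pow_lt. nra.
      * apply Rmult_le_compat_l; [lra|]. apply pow_incr. nra.
  - exists (/ (c ^ S (S (S k)) * d ^ k)).
    assert (Ck : 0 < c ^ S (S (S k))) by now apply pow_lt.
    assert (Dk : 0 < d ^ k) by now apply pow_lt.
    split. { left. apply Rinv_0_lt_compat, Rmult_lt_0_compat; auto. }
    intros z w Hw Hcw _. pose proof (Hl w Hw) as Hdw. destruct Hw as [_ Hw].
    assert (N : (z - w)%C <> 0) by (apply Cmod_gt_0; nra).
    rewrite mittag_leffler_ge_3 by lia.
    rewrite Cmod_inv by now apply Cpow_nz. rewrite Cmod_pow.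
    rewrite <- Rinv_mult. apply Rinv_le_contravar.
    + apply Rmult_lt_0_compat; [now apply Rmult_lt_0_compat | apply pow_lt; lra].
    + apply Rle_trans with ((c * Cmod w) ^ S (S (S k))).
      * rewrite Rpow_mult_distr, Rmult_assoc. apply Rmult_le_compat_l; [lra|].
        replace (Cmod w ^ S (S (S k))) with (Cmod w ^ k * Cmod w ^ 3) by (simpl; ring).
        apply Rmult_le_compat_r. { left. apply pow_lt. lra. } apply pow_incr. lra.
      * apply pow_incr. nra.
Qed.

Lemma lattice_series_correct k z : (1 <= k)%nat -> ~ nonzero_of L z ->
  is_sum_over (nonzero_of L) (mittag_leffler k z) (lattice_series L k z).
Proof.
  intros Hk Hz. destruct (lattice_distance_bound z Hz) as (c & d & Hc & Hd & Hb).
  destruct (mittag_leffler_bound k c (Cmod z) Hc Hk) as (K & HK & HKb).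
  apply sum_over_correct with (fun w => K * / Cmod w ^ 3).
  - apply summable_scal; auto. now apply lattice_summable.
  - intros w Hw. apply HKb; auto; [|lra]. replace (z - w)%C with (z + 0 - w)%C by ring.
    apply Hb; auto. rewrite Cmod_0. lra.
Qed.

Lemma cder_lattice_series k z : (1 <= k)%nat -> ~ nonzero_of L z ->
  cder (lattice_series L k) z (- INR k * lattice_series L (S k) z)%C.
Proof.
  intros Hk Hz. destruct (lattice_distance_bound z Hz) as (c & d & Hc & Hd & Hb).
  destruct (mittag_leffler_bound (S (S k)) c (Cmod z + 1) Hc ltac:(lia)) as (K & HK & HKb).
  assert (Hn : forall h w, Cmod h < d -> nonzero_of L w -> (z + h)%C <> w).
  { intros h w Hh Hw E. specialize (Hb h w Hh Hw). destruct Hw as [_ Hw].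
    apply Cmod_gt_0 in Hw. replace (z + h - w)%C with (RtoC 0) in Hb by (rewrite E; ring).
    rewrite Cmod_0 in Hb. nra. }
  apply cder_sum with (A := nonzero_of L) (F := mittag_leffler k)
    (F1 := fun x w => (- INR k * mittag_leffler (S k) x w)%C)
    (F2 := fun x w => (- INR k * (- INR (S k) * mittag_leffler (S (S k)) x w))%C)
    (m := fun w => INR k * INR (S k) * (K * / Cmod w ^ 3)) (d := d).
  - apply summable_scal; [apply Rmult_le_pos; apply pos_INR|].
    apply summable_scal; auto. now apply lattice_summable.
  - lra.
  - intros h w Hh Hw. apply cder_mittag_leffler; auto. apply Hw.
  - intros h w Hh Hw. apply cder_scal. apply cder_mittag_leffler; auto. apply Hw.
  - intros h w Hh Hw. rewrite !Cmod_mult, !Cmod_opp, !Cmod_R.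
    rewrite !(Rabs_pos_eq _ (pos_INR _)), <- Rmult_assoc.
    apply Rmult_le_compat_l; [apply Rmult_le_pos; apply pos_INR|].
    apply HKb; auto. pose proof (Cmod_triangle z h). lra.
  - intros h Hh. apply lattice_series_correct; auto.
    intros Hw. exact (Hn h _ Hh Hw eq_refl).
  - apply is_sum_over_scal, lattice_series_correct; auto.
Qed.

(** The subset [l0] contains all nonzero lattice points of modulus at most [2 * r]; every other [w]
    satisfies [Cmod (z - w) >= Cmod w / 2] on the whole disc. Uniformity is needed for integrating
    along paths. *)
Lemma lattice_series_1_uniform r e : 0 < e -> exists l0, finite_in (nonzero_of L) l0 /\
  forall l z, finite_in (nonzero_of L) l -> incl l0 l -> Cmod z <= r -> ~ nonzero_of L z ->
    Cmod (lattice_series L 1 z - finite_sum (mittag_leffler 1 z) l) <= e.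
Proof.
  intros He. set (K := r ^ 2 / (1 / 2)).
  assert (HK : 0 <= K) by (unfold K; pose proof (pow2_ge_0 r); lra).
  pose proof (summable_scal _ _ _ HK (lattice_summable L HL)) as HS.
  destruct (summable_tail _ _ e HS He) as (l1 & Hl1 & T).
  destruct (nonzero_of_locally_finite (2 * r)) as (l2' & Hl2').
  assert (Hl2 : exists l2, finite_in (nonzero_of L) l2 /\
    forall w, nonzero_of L w -> Cmod w <= 2 * r -> In w l2).
  { set (p := fun w => if excluded_middle_informative (nonzero_of L w) then true else false).
    exists (filter p (nodup (fun x y => excluded_middle_informative (x = y)) l2')). split; [split|].
    - apply NoDup_filter, NoDup_nodup.
    - apply Forall_forall. intros w Hw. apply filter_In in Hw. unfold p in Hw.
      destruct (excluded_middle_informative (nonzero_of L w)); [auto|]. destruct Hw; congruence.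
    - intros w Hw Hr. apply filter_In. split; [apply nodup_In; auto|]. unfold p.
      destruct (excluded_middle_informative (nonzero_of L w)); tauto. }
  destruct Hl2 as (l2 & Hl2 & Hin).
  destruct (finite_in_union _ _ _ Hl1 Hl2) as (l0 & Hl0 & I1 & I2).
  exists l0. split; auto. intros l z Hl I Hz Nz.
  apply (is_sum_over_le _ _ _ l _ _ (lattice_series_correct 1 z ltac:(lia) Nz) Hl).
  intros l' Hl' I'.
  apply (finite_sum_tail (nonzero_of L) (mittag_leffler 1 z) (fun w => K * / Cmod w ^ 3) e l0); auto.
  - intros w Hw D. apply T; auto. intros x Hx Hx1. apply (D x Hx), I1, Hx1.
  - intros w Hw D. apply mittag_leffler_1_bound; auto; [lra|apply Hw|].
    assert (~ Cmod w <= 2 * r) by (intros Hr; apply D, I2, Hin; auto).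
    pose proof (Cmod_triangle_inv w z). rewrite Cmod_minus_sym. lra.
Qed.

Lemma lattice_series_opp k z : (1 <= k)%nat -> ~ nonzero_of L z ->
  lattice_series L k (- z) = ((-1) ^ k * lattice_series L k z)%C.
Proof.
  intros Hk Hz. apply sum_over_eq.
  apply is_sum_over_ext with (fun w => (-1) ^ k * mittag_leffler k z (- w))%C.
  - intros w Hw. rewrite <- mittag_leffler_opp; auto.
    + f_equal. ring.
    + intros E. apply Hz. rewrite E. now apply nonzero_of_opp.
    + now apply nonzero_of_opp.
  - apply is_sum_over_scal.
    apply (is_sum_over_reindex (nonzero_of L) (nonzero_of L) (mittag_leffler k z) _
             (fun w => - w)%C (fun w => - w)%C); try apply nonzero_of_opp; try (intros; ring).
    now apply lattice_series_correct.
Qed.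

Lemma pole_series_2 z : pole_series L 2 z = weierstrass_p L z.
Proof. reflexivity. Qed.

Lemma cder_pole_series k z : (1 <= k)%nat -> ~ L z ->
  cder (pole_series L k) z (- INR k * pole_series L (S k) z)%C.
Proof.
  intros Hk Hz. assert (z <> 0) by (intros ->; apply Hz; now apply lattice_0).
  apply cder_ext with (fun x => / (x - 0) ^ k + lattice_series L k x)%C.
  { intros x. unfold pole_series. now replace (x - 0)%C with x by ring. }
  eapply cder_eq.
  - apply cder_plus; [now apply cder_inv_pow|]. apply cder_lattice_series; auto.
    now apply not_lattice_not_nonzero_of.
  - unfold pole_series. replace (z - 0)%C with z by ring. ring.
Qed.

Lemma pole_series_opp k z : (1 <= k)%nat -> ~ L z ->
  pole_series L k (- z) = ((-1) ^ k * pole_series L k z)%C.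
Proof.
  intros Hk Hz. assert (z <> 0) by (intros ->; apply Hz; now apply lattice_0).
  unfold pole_series. rewrite lattice_series_opp; auto using not_lattice_not_nonzero_of.
  assert (M1 : RtoC (-1) <> 0) by (intros E; apply RtoC_inj in E; lra).
  assert (E : ((-1) ^ k * (-1) ^ k)%C = 1).
  { rewrite <- Cpow_mult_l. replace (-1 * -1)%C with (RtoC 1) by ring. apply Cpow_1_l. }
  assert (E2 : (/ (- z) ^ k)%C = ((-1) ^ k * / z ^ k)%C).
  { replace (- z)%C with (-1 * z)%C by ring. rewrite Cpow_mult_l.
    pose proof (Cpow_nz z k H). pose proof (Cpow_nz _ k M1).
    replace (/ ((-1) ^ k * z ^ k))%C
      with (((-1) ^ k * (-1) ^ k) * / ((-1) ^ k * z ^ k))%C by (rewrite E; ring).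
    field. auto. }
  rewrite E2. ring.
Qed.

Lemma is_sum_over_nonzero f S : is_sum_over (nonzero_of L) f S -> is_sum_over L f (f 0 + S)%C.
Proof.
  intros H e He. destruct (H e He) as (l0 & Hl0 & K).
  assert (F0 : finite_in L (RtoC 0 :: nil)).
  { split; [constructor; [auto|constructor]|constructor; [now apply lattice_0|constructor]]. }
  exists (RtoC 0 :: nil ++ l0). split.
  - apply (finite_in_app L (RtoC 0 :: nil) l0); auto.
    + destruct Hl0 as [N F]. split; auto. revert F. apply Forall_impl. now intros a [].
    + intros w [<-|[]] Hw. apply not_nonzero_of_0. now apply (finite_in_In _ l0).
  - intros l Hl I. destruct (finite_in_split L (RtoC 0 :: nil) l F0 Hl) as (r & Hr & Dr & P).
    { intros w [<-|[]]. apply I. now left. }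
    assert (Hr' : finite_in (nonzero_of L) r).
    { split; [apply Hr|]. apply Forall_forall. intros w Hw. split.
      - now apply (finite_in_In L r).
      - intros ->. apply (Dr 0 Hw). now left. }
    rewrite (finite_sum_perm f _ _ P). simpl.
    replace (f 0 + finite_sum f r - (f 0 + S))%C with (finite_sum f r - S)%C by ring.
    apply K; auto. intros w Hw.
    assert (Hwl : In w l) by (apply I; now right).
    apply (Permutation_in _ P) in Hwl. destruct Hwl as [E|Hwl]; auto.
    exfalso. apply not_nonzero_of_0. rewrite E. now apply (finite_in_In _ l0).
Qed.

(** From order 3 on there are no correcting terms, and the series is a sum over the whole lattice,
    which a translation only permutes. *)
Lemma pole_series_periodic_ge_3 k z v : (3 <= k)%nat -> ~ L z -> L v ->
  pole_series L k (z + v) = pole_series L k z.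
Proof.
  assert (H : forall x, (3 <= k)%nat -> ~ L x -> is_sum_over L (fun w => / (x - w) ^ k)%C (pole_series L k x)).
  { intros x Hk Hx. unfold pole_series.
    replace (/ x ^ k)%C with (/ (x - 0) ^ k)%C by (now replace (x - 0)%C with x by ring).
    apply (is_sum_over_nonzero (fun w => / (x - w) ^ k)%C).
    apply is_sum_over_ext with (mittag_leffler k x).
    - intros w _. now apply mittag_leffler_ge_3.
    - apply lattice_series_correct; [lia|]. now apply not_lattice_not_nonzero_of. }
  intros Hk Hz Hv.
  assert (Hzv : ~ L (z + v)%C) by (rewrite lattice_shift; auto).
  apply (is_sum_over_unique L (fun w => / (z + v - w) ^ k)%C); [auto|].
  apply is_sum_over_ext with (fun w => / (z - (w - v)) ^ k)%C.
  - intros w _. do 2 f_equal. ring.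
  - apply (is_sum_over_reindex L L (fun w => / (z - w) ^ k)%C _ (fun w => w - v)%C (fun w => w + v)%C);
      auto; try (intros; ring).
    + intros. now apply lattice_minus.
    + intros. now apply lattice_plus.
Qed.

Lemma exists_not_lattice : exists z, ~ L z.
Proof.
  destruct (near_exists 0 _ (locally_finite_near L 0 (lattice_locally_finite L HL))) as (z & _ & H).
  eauto.
Qed.

Lemma cder_shift f v z l : cder f (z + v)%C l -> cder (fun x => f (x + v)%C) z l.
Proof.
  intros H. eapply cder_eq.
  - apply (cder_comp f (fun x => x + v)%C z l (1 + 0)%C); [|exact H].
    apply cder_plus; [apply cder_id|apply cder_const].
  - ring.
Qed.

(** Periodicity one order higher says that the increment has derivative zero off [L]. *)
Lemma pole_series_quasi_periodic k z z' v : (1 <= k)%nat ->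
  (forall x, ~ L x -> pole_series L (S k) (x + v) = pole_series L (S k) x) ->
  ~ L z -> ~ L z' -> L v ->
  (pole_series L k (z + v) - pole_series L k z = pole_series L k (z' + v) - pole_series L k z')%C.
Proof.
  intros Hk HP Hz Hz' Hv.
  apply (constant_of_cder_0 L (fun x => pole_series L k (x + v) - pole_series L k x)%C); auto.
  { now apply lattice_locally_finite. }
  intros x Hx. eapply cder_eq.
  - apply cder_minus; [|now apply cder_pole_series].
    apply cder_shift. apply cder_pole_series; auto. rewrite lattice_shift; auto.
  - cbv beta. rewrite HP by auto. ring.
Qed.

(** The constant increment is compared at [z] and at [- (z + v)], where evenness turns it into its
    own negative. Unlike the half period [v / 2], these points lie off [L] whenever [z] does. *)
Lemma weierstrass_p_periodic z v : ~ L z -> L v -> pole_series L 2 (z + v) = pole_series L 2 z.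
Proof.
  intros Hz Hv.
  assert (Hzv : ~ L (z + v)%C) by (rewrite lattice_shift; auto).
  assert (Hz' : ~ L (- (z + v))%C) by (rewrite lattice_opp_iff; auto).
  pose proof (pole_series_quasi_periodic 2 z _ v ltac:(lia)
    (fun x Hx => pole_series_periodic_ge_3 3 x v ltac:(lia) Hx Hv) Hz Hz' Hv) as E.
  rewrite pole_series_opp in E by (auto; lia).
  replace (- (z + v) + v)%C with (- z)%C in E by ring.
  rewrite pole_series_opp in E by (auto; lia).
  set (a := pole_series L 2 (z + v)) in *. set (b := pole_series L 2 z) in *.
  assert (F : (a - b)%C = 0). { apply Ceq_opp_0. rewrite E at 1. ring. }
  replace a with (a - b + b)%C by ring. rewrite F. ring.
Qed.

Lemma pole_series_periodic k z v : (2 <= k)%nat -> ~ L z -> L v ->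
  pole_series L k (z + v) = pole_series L k z.
Proof.
  intros Hk Hz Hv. destruct (Nat.eq_dec k 2) as [->|N].
  - now apply weierstrass_p_periodic.
  - apply pole_series_periodic_ge_3; auto. lia.
Qed.

Lemma zeta_quasi_periodic v : L v -> exists eta, forall z, ~ L z ->
  pole_series L 1 (z + v) = (pole_series L 1 z + eta)%C.
Proof.
  intros Hv. destruct exists_not_lattice as (p & Hp).
  exists (pole_series L 1 (p + v) - pole_series L 1 p)%C. intros z Hz.
  rewrite <- (pole_series_quasi_periodic 1 z p v); auto; [ring|].
  intros. apply pole_series_periodic; auto.
Qed.

Lemma pow_bound_of_cder (f f' : C -> C) d K n : f 0 = 0 ->
  (forall z, Cmod z < d -> cder f z (f' z)) ->
  (forall z, Cmod z < d -> Cmod (f' z) <= K * Cmod z ^ n) -> 0 <= K ->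
  forall z, Cmod z < d -> Cmod (f z) <= K * Cmod z ^ S n.
Proof.
  intros F0 Hf HK K0 z Hz.
  assert (Hseg : forall t, 0 <= t <= 1 -> Cmod (seg 0 z t) <= Cmod z).
  { intros t Ht. pose proof (seg_in_ball 0 z t Ht) as H.
    replace (seg 0 z t - 0)%C with (seg 0 z t) in H by ring.
    now replace (z - 0)%C with z in H by ring. }
  pose proof (mean_value_seg f f' 0 z (K * Cmod z ^ n)) as M.
  rewrite F0 in M. replace (f z - 0)%C with (f z) in M by ring.
  replace (z - 0)%C with z in M by ring.
  replace (K * Cmod z ^ S n) with (K * Cmod z ^ n * Cmod z) by (simpl; ring). apply M.
  - intros t Ht. apply Hf. specialize (Hseg t Ht). lra.
  - intros t Ht. specialize (Hseg t Ht). eapply Rle_trans; [apply HK; lra|].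
    apply Rmult_le_compat_l; auto. apply pow_incr. split; auto using Cmod_ge_0.
Qed.

Lemma lattice_series_odd_0 k : (3 <= k)%nat -> ((-1) ^ k = -1)%C -> lattice_series L k 0 = 0.
Proof.
  intros Hk E. pose proof (lattice_series_opp k 0 ltac:(lia) not_nonzero_of_0) as H.
  replace (- 0)%C with (RtoC 0) in H by ring. rewrite E in H.
  apply Ceq_opp_0. rewrite H at 1. ring.
Qed.

(** The series of order [k] has derivative [- k] times the next one. Starting from a linear bound
    for order 6, integration goes down to order 2; the series of orders 5 and 3 vanish at 0 by
    parity, and the constants 5, 20, 60, 120 are the products of the factors [k]. *)
Lemma lattice_series_taylor : exists K d, 0 <= K /\ 0 < d /\ forall z, Cmod z < d ->
  ~ nonzero_of L z /\
  Cmod (lattice_series L 4 z - lattice_series L 4 0 - 10 * lattice_series L 6 0 * z ^ 2)%C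
    <= K * Cmod z ^ 3 /\
  Cmod (lattice_series L 3 z + 3 * lattice_series L 4 0 * z + 10 * lattice_series L 6 0 * z ^ 3)%C
    <= K * Cmod z ^ 4 /\
  Cmod (lattice_series L 2 z - 3 * lattice_series L 4 0 * z ^ 2 - 5 * lattice_series L 6 0 * z ^ 4)%C
    <= K * Cmod z ^ 5.
Proof.
  set (S4 := lattice_series L 4 0). set (S6 := lattice_series L 6 0).
  destruct nonzero_of_lower_bound as (d0 & Hd0 & Hl).
  pose proof (cder_lattice_series 6 0 ltac:(lia) not_nonzero_of_0) as H6.
  destruct (cder_eps _ _ _ 1 H6 Rlt_0_1) as (d1 & Hd1 & H6').
  set (K := Cmod (- INR 6 * lattice_series L 7 0)%C + 1).
  assert (K0 : 0 <= K) by (unfold K; pose proof (Cmod_ge_0 (- INR 6 * lattice_series L 7 0)%C); lra).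
  set (d := Rmin d0 d1). assert (Hd : 0 < d) by now apply Rmin_pos.
  assert (Hn : forall z, Cmod z < d -> ~ nonzero_of L z).
  { intros z Hz Hw. specialize (Hl z Hw). pose proof (Rmin_l d0 d1). fold d in H. lra. }
  assert (B6 : forall z, Cmod z < d -> Cmod (lattice_series L 6 z - S6) <= K * Cmod z ^ 1).
  { intros z Hz. pose proof (Rmin_r d0 d1) as R. fold d in R.
    specialize (H6' z ltac:(lra)). replace (0 + z)%C with z in H6' by ring. fold S6 in H6'.
    replace (lattice_series L 6 z - S6)%C
      with ((lattice_series L 6 z - S6 - - INR 6 * lattice_series L 7 0 * z)
            + - INR 6 * lattice_series L 7 0 * z)%C by ring.
    eapply Rle_trans; [apply Cmod_triangle|]. rewrite (Cmod_mult _ z). unfold K. lra. }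
  assert (B5 : forall z, Cmod z < d -> Cmod (lattice_series L 5 z + 5 * S6 * z)%C <= 5 * K * Cmod z ^ 2).
  { apply (pow_bound_of_cder _ (fun z => -5 * (lattice_series L 6 z - S6))%C d (5 * K) 1); [| | |lra].
    - rewrite lattice_series_odd_0; [ring|lia|ring].
    - intros z Hz. eapply cder_eq.
      + apply cder_plus; [apply cder_lattice_series; [lia|auto]|].
        apply cder_scal, cder_id.
      + simpl INR. rewrite !RtoC_plus. ring.
    - intros z Hz. rewrite Cmod_mult, Cmod_R. replace (Rabs (-5)) with 5 by (rewrite Rabs_left; lra).
      specialize (B6 z Hz). lra. }
  assert (B4 : forall z, Cmod z < d -> Cmod (lattice_series L 4 z - S4 - 10 * S6 * z ^ 2)%C <= 20 * K * Cmod z ^ 3).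
  { apply (pow_bound_of_cder _ (fun z => -4 * (lattice_series L 5 z + 5 * S6 * z))%C d (20 * K) 2); [| | |lra].
    - fold S4. ring.
    - intros z Hz. eapply cder_eq.
      + apply cder_minus; [apply cder_minus; [apply cder_lattice_series; [lia|auto]|apply cder_const]|].
        apply cder_scal, (cder_pow (fun w => w) z 1 2), cder_id.
      + simpl INR. simpl pred. rewrite !RtoC_plus. ring.
    - intros z Hz. rewrite Cmod_mult, Cmod_R. replace (Rabs (-4)) with 4 by (rewrite Rabs_left; lra).
      specialize (B5 z Hz). lra. }
  assert (B3 : forall z, Cmod z < d -> Cmod (lattice_series L 3 z + 3 * S4 * z + 10 * S6 * z ^ 3)%C <= 60 * K * Cmod z ^ 4).
  { apply (pow_bound_of_cder _ (fun z => -3 * (lattice_series L 4 z - S4 - 10 * S6 * z ^ 2))%C d (60 * K) 3); [| | |lra].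
    - rewrite lattice_series_odd_0; [ring|lia|ring].
    - intros z Hz. eapply cder_eq.
      + apply cder_plus; [apply cder_plus; [apply cder_lattice_series; [lia|auto]|apply cder_scal, cder_id]|].
        apply cder_scal, (cder_pow (fun w => w) z 1 3), cder_id.
      + simpl INR. simpl pred. rewrite !RtoC_plus. ring.
    - intros z Hz. rewrite Cmod_mult, Cmod_R. replace (Rabs (-3)) with 3 by (rewrite Rabs_left; lra).
      specialize (B4 z Hz). lra. }
  assert (B2 : forall z, Cmod z < d -> Cmod (lattice_series L 2 z - 3 * S4 * z ^ 2 - 5 * S6 * z ^ 4)%C <= 120 * K * Cmod z ^ 5).
  { apply (pow_bound_of_cder _ (fun z => -2 * (lattice_series L 3 z + 3 * S4 * z + 10 * S6 * z ^ 3))%C d (120 * K) 4); [| | |lra].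
    - assert (E : lattice_series L 2 0 = 0).
      { apply sum_over_eq. intros e He. exists nil. split; [apply finite_in_nil|]. intros l Hfl _.
        rewrite (finite_sum_ext _ (fun w => 0 * w)%C).
        - rewrite finite_sum_scal. rewrite Cmult_0_l. replace (0 - 0)%C with (RtoC 0) by ring.
          now rewrite Cmod_0.
        - intros w Hw. destruct (finite_in_In _ _ _ Hfl Hw) as [_ N].
          unfold mittag_leffler. field. auto. }
      rewrite E. ring.
    - intros z Hz. eapply cder_eq.
      + apply cder_minus; [apply cder_minus; [apply cder_lattice_series; [lia|auto]|]|];
        (apply cder_scal, (cder_pow (fun w => w) z 1), cder_id).
      + simpl INR. simpl pred. rewrite !RtoC_plus. ring.
    - intros z Hz. rewrite Cmod_mult, Cmod_R. replace (Rabs (-2)) with 2 by (rewrite Rabs_left; lra).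
      specialize (B3 z Hz). lra. }
  exists (120 * K), d. split; [lra|]. split; auto. intros z Hz.
  specialize (B4 z Hz). specialize (B3 z Hz). specialize (B2 z Hz).
  pose proof (pow_le _ 3 (Cmod_ge_0 z)). pose proof (pow_le _ 4 (Cmod_ge_0 z)).
  repeat split; auto; nra.
Qed.

Lemma invariant_series k : (3 <= k)%nat -> ((-1) ^ k = 1)%C ->
  sum_over (nonzero_of L) (fun w => / w ^ k)%C = lattice_series L k 0.
Proof.
  intros Hk E. apply sum_over_eq.
  apply is_sum_over_ext with (mittag_leffler k 0).
  - intros w [_ Hw]. rewrite mittag_leffler_ge_3 by auto.
    replace (0 - w)%C with (-1 * w)%C by ring. rewrite Cpow_mult_l, E. f_equal. ring.
  - apply lattice_series_correct; [lia|apply not_nonzero_of_0].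
Qed.

Lemma g2_series : g2 L = (60 * lattice_series L 4 0)%C.
Proof. unfold g2. rewrite invariant_series; [auto|lia|ring]. Qed.

Lemma g3_series : g3 L = (140 * lattice_series L 6 0)%C.
Proof. unfold g3. rewrite invariant_series; [auto|lia|ring]. Qed.

End LatticeSeries.

(** ** Doubly periodic holomorphic functions are constant *)

Lemma constant_off_list (I : R -> R) (l : list R) : forall a b, a <= b ->
  (forall x, a <= x <= b -> continuity_pt I x) ->
  (forall x, a < x < b -> ~ In x l -> is_derive I x 0) -> I a = I b.
Proof.
  induction l as [|y l IH]; intros a b Hab HC HD.
  - destruct (MVT_gen I a b (fun _ => 0)) as (c & _ & E).
    + rewrite Rmin_left, Rmax_right by auto. intros x Hx. apply HD; auto.
    + rewrite Rmin_left, Rmax_right by auto. auto.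
    + lra.
  - destruct (classic (a < y < b)) as [Hy|Hy].
    + transitivity (I y); apply IH; try lra.
      * intros x Hx. apply HC. lra.
      * intros x Hx Nx. apply HD; [lra|]. intros [->|F]; [lra|auto].
      * intros x Hx. apply HC. lra.
      * intros x Hx Nx. apply HD; [lra|]. intros [->|F]; [lra|auto].
    + apply IH; auto. intros x Hx Nx. apply HD; auto. intros [->|F]; [lra|auto].
Qed.

Lemma gap_from_list (l : list R) x : ~ In x l ->
  exists d, 0 < d /\ forall u, Rabs (u - x) < d -> ~ In u l.
Proof.
  induction l as [|y l IH]; intros H.
  - exists 1. split; [lra|auto].
  - destruct IH as (d & Hd & K). { intros F. apply H. now right. }
    assert (P : 0 < Rabs (y - x)). { apply Rabs_pos_lt. intros E. apply H. left. lra. }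
    exists (Rmin d (Rabs (y - x))). split; [now apply Rmin_pos|].
    intros u Hu [->|F].
    + pose proof (Rmin_r d (Rabs (u - x))). lra.
    + pose proof (Rmin_l d (Rabs (y - x))). apply (K u); auto. lra.
Qed.

Definition ccont2 (p : R -> R -> C) (x y : R) : Prop :=
  forall e, 0 < e -> exists d, 0 < d /\
    forall u v, Rabs (u - x) < d -> Rabs (v - y) < d -> Cmod (p u v - p x y) < e.

Lemma ccont2_Re p x y : ccont2 p x y -> continuity_2d_pt (fun u v => Re (p u v)) x y.
Proof.
  intros H [e He]. destruct (H e He) as (d & Hd & K). exists (mkposreal d Hd).
  intros u v Hu Hv. eapply Rle_lt_trans; [|exact (K u v Hu Hv)].
  apply (re_le_Cmod (p u v - p x y)).
Qed.

Lemma ccont2_comp f p x y : ccont2 p x y -> ccont f (p x y) -> ccont2 (fun u v => f (p u v)) x y.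
Proof.
  intros Hp Hf e He. destruct (ccont_eps _ _ _ Hf He) as (d & Hd & K).
  destruct (Hp d Hd) as (d' & Hd' & K'). exists d'. split; auto.
Qed.

Lemma ccont2_mult f g x y : ccont2 f x y -> ccont2 g x y -> ccont2 (fun u v => f u v * g u v)%C x y.
Proof.
  intros Hf Hg e He.
  set (K := Cmod (f x y) + Cmod (g x y) + 2).
  pose proof (Cmod_ge_0 (f x y)). pose proof (Cmod_ge_0 (g x y)).
  assert (HK : 0 < K) by (unfold K; lra).
  assert (He' : 0 < Rmin 1 (e / K)) by (apply Rmin_pos; [lra|now apply Rdiv_lt_0_compat]).
  destruct (Hf _ He') as (d1 & Hd1 & K1). destruct (Hg _ He') as (d2 & Hd2 & K2).
  exists (Rmin d1 d2). split; [now apply Rmin_pos|]. intros u v Hu Hv.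
  pose proof (Rmin_l d1 d2). pose proof (Rmin_r d1 d2).
  pose proof (Rmin_l 1 (e / K)). pose proof (Rmin_r 1 (e / K)).
  specialize (K1 u v ltac:(lra) ltac:(lra)). specialize (K2 u v ltac:(lra) ltac:(lra)).
  replace (f u v * g u v - f x y * g x y)%C
    with ((f u v - f x y) * g u v + f x y * (g u v - g x y))%C by ring.
  eapply Rle_lt_trans; [apply Cmod_triangle|]. rewrite !Cmod_mult.
  pose proof (Cmod_triangle_inv (g u v) (g x y)).
  apply Rle_lt_trans with (e / K * (Cmod (g x y) + 1) + Cmod (f x y) * (e / K)).
  - apply Rplus_le_compat; apply Rmult_le_compat; auto using Cmod_ge_0; lra.
  - assert (0 < e / K) by now apply Rdiv_lt_0_compat.
    apply Rlt_le_trans with (e / K * K); [assert (EK : K = Cmod (f x y) + Cmod (g x y) + 2) by reflexivity; nra|]. right. field. lra.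
Qed.

Lemma ccont2_plus_const a f x y : ccont2 f x y -> ccont2 (fun u v => a + f u v)%C x y.
Proof.
  intros Hf e He. destruct (Hf e He) as (d & Hd & K). exists d. split; auto. intros u v Hu Hv.
  replace (a + f u v - (a + f x y))%C with (f u v - f x y)%C by ring. auto.
Qed.

Lemma ccont2_fst x y : ccont2 (fun u _ => RtoC u) x y.
Proof.
  intros e He. exists e. split; auto. intros u v Hu _. now rewrite <- RtoC_minus, Cmod_R.
Qed.

Lemma ccont2_snd g x y : rcont g y -> ccont2 (fun _ v => g v) x y.
Proof.
  intros H e He. destruct (proj1 (rcont_eps _ _) H e He) as (d & Hd & K). exists d. split; auto.
Qed.

Definition cis (t : R) : C := Cexp (Ci * t).

Lemma rder_cis t : rder cis t (Ci * cis t)%C.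
Proof.
  eapply rder_eq.
  - apply (rder_comp Cexp (fun s => Ci * s)%C); [|apply cder_Cexp].
    apply rder_mult; [apply rder_const|apply rder_RtoC].
  - unfold cis. cbv beta. ring.
Qed.

Lemma Cmod_cis t : Cmod (cis t) = 1.
Proof.
  unfold cis. rewrite Cmod_Cexp. replace (Re (Ci * t)%C) with 0; [apply exp_0|].
  unfold Re, Ci, RtoC, Cmult; simpl. ring.
Qed.

Lemma cis_2PI : cis (2 * PI) = cis 0.
Proof.
  unfold cis, Cexp.
  replace (Re (Ci * RtoC (2 * PI))%C) with 0 by (unfold Re, Ci, RtoC, Cmult; simpl; ring).
  replace (Im (Ci * RtoC (2 * PI))%C) with (2 * PI) by (unfold Im, Ci, RtoC, Cmult; simpl; ring).
  replace (Re (Ci * RtoC 0)%C) with 0 by (unfold Re, Ci, RtoC, Cmult; simpl; ring).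
  replace (Im (Ci * RtoC 0)%C) with 0 by (unfold Im, Ci, RtoC, Cmult; simpl; ring).
  now rewrite cos_2PI, sin_2PI, cos_0, sin_0.
Qed.

Lemma cis_PI : cis PI = (-1)%C.
Proof.
  unfold cis, Cexp.
  replace (Re (Ci * RtoC PI)%C) with 0 by (unfold Re, Ci, RtoC, Cmult; simpl; ring).
  replace (Im (Ci * RtoC PI)%C) with PI by (unfold Im, Ci, RtoC, Cmult; simpl; ring).
  rewrite cos_PI, sin_PI, exp_0. unfold RtoC. f_equal; ring.
Qed.

Section MeanValue.

Variables (S : C -> Prop) (f f1 : C -> C).
Hypothesis HS : locally_finite S.
Hypothesis Hf : forall z, ccont f z.
Hypothesis Hf1 : forall z, ~ S z -> cder f z (f1 z) /\ ccont f1 z.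

Variables c rho : C.
Hypothesis Hrho : rho <> 0.

Let p (r t : R) : C := (c + r * (rho * cis t))%C.
Let mean (r : R) : R := RInt (fun t => Re (f (p r t))) 0 (2 * PI).

Lemma circle_continuous r t : ccont2 p r t.
Proof.
  apply (ccont2_plus_const c (fun u v => u * (rho * cis v))%C).
  apply (ccont2_mult (fun u _ => RtoC u) (fun _ v => rho * cis v)%C); [apply ccont2_fst|].
  apply ccont2_snd. apply rcont_mult; eapply rder_rcont; [apply rder_const|apply rder_cis].
Qed.

Lemma circle_rcont r t : rcont (fun v => p r v) t.
Proof.
  apply rcont_eps. intros e He. destruct (circle_continuous r t e He) as (d & Hd & K).
  exists d. split; auto. intros s Hs. apply K; auto.
  replace (r - r) with 0 by ring. now rewrite Rabs_R0.
Qed.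

Lemma circle_ex_RInt r a b : ex_RInt (fun t => Re (f (p r t))) a b.
Proof.
  apply (ex_RInt_continuous (V := R_CompleteNormedModule)). intros t _.
  exact (proj1 (rcont_comp f (fun v => p r v) t (circle_rcont r t) (Hf _))).
Qed.

Lemma circle_mean_continuous r : continuity_pt mean r.
Proof.
  pose proof PI_RGT_0 as HPI.
  apply continuity_pt_filterlim, filterlim_locally. intros [e He].
  assert (He' : 0 < e / (4 * PI)) by (apply Rdiv_lt_0_compat; lra).
  destruct (uniform_continuity_2d_1d' (fun u v => Re (f (p u v))) 0 (2 * PI) r) with (eps := mkposreal _ He')
    as ([d Hd] & K).
  { intros t _. apply ccont2_Re, ccont2_comp; [apply circle_continuous|apply Hf]. }
  simpl in K. exists (mkposreal d Hd). intros s Hs.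
  assert (Hs' : Rabs (s - r) < d) by exact Hs. apply Rabs_def2 in Hs'.
  change (Rabs (mean s - mean r) < e). unfold mean.
  replace (RInt (fun t => Re (f (p s t))) 0 (2 * PI) - RInt (fun t => Re (f (p r t))) 0 (2 * PI))
    with (RInt (fun t => Re (f (p s t)) - Re (f (p r t))) 0 (2 * PI)).
  - apply Rle_lt_trans with ((2 * PI - 0) * (e / (4 * PI))).
    + apply abs_RInt_le_const; [lra| |].
      * apply (ex_RInt_minus (V := R_NormedModule)); apply circle_ex_RInt.
      * intros t Ht. left. apply K; try lra. replace (t - t) with 0 by ring. now rewrite Rabs_R0.
    + replace ((2 * PI - 0) * (e / (4 * PI))) with (e / 2) by (field; lra). lra.
  - apply (RInt_minus (V := R_CompleteNormedModule)); apply circle_ex_RInt.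
Qed.

(** By the Cauchy-Riemann equations the radial derivative of [Re f] is [/ r] times the angular
    derivative of [Im f], whose integral over the closed circle is zero. *)
Lemma circle_mean_derive r : 0 < r ->
  (exists d, 0 < d /\ forall u t, Rabs (u - r) < d -> ~ S (p u t)) -> is_derive mean r 0.
Proof.
  intros Hr (d & Hd & K).
  assert (D1 : forall u t, Rabs (u - r) < d ->
     is_derive (fun z => Re (f (p z t))) u (Re (f1 (p u t) * (rho * cis t))%C)).
  { intros u t Hu. refine (proj1 (rder_comp f (fun z => p z t) u _ _ _ _)).
    - eapply rder_eq.
      + apply rder_plus; [apply rder_const|]. apply rder_mult; [apply rder_RtoC|apply rder_const].
      + cbv beta. ring.
    - apply Hf1. auto. }
  assert (Hrr : Rabs (r - r) < d) by (replace (r - r) with 0 by ring; now rewrite Rabs_R0).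
  assert (E : RInt (fun t => Derive (fun u => Re (f (p u t))) r) 0 (2 * PI) = 0).
  { apply is_RInt_unique.
    set (J := fun t => / r * Im (f (p r t))).
    replace 0 with (minus (J (2 * PI)) (J 0)) at 2
      by (unfold J, p, minus, plus, opp; simpl; rewrite cis_2PI; ring).
    apply (is_RInt_ext (fun t => Re (f1 (p r t) * (rho * cis t))%C)).
    { intros t _. symmetry. apply is_derive_unique. now apply D1. }
    apply (is_RInt_derive (V := R_CompleteNormedModule) J).
    - intros t _. unfold J.
      replace (Re (f1 (p r t) * (rho * cis t))%C)
        with (/ r * Im (f1 (p r t) * (r * (rho * (Ci * cis t))))%C).
      2:{ unfold Re, Im, Ci, RtoC, Cmult; simpl. field. lra. }
      apply (is_derive_scal (fun t => Im (f (p r t))) t).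
      refine (proj2 (rder_comp f (fun z => p r z) t _ _ _ _)).
      + eapply rder_eq.
        * apply rder_plus; [apply rder_const|]. apply rder_mult; [apply rder_const|].
          apply rder_mult; [apply rder_const|apply rder_cis].
        * cbv beta. ring.
      + apply Hf1. auto.
    - intros t _. refine (proj1 (rcont_mult (fun t => f1 (p r t)) _ t _ _)).
      + apply rcont_comp; [apply circle_rcont|]. apply Hf1. auto.
      + apply rcont_mult; eapply rder_rcont; [apply rder_const|apply rder_cis]. }
  rewrite <- E.
  apply (is_derive_RInt_param (fun u t => Re (f (p u t))) 0 (2 * PI) r).
  - exists (mkposreal d Hd). intros u Hu t _. eexists. apply D1. exact Hu.
  - intros t _. apply continuity_2d_pt_ext_loc with (fun u v => Re (f1 (p u v) * (rho * cis v))%C).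
    + exists (mkposreal d Hd). intros u v Hu _. symmetry. apply is_derive_unique. now apply D1.
    + apply (ccont2_Re (fun u v => f1 (p u v) * (rho * cis v))%C).
      apply (ccont2_mult (fun u v => f1 (p u v)) (fun _ v => rho * cis v)%C).
      * apply ccont2_comp; [apply circle_continuous|]. apply Hf1. auto.
      * apply ccont2_snd. apply rcont_mult; eapply rder_rcont; [apply rder_const|apply rder_cis].
  - exists (mkposreal d Hd). intros u _. apply circle_ex_RInt.
Qed.

(* The circles that meet [S] are finitely many; there the mean is still continuous in the
   radius, so continuous singularities are harmless. *)
Lemma circle_mean_value : mean 1 = 2 * PI * Re (f c).
Proof.
  assert (Hrho' : 0 < Cmod rho) by now apply Cmod_gt_0.
  destruct (HS (Cmod c + 2 * Cmod rho)) as (l & Hl).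
  transitivity (mean 0).
  - symmetry. apply (constant_off_list mean (map (fun w => Cmod (w - c) / Cmod rho) l)); [lra| |].
    + intros x _. apply circle_mean_continuous.
    + intros x Hx Nx. apply circle_mean_derive; [lra|].
      destruct (gap_from_list _ _ Nx) as (d & Hd & K).
      exists (Rmin d (Rmin x (1 - x))).
      split; [apply Rmin_pos; [auto|apply Rmin_pos; lra]|].
      intros u t Hu HSu.
      pose proof (Rmin_l d (Rmin x (1 - x))). pose proof (Rmin_r d (Rmin x (1 - x))).
      pose proof (Rmin_l x (1 - x)). pose proof (Rmin_r x (1 - x)).
      apply (K u); [lra|].
      assert (Hu' : - Rmin x (1 - x) < u - x < Rmin x (1 - x)) by (apply Rabs_def2 in Hu; lra).
      assert (E : Cmod (p u t - c) = u * Cmod rho).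
      { unfold p. replace (c + u * (rho * cis t) - c)%C with (u * (rho * cis t))%C by ring.
        rewrite !Cmod_mult, Cmod_cis, Cmod_R, Rabs_pos_eq by lra. ring. }
      replace u with (Cmod (p u t - c) / Cmod rho) by (rewrite E; field; lra).
      apply (in_map (fun w => Cmod (w - c) / Cmod rho)).
      apply Hl; auto. pose proof (Cmod_triangle_inv (p u t) c). nra.
  - unfold mean.
    rewrite (RInt_ext _ (fun _ => Re (f c))).
    + rewrite RInt_const. unfold scal; simpl. unfold mult; simpl. ring.
    + intros t _. do 2 f_equal. unfold p. ring.
Qed.

(** [M * t - J t] is nondecreasing and vanishes at both ends of [[0, 2 * PI]], hence throughout. Its
    derivative at [PI], an interior parameter, gives the value at [c - rho]; since [rho] is any
    nonzero number, this reaches every other point of the plane. *)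
Lemma max_principle : (forall z, Re (f z) <= Re (f c)) -> Re (f (c - rho)%C) = Re (f c).
Proof.
  intros HM. pose proof PI_RGT_0 as HPI.
  set (h := fun t => Re (f (p 1 t))).
  set (J := fun t => RInt h 0 t).
  assert (Hh : forall t, continuous h t).
  { intros t. exact (proj1 (rcont_comp f (fun v => p 1 v) t (circle_rcont 1 t) (Hf _))). }
  assert (HJ : forall t, is_derive J t (h t)).
  { intros t. apply (is_derive_RInt (V := R_NormedModule) h J 0 t); [|apply Hh].
    exists (mkposreal 1 Rlt_0_1). intros y _.
    apply (RInt_correct (V := R_CompleteNormedModule)). apply circle_ex_RInt. }
  set (M := Re (f c)).
  assert (HG : forall t, is_derive (fun t => M * t - J t) t (M - h t)).
  { intros t. apply (is_derive_minus (V := R_NormedModule) (fun t => M * t) J t M (h t)); [|apply HJ].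
    auto_derive; auto. ring. }
  assert (Hinc : forall a b, a <= b -> M * a - J a <= M * b - J b).
  { intros a b Hab. destruct (MVT_gen (fun t => M * t - J t) a b (fun t => M - h t)) as (x & _ & E).
    - intros x _. apply HG.
    - intros x _. apply continuity_pt_filterlim.
      apply (ex_derive_continuous (V := R_NormedModule) (fun t => M * t - J t)).
      eexists. apply HG.
    - cut (0 <= (M - h x) * (b - a)); [lra|]. apply Rmult_le_pos; [|lra].
      specialize (HM (p 1 x)). fold (h x) in HM. fold M in HM. lra. }
  assert (J0 : J 0 = 0) by apply (RInt_point (V := R_CompleteNormedModule)).
  assert (J1 : J (2 * PI) = 2 * PI * M) by apply circle_mean_value.
  assert (Z : forall t, 0 <= t <= 2 * PI -> M * t - J t = 0).
  { intros t Ht. pose proof (Hinc 0 t (proj1 Ht)). pose proof (Hinc t (2 * PI) (proj2 Ht)). lra. }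
  assert (E : h PI = M).
  { cut (0 = M - h PI); [lra|].
    rewrite <- (is_derive_unique _ _ _ (HG PI)).
    symmetry. apply is_derive_unique.
    apply (is_derive_ext_loc (fun _ => 0)); [|apply (is_derive_const (V := R_NormedModule))].
    exists (mkposreal PI HPI). intros t Ht. symmetry. apply Z.
    assert (Ht' : Rabs (t - PI) < PI) by exact Ht. apply Rabs_def2 in Ht'. lra. }
  rewrite <- E. unfold h, p. rewrite cis_PI. do 2 f_equal. ring.
Qed.

End MeanValue.

(** The maximum over [y] is a continuous function of [x] by uniform continuity, so the one-variable
    theorem can be used twice. *)
Lemma continuous_max_2d (u : R -> R -> R) :
  (forall x y, 0 <= x <= 1 -> 0 <= y <= 1 -> continuity_2d_pt u x y) ->
  exists x0 y0, forall x y, 0 <= x <= 1 -> 0 <= y <= 1 -> u x y <= u x0 y0.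
Proof.
  intros Hu.
  assert (H1 : forall x, exists y0, 0 <= y0 <= 1 /\ forall y, 0 <= x <= 1 -> 0 <= y <= 1 -> u x y <= u x y0).
  { intros x. destruct (classic (0 <= x <= 1)) as [Hx|Hx].
    - destruct (continuity_ab_maj (u x) 0 1) as (y0 & K & Hy); [lra| |].
      + intros y Hy. apply continuity_pt_filterlim, filterlim_locally. intros e.
        destruct (Hu x y Hx Hy e) as (d & Hd). exists d. intros v Hv. apply Hd; auto.
        replace (x - x) with 0 by ring. rewrite Rabs_R0. apply cond_pos.
      + exists y0. split; auto.
    - exists 0. split; [lra|tauto]. }
  set (t := fun x => proj1_sig (constructive_indefinite_description _ (H1 x))).
  assert (Ht : forall x, 0 <= t x <= 1 /\ forall y, 0 <= x <= 1 -> 0 <= y <= 1 -> u x y <= u x (t x)).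
  { intros x. unfold t. destruct (constructive_indefinite_description _ (H1 x)); auto. }
  (* Clamping makes the partial maximum continuous from both sides at the end points of [0, 1]. *)
  set (m := fun x => u (clamp x) (t (clamp x))).
  destruct (continuity_ab_maj m 0 1) as (x0 & K & Hx0); [lra| |].
  - intros x Hx. apply continuity_pt_filterlim, filterlim_locally. intros [e He].
    destruct (uniform_continuity_2d_1d' u 0 1 x) with (eps := mkposreal e He) as ([d Hd] & U).
    { intros y Hy. apply Hu; auto. }
    simpl in U. exists (mkposreal d Hd). intros s Hs.
    assert (Hs' : Rabs (s - x) < d) by exact Hs.
    change (Rabs (m s - m x) < e). unfold m. rewrite (clamp_id x Hx).
    assert (Hc : x - d <= clamp s <= x + d).
    { apply Rabs_def2 in Hs'. unfold clamp, Rmax, Rmin. repeat destruct (Rle_dec _ _); lra. }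
    pose proof (clamp_in s) as Hcs. set (s' := clamp s) in *.
    destruct (Ht s') as [A B]. destruct (Ht x) as [A' B'].
    assert (V : forall y, 0 <= y <= 1 -> Rabs (u s' y - u x y) < e).
    { intros y Hy. apply U; try lra. replace (y - y) with 0 by ring. now rewrite Rabs_R0. }
    pose proof (V _ A) as V1. pose proof (V _ A') as V2.
    apply Rabs_def2 in V1. apply Rabs_def2 in V2.
    pose proof (B (t x) Hcs A'). pose proof (B' (t s') Hx A). apply Rabs_def1; lra.
  - exists x0, (t x0). intros x y Hx Hy. specialize (K x Hx). unfold m in K.
    rewrite !clamp_id in K by auto. destruct (Ht x) as [_ B]. specialize (B y Hx Hy). lra.
Qed.

Lemma real_coordinates (w1 w2 : C) :
  (forall s t : R, (s * w1 + t * w2 = 0)%C -> s = 0 /\ t = 0) ->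
  forall z, exists s t : R, z = (s * w1 + t * w2)%C.
Proof.
  intros H z. destruct w1 as [x1 y1], w2 as [x2 y2], z as [x y].
  assert (HC : forall s t : R, (s * (x1, y1) + t * (x2, y2))%C = (s * x1 + t * x2, s * y1 + t * y2)).
  { intros. unfold Cmult, Cplus, RtoC; simpl. f_equal; ring. }
  set (D := x1 * y2 - y1 * x2).
  assert (HD : D <> 0).
  { intros E. unfold D in E.
    destruct (H y2 (- y1)) as [Y2 Y1]. { rewrite HC. unfold RtoC. f_equal; nra. }
    destruct (H x2 (- x1)) as [X2 X1]. { rewrite HC. unfold RtoC. f_equal; nra. }
    destruct (H 1 0) as [F _]; [|lra]. rewrite HC. unfold RtoC. f_equal; nra. }
  exists ((x * y2 - y * x2) / D), ((x1 * y - y1 * x) / D).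
  rewrite HC. unfold D in *. f_equal; field; auto.
Qed.

(** All values are taken on the period parallelogram, the image of the unit square under [p]. *)
Lemma periodic_max (L : C -> Prop) (u : C -> C) : lattice L -> (forall z, ccont u z) ->
  (forall z v, L v -> u (z + v)%C = u z) -> exists c, forall z, Re (u z) <= Re (u c).
Proof.
  intros (w1 & w2 & Hi & HL) Hu Hp.
  set (p := fun x y : R => (2 * x * w1 + 2 * y * w2)%C).
  assert (Hpc : forall x y, ccont2 p x y).
  { intros x y e He. unfold p. set (K := 2 * Cmod w1 + 2 * Cmod w2 + 1).
    pose proof (Cmod_ge_0 w1). pose proof (Cmod_ge_0 w2).
    assert (HK : 0 < K) by (unfold K; lra).
    exists (e / K). split; [now apply Rdiv_lt_0_compat|]. intros u' v Hu' Hv.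
    replace (2 * u' * w1 + 2 * v * w2 - (2 * x * w1 + 2 * y * w2))%C
      with (2 * (u' - x)%R * w1 + 2 * (v - y)%R * w2)%C by (rewrite !RtoC_minus; ring).
    eapply Rle_lt_trans; [apply Cmod_triangle|]. rewrite !Cmod_mult, !Cmod_R, (Rabs_pos_eq 2) by lra.
    apply Rle_lt_trans with (2 * (e / K) * Cmod w1 + 2 * (e / K) * Cmod w2).
    - apply Rplus_le_compat; apply Rmult_le_compat_r; lra.
    - assert (0 < e / K) by now apply Rdiv_lt_0_compat.
      apply Rlt_le_trans with (e / K * K); [assert (EK : K = 2 * Cmod w1 + 2 * Cmod w2 + 1) by reflexivity; nra|]. right. field. lra. }
  destruct (continuous_max_2d (fun x y => Re (u (p x y)))) as (x0 & y0 & HM).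
  { intros x y _ _. apply ccont2_Re, ccont2_comp; auto. }
  exists (p x0 y0). intros z.
  destruct (real_coordinates w1 w2 Hi z) as (s & t & Ez).
  destruct (archimed (s / 2)) as [A1 A2]. destruct (archimed (t / 2)) as [B1 B2].
  set (m := (up (s / 2) - 1)%Z). set (n := (up (t / 2) - 1)%Z).
  assert (Hm : IZR m = IZR (up (s / 2)) - 1) by (unfold m; now rewrite minus_IZR).
  assert (Hn : IZR n = IZR (up (t / 2)) - 1) by (unfold n; now rewrite minus_IZR).
  assert (E : z = (p (s / 2 - IZR m)%R (t / 2 - IZR n)%R + (2 * IZR m * w1 + 2 * IZR n * w2))%C).
  { rewrite Ez. unfold p. rewrite !RtoC_minus, !RtoC_div by lra. field. }
  rewrite E, Hp; [apply HM; lra|]. apply HL. eauto.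
Qed.

Lemma liouville_Re (L S : C -> Prop) (f f1 : C -> C) : lattice L -> locally_finite S ->
  (forall z, ccont f z) -> (forall z, ~ S z -> cder f z (f1 z) /\ ccont f1 z) ->
  (forall z v, L v -> f (z + v)%C = f z) -> forall z w, Re (f z) = Re (f w).
Proof.
  intros HL HS Hf Hf1 Hp.
  destruct (periodic_max L f HL Hf Hp) as (c & Hc).
  assert (K : forall z, Re (f z) = Re (f c)).
  { intros z. destruct (classic (z = c)) as [->|N]; auto.
    replace z with (c - (c - z))%C by ring.
    apply (max_principle S f f1); auto. apply Cminus_neq_0. auto. }
  intros z w. now rewrite !K.
Qed.

(** On [S] only continuity is assumed, so removable singularities can be filled with their limits
    without differentiating there. The imaginary part of [f] is the real part of [- Ci * f]. *)
Theorem liouville_elliptic (L S : C -> Prop) (f f1 : C -> C) : lattice L -> locally_finite S ->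
  (forall z, ccont f z) -> (forall z, ~ S z -> cder f z (f1 z) /\ ccont f1 z) ->
  (forall z v, L v -> f (z + v)%C = f z) -> forall z w, f z = f w.
Proof.
  intros HL HS Hf Hf1 Hp z w.
  pose proof (liouville_Re L S f f1 HL HS Hf Hf1 Hp z w) as E1.
  pose proof (liouville_Re L S (fun z => - Ci * f z)%C (fun z => - Ci * f1 z)%C HL HS) as E2.
  assert (E3 : forall a, Re (- Ci * a)%C = Im a).
  { intros a. unfold Re, Im, Ci, Cmult, Copp; simpl. ring. }
  specialize (E2 ltac:(intros x; apply ccont_mult; [apply ccont_const|apply Hf])).
  specialize (E2 ltac:(intros x Hx; destruct (Hf1 x Hx); split;
     [now apply cder_scal | apply ccont_mult; [apply ccont_const|auto]])).
  specialize (E2 ltac:(intros x v Hv; cbv beta; now rewrite Hp) z w). cbv beta in E2. rewrite !E3 in E2.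
  rewrite (surjective_pairing (f z)), (surjective_pairing (f w)). f_equal; auto.
Qed.

(** ** The differential equations of the Weierstrass function *)

Lemma clim_shift f z l v : clim f (z + v)%C l -> clim (fun x => f (x + v)%C) z l.
Proof.
  intros H e He. destruct (H e He) as (d & Hd & K). exists d. split; auto.
  intros w Hw Hwd. apply K.
  - intros E. apply Hw. replace w with (w + v - v)%C by ring. rewrite E. ring.
  - now replace (w + v - (z + v))%C with (w - z)%C by ring.
Qed.

Lemma clim_periodic (S : C -> Prop) h c v z : locally_finite S ->
  (forall x, ~ S x -> h (x + v)%C = h x) -> clim h (z + v)%C c -> clim h z c.
Proof.
  intros HS Hp H. apply clim_ext_near with (fun x => h (x + v)%C); [|now apply clim_shift].
  apply (near_mono _ _ _ (locally_finite_near S z HS)). auto.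
Qed.

Lemma clim_pow_ratio (f : C -> C) K d n m : (m < n)%nat -> 0 <= K -> 0 < d ->
  (forall z, Cmod z < d -> Cmod (f z) <= K * Cmod z ^ n) -> clim (fun z => f z / z ^ m)%C 0 0.
Proof.
  intros Hmn HK Hd H.
  apply clim_0_bound with (fun z => K * z ^ (n - m))%C.
  - exists d. split; auto. intros w Hw Hwd.
    replace (w - 0)%C with w in Hwd by ring.
    assert (W : 0 < Cmod w) by now apply Cmod_gt_0.
    rewrite Cmod_div, Cmod_mult, !Cmod_pow, Cmod_R, Rabs_pos_eq by (auto using Cpow_nz).
    assert (0 < Cmod w ^ m) by now apply pow_lt.
    apply Rle_div_l; auto. rewrite Rmult_assoc, <- pow_add.
    replace (n - m + m)%nat with n by lia. auto.
  - apply clim_eq with (K * 0 ^ (n - m))%C.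
    + apply clim_mult; [apply clim_const|]. apply clim_pow, clim_id.
    + replace (n - m)%nat with (S (n - m - 1)) by lia. simpl. ring.
Qed.

(** Liouville's theorem in the form in which it is applied: one common limit [c] at all the
    singularities makes the extension by [c] continuous and periodic, and a point of [S] identifies
    the constant. *)
Lemma elliptic_constant (L S : C -> Prop) (h h1 : C -> C) (c : C) : lattice L -> locally_finite S ->
  (exists p, S p) -> (forall z v, L v -> S z -> S (z + v)%C) ->
  (forall z, ~ S z -> cder h z (h1 z) /\ ccont h1 z) ->
  (forall z v, ~ S z -> L v -> h (z + v)%C = h z) ->
  (forall p, S p -> clim h p c) ->
  forall z, ~ S z -> h z = c.
Proof.
  intros HL HS (p & Hp) HSL Hh Hper Hlim z Hz.
  set (f := fun z => if excluded_middle_informative (S z) then c else h z).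
  assert (f_in : forall z, S z -> f z = c).
  { intros x Hx. unfold f. destruct (excluded_middle_informative (S x)); tauto. }
  assert (f_out : forall z, ~ S z -> f z = h z).
  { intros x Hx. unfold f. destruct (excluded_middle_informative (S x)); tauto. }
  assert (HSL' : forall z v, L v -> ~ S z -> ~ S (z + v)%C).
  { intros x v Hv Hx F. apply Hx. replace x with (x + v + - v)%C by ring.
    apply HSL; auto. now apply lattice_opp. }
  assert (f_near : forall x, near x (fun w => h w = f w)).
  { intros x. apply (near_mono _ _ _ (locally_finite_near S x HS)). intros w _ Hw.
    symmetry. auto. }
  rewrite <- (f_out z Hz), <- (f_in p Hp).
  apply (liouville_elliptic L S f h1); auto.
  - intros x. destruct (classic (S x)) as [Hx|Hx].
    + unfold ccont. rewrite f_in by auto. apply clim_ext_near with h; auto.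
    + unfold ccont. rewrite f_out by auto. apply clim_ext_near with h; auto.
      apply (cder_cont h x (h1 x)). now apply Hh.
  - intros x Hx. destruct (Hh x Hx) as [A B]. split; auto.
    apply cder_ext_near with h; auto. symmetry. auto.
  - intros x v Hv. destruct (classic (S x)) as [Hx|Hx].
    + rewrite !f_in; auto.
    + rewrite !f_out; auto.
Qed.

Section Equations.

Variable L : C -> Prop.
Hypothesis HL : lattice L.

Notation W := (pole_series L).
Notation E := (lattice_series L).
Notation S4 := (lattice_series L 4 0).
Notation S6 := (lattice_series L 6 0).

Lemma lattice_series_cont k z : (1 <= k)%nat -> ~ nonzero_of L z -> ccont (E k) z.
Proof. intros. eapply cder_cont, cder_lattice_series; auto. Qed.

Lemma lattice_series_2_0 : E 2 0 = 0.
Proof.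
  destruct (lattice_series_taylor L HL) as (K & d & HK & Hd & H).
  destruct (H 0) as (_ & _ & _ & H2). { now rewrite Cmod_0. }
  replace (E 2 0 - 3 * S4 * 0 ^ 2 - 5 * S6 * 0 ^ 4)%C with (E 2 0) in H2 by (simpl; ring).
  rewrite Cmod_0 in H2. apply Cmod_eq_0. pose proof (Cmod_ge_0 (E 2 0)).
  replace (K * 0 ^ 5) with 0 in H2 by ring. lra.
Qed.

Lemma clim_lattice_series_2 : clim (fun z => E 2 z / z ^ 2)%C 0 (3 * S4)%C.
Proof.
  destruct (lattice_series_taylor L HL) as (K & d & HK & Hd & H).
  pose proof (clim_pow_ratio (fun z => E 2 z - 3 * S4 * z ^ 2 - 5 * S6 * z ^ 4)%C K d 5 2
    ltac:(lia) HK Hd (fun z Hz => proj2 (proj2 (proj2 (H z Hz))))) as R.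
  apply clim_ext with (fun z => (E 2 z - 3 * S4 * z ^ 2 - 5 * S6 * z ^ 4) / z ^ 2
                                + (3 * S4 + 5 * S6 * z ^ 2))%C.
  { intros w Hw. field. auto. }
  eapply clim_eq.
  - apply clim_plus; [exact R|]. apply clim_plus; [apply clim_const|].
    apply clim_mult; [apply clim_const|]. apply clim_pow, clim_id.
  - ring.
Qed.

(** This is [wp'' = 6 wp^2 - g2 / 2], because [wp'' = 6 W 4] and [g2 = 60 S4]. In the difference the
    fourth order poles cancel; the remaining quotient [E 2 x / x ^ 2] tends to [3 S4], which leaves
    the limit [S4 - 6 S4]. *)
Lemma pole_series_4_ode z : ~ L z -> W 4 z = (W 2 z ^ 2 - 5 * S4)%C.
Proof.
  intros Hz.
  cut ((W 4 z - W 2 z ^ 2)%C = (- 5 * S4)%C).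
  { intros F. replace (W 4 z) with (W 4 z - W 2 z ^ 2 + W 2 z ^ 2)%C by ring. rewrite F. ring. }
  apply (elliptic_constant L L (fun z => W 4 z - W 2 z ^ 2)%C
     (fun z => - 4 * W 5 z - 2 * (- 2 * W 3 z) * W 2 z)%C); auto.
  - now apply lattice_locally_finite.
  - exists 0. now apply lattice_0.
  - intros x v Hv Hx. now apply lattice_plus.
  - intros x Hx. split.
    + eapply cder_eq.
      * apply cder_minus; [apply cder_pole_series; auto; lia|].
        apply (cder_pow (W 2) x (- INR 2 * W 3 x)%C 2). apply cder_pole_series; auto.
      * simpl INR. simpl pred. rewrite !RtoC_plus. ring.
    + assert (CW : forall k, (1 <= k)%nat -> ccont (W k) x).
      { intros k Hk. eapply cder_cont, cder_pole_series; auto. }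
      repeat first [apply ccont_minus | apply ccont_mult | apply ccont_const | apply CW; lia].
  - intros x v Hx Hv. rewrite !(pole_series_periodic L HL _ x v) by (auto; lia). reflexivity.
  - intros p Hp.
    apply clim_periodic with (S := L) (v := (- p)%C); [now apply lattice_locally_finite| |].
    { intros x Hx. rewrite !(pole_series_periodic L HL _ x (- p)) by
        (auto; try lia; now apply lattice_opp). reflexivity. }
    replace (p + - p)%C with (RtoC 0) by ring.
    apply clim_ext with (fun x => E 4 x - 2 * (E 2 x / x ^ 2) - E 2 x ^ 2)%C.
    { intros w Hw. unfold pole_series. field. auto. }
    eapply clim_eq.
    + apply clim_minus; [apply clim_minus|].
      * apply lattice_series_cont; [lia|apply not_nonzero_of_0].
      * apply clim_mult; [apply clim_const|apply clim_lattice_series_2].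
      * apply clim_pow, lattice_series_cont; [lia|apply not_nonzero_of_0].
    + rewrite lattice_series_2_0. ring.
Qed.

(** This is [wp'^2 = 4 wp^3 - g2 wp - g3], as [wp' = - 2 W 3]. The second order equation shows that
    [h] has derivative zero, so only its limit at the origin has to be computed. *)
Lemma pole_series_3_ode z : ~ L z -> (W 3 z ^ 2 = W 2 z ^ 3 - 15 * S4 * W 2 z - 35 * S6)%C.
Proof.
  intros Hz.
  set (h := fun z => (W 3 z ^ 2 - W 2 z ^ 3 + 15 * S4 * W 2 z)%C).
  assert (Hlim : clim h 0 (- 35 * S6)%C).
  { destruct (lattice_series_taylor L HL) as (K & d & HK & Hd & H).
    pose proof (clim_pow_ratio (fun z => E 2 z - 3 * S4 * z ^ 2 - 5 * S6 * z ^ 4)%C K d 5 4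
      ltac:(lia) HK Hd (fun z Hz => proj2 (proj2 (proj2 (H z Hz))))) as R2.
    pose proof (clim_pow_ratio (fun z => E 3 z + 3 * S4 * z + 10 * S6 * z ^ 3)%C K d 4 3
      ltac:(lia) HK Hd (fun z Hz => proj1 (proj2 (proj2 (H z Hz))))) as R3.
    (* The Taylor remainders of [E 2] and [E 3] are isolated; the singular terms then cancel
       identically and [- 35 * S6] is what remains. *)
    apply clim_ext with (fun x => 
       2 * ((E 3 x + 3 * S4 * x + 10 * S6 * x ^ 3) / x ^ 3)
       - 3 * ((E 2 x - 3 * S4 * x ^ 2 - 5 * S6 * x ^ 4) / x ^ 4)
       - 35 * S6 + E 3 x ^ 2 - 3 * (E 2 x / x ^ 2) * E 2 x - E 2 x ^ 3 + 15 * S4 * E 2 x)%C.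
    { intros w Hw. unfold h, pole_series. field. auto. }
    assert (C2 : clim (E 2) 0 0).
    { rewrite <- lattice_series_2_0 at 2. apply lattice_series_cont; [lia|apply not_nonzero_of_0]. }
    assert (C3 : clim (E 3) 0 0).
    { rewrite <- (lattice_series_odd_0 L HL 3) at 2; [|lia|simpl; ring].
      apply lattice_series_cont; [lia|apply not_nonzero_of_0]. }
    pose proof clim_lattice_series_2 as C22.
    eapply clim_eq.
    - repeat first [ exact R2 | exact R3 | exact C22 | exact C2 | exact C3 | apply clim_const
                   | apply clim_plus | apply clim_opp | eapply clim_mult | apply clim_pow ].
    - ring. }
  assert (Hc : forall w, ~ L w -> h w = h z).
  { intros w Hw. apply (constant_of_cder_0 L); auto. { now apply lattice_locally_finite. }
    intros x Hx. eapply cder_eq.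
    - apply cder_plus; [apply cder_minus|].
      + apply (cder_pow (W 3) x (- INR 3 * W 4 x)%C 2). apply cder_pole_series; auto.
      + apply (cder_pow (W 2) x (- INR 2 * W 3 x)%C 3). apply cder_pole_series; auto.
      + apply cder_scal. apply cder_pole_series; auto.
    - rewrite pole_series_4_ode by auto. simpl INR. simpl pred. rewrite !RtoC_plus. ring. }
  assert (Ez : h z = (- 35 * S6)%C).
  { apply (clim_unique h 0); auto. apply clim_ext_near with (fun _ => h z); [|apply clim_const].
    apply (near_mono _ _ _ (locally_finite_near L 0 (lattice_locally_finite L HL))).
    intros w _ Hw. symmetry. auto. }
  unfold h in Ez. 
  replace (W 3 z ^ 2)%C with (W 3 z ^ 2 - W 2 z ^ 3 + 15 * S4 * W 2 z + (W 2 z ^ 3 - 15 * S4 * W 2 z))%C by ring.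
  rewrite Ez. ring.
Qed.

End Equations.

(** ** A lattice with real invariants is invariant under conjugation *)

Lemma finite_min (l : list R) : forall P : R -> Prop, (forall t, P t -> In t l) -> (exists t, P t) ->
  exists t, P t /\ forall s, P s -> t <= s.
Proof.
  induction l as [|x l IH]; intros P Hl (t & Ht).
  - destruct (Hl t Ht).
  - destruct (classic (exists t, P t /\ t <> x)) as [N|N].
    + destruct (IH (fun t => P t /\ t <> x)) as (m & [Hm Nm] & Hmin); auto.
      { intros s [Hs Ns]. destruct (Hl s Hs); [congruence|auto]. }
      destruct (classic (P x)) as [Px|Px].
      * destruct (Rle_dec x m).
        -- exists x. split; auto. intros s Hs. destruct (Req_dec s x) as [->|E]; [lra|].
           specialize (Hmin s (conj Hs E)). lra.
        -- exists m. split; auto. intros s Hs. destruct (Req_dec s x) as [->|E]; [lra|auto].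
      * exists m. split; auto. intros s Hs. apply Hmin. split; auto. congruence.
    + exists t. split; auto. intros s Hs.
      assert (K : forall u, P u -> u = x).
      { intros u Hu. apply NNPP. intros F. apply N. eauto. }
      rewrite (K s Hs), (K t Ht). lra.
Qed.

(* The equation [y'' = (12 / t^2 + e) y] has the indices 4 and -3 at the origin, so
   a solution that is [O (t^5)] vanishes: the energy below satisfies [E' <= 2 K E]
   because the form [- 108 u^2 + 48 u v - 7 v^2] is negative. *)
Lemma singular_ode_unique (y1 y2 z1 z2 a b : R -> R) (T t0 K C : R) :
  0 < T <= 1 -> 0 < t0 -> 0 <= K -> 0 <= C ->
  (forall t, 0 < t <= T -> is_derive y1 t (z1 t) /\ is_derive y2 t (z2 t) /\
     is_derive z1 t (12 / t ^ 2 * y1 t + (a t * y1 t - b t * y2 t)) /\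
     is_derive z2 t (12 / t ^ 2 * y2 t + (a t * y2 t + b t * y1 t))) ->
  (forall t, 0 < t <= T -> Rabs (a t) <= K /\ Rabs (b t) <= K) ->
  (forall t, 0 < t <= T -> t <= t0 -> y1 t ^ 2 + y2 t ^ 2 <= C * t ^ 10 /\ z1 t ^ 2 + z2 t ^ 2 <= C * t ^ 8) ->
  y1 T = 0 /\ y2 T = 0.
Proof.
  intros HT Ht0 HK HC HD HB HO.
  (* The powers 9 and 7 are one below the orders 10 and 8 that are assumed for the squares, so the
     energy tends to 0 at the origin. The exponential absorbs the bounded coefficients [a] and
     [b]. *)
  set (En := fun t => (12 * (y1 t ^ 2 + y2 t ^ 2) / t ^ 9 + (z1 t ^ 2 + z2 t ^ 2) / t ^ 7) * exp (- (2 * K * t))).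
  assert (Edec : forall s, 0 < s <= T -> En T <= En s).
  { intros s Hs.
    destruct (MVT_gen En s T (fun t =>
       (12 * (2 * y1 t * z1 t + 2 * y2 t * z2 t) / t ^ 9
         - 108 * (y1 t ^ 2 + y2 t ^ 2) / t ^ 10
         + (2 * z1 t * (12 / t ^ 2 * y1 t + (a t * y1 t - b t * y2 t))
            + 2 * z2 t * (12 / t ^ 2 * y2 t + (a t * y2 t + b t * y1 t))) / t ^ 7
         - 7 * (z1 t ^ 2 + z2 t ^ 2) / t ^ 8
         - 2 * K * (12 * (y1 t ^ 2 + y2 t ^ 2) / t ^ 9 + (z1 t ^ 2 + z2 t ^ 2) / t ^ 7))
       * exp (- (2 * K * t)))) as (c & Hc & Ec).
    - rewrite Rmin_left, Rmax_right by lra. intros t Ht.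
      destruct (HD t ltac:(lra)) as (D1 & D2 & D3 & D4). unfold En.
      auto_derive.
      + repeat split; try (eexists; eassumption); try (apply Rgt_not_eq; apply pow_lt; lra);
         try (intros F; pose proof (pow_lt t 9 ltac:(lra)); pose proof (pow_lt t 7 ltac:(lra)); simpl in *; lra).
      + assert (F : forall f l, is_derive f t l -> Derive (fun x : R => f x) t = l).
        { intros f l Hf. now apply is_derive_unique. }
        rewrite (F _ _ D1), (F _ _ D2), (F _ _ D3), (F _ _ D4). field. lra.
    - rewrite Rmin_left, Rmax_right by lra. intros t Ht.
      destruct (HD t ltac:(lra)) as (D1 & D2 & D3 & D4).
      apply continuity_pt_filterlim, (ex_derive_continuous (V := R_NormedModule) En).
      unfold En. auto_derive.
      repeat split; try (eexists; eassumption); try (apply Rgt_not_eq; apply pow_lt; lra);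
         try (intros F; pose proof (pow_lt t 9 ltac:(lra)); pose proof (pow_lt t 7 ltac:(lra)); simpl in *; lra).
    - rewrite Rmin_left, Rmax_right in Hc by lra.
      destruct (HB c ltac:(lra)) as [Ba Bb].
      assert (Hc1 : 0 < c <= 1) by lra.
      match type of Ec with _ = ?A * exp ?B * (T - s) => 
        assert (HA : A <= 0);
          [|assert (P : 0 <= exp B * (T - s)) by (apply Rmult_le_pos; [left; apply exp_pos|lra]);
            rewrite Rmult_assoc in Ec; set (Q := exp B * (T - s)) in *; clearbody Q;
            set (A' := A) in *; clearbody A'; nra] end.
      (* In the variables [u = y / c] and [v = z] the singular part is a quadratic form with factor
         [/ c ^ 8]. The perturbation carries [c ^ 2] and the term of the exponential only [c], so
         the latter wins for [c <= 1]. *)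
      clear Ec. set (u1 := y1 c / c). set (u2 := y2 c / c). set (v1 := z1 c) in *. set (v2 := z2 c) in *.
      assert (E1 : y1 c = c * u1) by (unfold u1; field; lra).
      assert (E2 : y2 c = c * u2) by (unfold u2; field; lra).
      rewrite E1, E2.
      match goal with |- ?A <= 0 => replace A with
        (/ c ^ 8 * ((-108 * u1 ^ 2 + 48 * u1 * v1 - 7 * v1 ^ 2) + (-108 * u2 ^ 2 + 48 * u2 * v2 - 7 * v2 ^ 2)
          + 2 * c ^ 2 * (v1 * (a c * u1 - b c * u2) + v2 * (a c * u2 + b c * u1))
          - 2 * K * c * (12 * (u1 ^ 2 + u2 ^ 2) + v1 ^ 2 + v2 ^ 2))) by (field; lra) end.
      assert (P8 : 0 < / c ^ 8) by (apply Rinv_0_lt_compat, pow_lt; lra).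
      assert (Q0 : forall u v, -108 * u ^ 2 + 48 * u * v - 7 * v ^ 2 <= 0).
      { clear. intros u v. pose proof (pow2_ge_0 (7 * v - 24 * u)). pose proof (pow2_ge_0 u). nra. }
      pose proof (Q0 u1 v1) as Q1. pose proof (Q0 u2 v2) as Q2. clear Q0.
      assert (Q3 : forall x y e, Rabs e <= K -> 2 * (e * x * y) <= K * (x ^ 2 + y ^ 2)).
      { clear. intros x y e He. apply Rabs_le_between in He.
        pose proof (pow2_ge_0 (x - y)). pose proof (pow2_ge_0 (x + y)). nra. }
      assert (Bb' : Rabs (- b c) <= K) by now rewrite Rabs_Ropp.
      pose proof (Q3 v1 u1 _ Ba). pose proof (Q3 v1 u2 _ Bb').
      pose proof (Q3 v2 u2 _ Ba). pose proof (Q3 v2 u1 _ Bb).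
      assert (Q : 2 * (v1 * (a c * u1 - b c * u2) + v2 * (a c * u2 + b c * u1))
                   <= 2 * K * (12 * (u1 ^ 2 + u2 ^ 2) + v1 ^ 2 + v2 ^ 2)).
      { pose proof (pow2_ge_0 u1). pose proof (pow2_ge_0 u2). nra. }
      set (X := v1 * (a c * u1 - b c * u2) + v2 * (a c * u2 + b c * u1)) in *.
      set (G := 12 * (u1 ^ 2 + u2 ^ 2) + v1 ^ 2 + v2 ^ 2) in *.
      assert (G0 : 0 <= K * G).
      { apply Rmult_le_pos; auto. unfold G. pose proof (pow2_ge_0 u1). pose proof (pow2_ge_0 u2).
        pose proof (pow2_ge_0 v1). pose proof (pow2_ge_0 v2). lra. }
      assert (c ^ 2 * (2 * X) <= c * (2 * K * G)).
      { apply Rle_trans with (c ^ 2 * (2 * K * G)).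
        - apply Rmult_le_compat_l; [apply pow2_ge_0|lra].
        - assert (c ^ 2 <= c) by nra. nra. }
      nra. }
  assert (Esmall : forall s, 0 < s <= T -> s <= t0 -> En s <= 13 * C * s).
  { intros s Hs Hs0. destruct (HO s Hs Hs0) as [O1 O2]. unfold En.
    assert (P9 : 0 < s ^ 9) by (apply pow_lt; lra). assert (P7 : 0 < s ^ 7) by (apply pow_lt; lra).
    assert (X : exp (- (2 * K * s)) <= 1).
    { rewrite <- exp_0. destruct (Rle_lt_or_eq_dec 0 (2 * K * s)) as [F|F]; [nra| |].
      - left. apply exp_increasing. lra.
      - rewrite <- F, Ropp_0. lra. }
    pose proof (exp_pos (- (2 * K * s))).
    assert (A1 : 12 * (y1 s ^ 2 + y2 s ^ 2) / s ^ 9 <= 12 * C * s).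
    { apply Rle_div_l; auto. replace (12 * C * s * s ^ 9) with (12 * (C * s ^ 10)) by ring. lra. }
    assert (A2 : (z1 s ^ 2 + z2 s ^ 2) / s ^ 7 <= C * s).
    { apply Rle_div_l; auto. replace (C * s * s ^ 7) with (C * s ^ 8) by ring. lra. }
    assert (A3 : 0 <= 12 * (y1 s ^ 2 + y2 s ^ 2) / s ^ 9).
    { apply Rmult_le_pos; [|left; now apply Rinv_0_lt_compat].
      pose proof (pow2_ge_0 (y1 s)). pose proof (pow2_ge_0 (y2 s)). lra. }
    assert (A4 : 0 <= (z1 s ^ 2 + z2 s ^ 2) / s ^ 7).
    { apply Rmult_le_pos; [|left; now apply Rinv_0_lt_compat].
      pose proof (pow2_ge_0 (z1 s)). pose proof (pow2_ge_0 (z2 s)). lra. }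
    nra. }
  assert (E0 : En T <= 0).
  { apply Rnot_lt_le. intros F.
    (* Small enough that [13 * C * s], which bounds the energy at [s], is less than half of
       [En T]. *)
    set (s := Rmin T (Rmin t0 (En T / (26 * C + 1)))).
    assert (Hs : 0 < s).
    { apply Rmin_pos; [lra|]. apply Rmin_pos; auto. apply Rdiv_lt_0_compat; lra. }
    pose proof (Rmin_l T (Rmin t0 (En T / (26 * C + 1)))) as M1.
    pose proof (Rmin_r T (Rmin t0 (En T / (26 * C + 1)))) as M2.
    pose proof (Rmin_l t0 (En T / (26 * C + 1))) as M3.
    pose proof (Rmin_r t0 (En T / (26 * C + 1))) as M4. fold s in M1, M2.
    pose proof (Edec s ltac:(lra)). pose proof (Esmall s ltac:(lra) ltac:(lra)).
    assert (s * (26 * C + 1) <= En T) by (apply Rle_div_r; lra). nra. }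
  unfold En in E0.
  pose proof (exp_pos (- (2 * K * T))) as Hexp.
  assert (P9 : 0 < / T ^ 9) by (apply Rinv_0_lt_compat, pow_lt; lra).
  assert (P7 : 0 < / T ^ 7) by (apply Rinv_0_lt_compat, pow_lt; lra).
  pose proof (pow2_ge_0 (y1 T)). pose proof (pow2_ge_0 (y2 T)).
  pose proof (pow2_ge_0 (z1 T)). pose proof (pow2_ge_0 (z2 T)).
  unfold Rdiv in E0.
  assert (F : y1 T ^ 2 + y2 T ^ 2 <= 0).
  { apply Rnot_lt_le. intros F.
    assert (0 < 12 * (y1 T ^ 2 + y2 T ^ 2) * / T ^ 9) by (apply Rmult_lt_0_compat; lra).
    assert (0 <= (z1 T ^ 2 + z2 T ^ 2) * / T ^ 7) by (apply Rmult_le_pos; lra). nra. }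
  split; nra.
Qed.

Lemma clim_pole_series_0 (L : C -> Prop) k : lattice L -> (1 <= k)%nat ->
  clim (fun x => x ^ k * pole_series L k x)%C 0 1.
Proof.
  intros HL Hk. apply clim_ext with (fun x => 1 + x ^ k * lattice_series L k x)%C.
  { intros w Hw. unfold pole_series. field. now apply Cpow_nz. }
  eapply clim_eq.
  - apply clim_plus; [apply clim_const|]. apply clim_mult; [apply clim_pow, clim_id|].
    apply (lattice_series_cont L HL k 0); auto. apply not_nonzero_of_0.
  - destruct k; [lia|]. simpl. ring.
Qed.

Lemma clim_pole_series (L : C -> Prop) k p : lattice L -> (2 <= k)%nat -> L p ->
  clim (fun x => (x - p) ^ k * pole_series L k x)%C p 1.
Proof.
  intros HL Hk Hp.
  apply clim_ext_near with (fun x => (x + - p) ^ k * pole_series L k (x + - p))%C.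
  - apply (near_mono _ _ _ (locally_finite_near L p (lattice_locally_finite L HL))).
    intros w _ Hw. now rewrite pole_series_periodic by (auto; now apply lattice_opp).
  - apply (clim_shift (fun x => x ^ k * pole_series L k x)%C).
    replace (p + - p)%C with (RtoC 0) by ring. apply clim_pole_series_0; auto. lia.
Qed.

(** Multiplied by [(x - p) ^ 2], the difference of the two functions tends to 1 at the pole [p], but
    it is 0 on the ray that ends there. *)
Lemma pole_ne_regular (L L' : C -> Prop) (w : C) (t1 : R) : lattice L -> lattice L' -> w <> 0 -> 0 < t1 ->
  L (t1 * w)%C -> ~ L' (t1 * w)%C ->
  ~ (forall t, 0 < t < t1 -> pole_series L 2 (t * w) = pole_series L' 2 (t * w)).
Proof.
  intros HL HL' Hw Ht1 HLp HLp' H. set (p := (t1 * w)%C) in *.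
  assert (R : clim (fun x => (x - p) ^ 2 * pole_series L 2 x - (x - p) ^ 2 * pole_series L' 2 x)%C p 1).
  { eapply clim_eq.
    - apply clim_minus; [now apply clim_pole_series|]. apply clim_mult.
      + apply clim_pow. apply clim_minus; [apply clim_id|apply clim_const].
      + apply (cder_cont (pole_series L' 2) p (- INR 2 * pole_series L' 3 p)%C).
        apply cder_pole_series; auto.
    - ring. }
  destruct (R (1 / 2) ltac:(lra)) as (d & Hd & K).
  pose proof (proj1 (Cmod_gt_0 w) Hw) as W.
  set (s := Rmin (t1 / 2) (d / (2 * Cmod w))).
  assert (Hs : 0 < s) by (apply Rmin_pos; [lra|]; apply Rdiv_lt_0_compat; lra).
  pose proof (Rmin_l (t1 / 2) (d / (2 * Cmod w))) as M1.
  pose proof (Rmin_r (t1 / 2) (d / (2 * Cmod w))) as M2. fold s in M1, M2.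
  specialize (K ((t1 - s)%R * w)%C).
  assert (E : ((t1 - s)%R * w - p)%C = (- (s * w))%C) by (unfold p; rewrite RtoC_minus; ring).
  rewrite E, (H (t1 - s)) in K by lra.
  match type of K with _ -> _ -> Cmod ?z < _ => replace z with (- (1))%C in K by ring end.
  rewrite !Cmod_opp, Cmod_1, Cmod_mult, Cmod_R, Rabs_pos_eq in K by lra.
  enough (1 < 1 / 2) by lra. apply K.
  - intros F. assert (Z : (s * w)%C = 0).
    { replace (s * w)%C with (- ((t1 - s)%R * w - p))%C by (rewrite E; ring). rewrite F. ring. }
    apply (Cmult_neq_0 s w); auto. intros G. apply RtoC_inj in G. lra.
  - apply Rle_lt_trans with (d / (2 * Cmod w) * Cmod w); [apply Rmult_le_compat_r; lra|].
    replace (d / (2 * Cmod w) * Cmod w) with (d / 2) by (field; lra). lra.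
Qed.

Lemma rcont_bounded (g : R -> C) T : 0 <= T -> (forall t, 0 <= t <= T -> rcont g t) ->
  exists K, 0 <= K /\ forall t, 0 <= t <= T -> Rabs (Re (g t)) <= K /\ Rabs (Im (g t)) <= K.
Proof.
  intros HT Hg.
  assert (A : forall h, (forall t, 0 <= t <= T -> continuous h t) ->
    exists K, 0 <= K /\ forall t, 0 <= t <= T -> Rabs (h t) <= K).
  { intros h Hh.
    assert (Hc : forall t, 0 <= t <= T -> continuity_pt h t).
    { intros t Ht. apply continuity_pt_filterlim. now apply Hh. }
    destruct (continuity_ab_maj h 0 T HT Hc) as (x & Hx & _).
    destruct (continuity_ab_min h 0 T HT Hc) as (y & Hy & _).
    exists (Rabs (h x) + Rabs (h y)). pose proof (Rabs_pos (h x)). pose proof (Rabs_pos (h y)).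
    split; [lra|]. intros t Ht. specialize (Hx t Ht). specialize (Hy t Ht).
    pose proof (Rle_abs (h x)). pose proof (Rle_abs (- h y)) as B. rewrite Rabs_Ropp in B.
    apply Rabs_le. lra. }
  destruct (A (fun t => Re (g t))) as (K1 & H1 & B1). { intros t Ht. apply (Hg t Ht). }
  destruct (A (fun t => Im (g t))) as (K2 & H2 & B2). { intros t Ht. apply (Hg t Ht). }
  exists (K1 + K2). split; [lra|]. intros t Ht. specialize (B1 t Ht). specialize (B2 t Ht). lra.
Qed.

(** Subtracting the equations [wp'' = 6 wp^2 - g2 / 2] of the two lattices gives
    [Y'' = 6 w^2 (P + Q) Y], and the principal part of [P + Q] contributes [12 / t^2]. Equal
    invariants make the expansions agree through the fourth order, so [Y] is [O (t^5)]. *)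
Lemma weierstrass_p_eq_on_ray (L L' : C -> Prop) (w : C) (T : R) : lattice L -> lattice L' -> w <> 0 -> 0 < T <= 1 ->
  lattice_series L 4 0 = lattice_series L' 4 0 -> lattice_series L 6 0 = lattice_series L' 6 0 ->
  (forall t, 0 < t <= T -> ~ L (t * w)%C /\ ~ L' (t * w)%C) ->
  pole_series L 2 (T * w) = pole_series L' 2 (T * w).
Proof.
  intros HL HL' Hw HT E4 E6 HN.
  set (P := pole_series L 2). set (Q := pole_series L' 2).
  set (Y := fun t : R => (P (t * w) + -1 * Q (t * w))%C).
  set (Z := fun t : R => (-2 * w * (pole_series L 3 (t * w) + -1 * pole_series L' 3 (t * w)))%C).
  set (e := fun t : R => (6 * w ^ 2 * (lattice_series L 2 (t * w) + lattice_series L' 2 (t * w)))%C).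
  assert (Rw : forall t, rder (fun s : R => (s * w)%C) t w).
  { intros t. eapply rder_eq; [apply rder_mult; [apply rder_RtoC|apply rder_const]|]. cbv beta. ring. }
  assert (HRW : forall M k (t : R), lattice M -> (1 <= k)%nat -> ~ M (t * w)%C ->
     rder (fun s : R => pole_series M k (s * w)) t (- INR k * pole_series M (S k) (t * w) * w)%C).
  { intros M k t HM Hk Ht. apply (rder_comp (pole_series M k) (fun s : R => (s * w)%C)); auto.
    now apply cder_pole_series. }
  assert (DY : forall t, 0 < t <= T -> rder Y t (Z t)).
  { intros t Ht. destruct (HN t Ht) as [N N']. unfold Y. eapply rder_eq.
    - apply rder_plus; [apply HRW; auto|]. apply rder_mult; [apply rder_const|apply HRW; auto].
    - unfold Z. simpl INR. rewrite RtoC_plus. ring. }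
  assert (DZ : forall t, 0 < t <= T -> rder Z t (RtoC (12 / t ^ 2) * Y t + e t * Y t)%C).
  { intros t Ht. destruct (HN t Ht) as [N N']. unfold Z. eapply rder_eq.
    - apply rder_mult; [apply rder_const|]. apply rder_plus; [apply HRW; auto|].
      apply rder_mult; [apply rder_const|apply HRW; auto].
    - assert (Nt : RtoC t <> 0) by (intros F; apply RtoC_inj in F; lra).
      assert (Nt2 : t <> 0) by lra.
      rewrite !pole_series_4_ode by auto. rewrite <- E4.
      unfold Y, e, P, Q. unfold pole_series. simpl INR. rewrite !RtoC_plus, RtoC_div, RtoC_pow by
        (apply pow_nonzero; auto).
      field. auto. }
  destruct (rcont_bounded e T ltac:(lra)) as (K & HK & HKb).
  { intros t Ht. unfold e. apply rcont_mult; [eapply rder_rcont, rder_const|].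
    assert (Nz : forall M, lattice M -> (0 < t -> ~ M (t * w)%C) -> ~ nonzero_of M (t * w)%C).
    { intros M HM HMt [A B]. destruct (Req_dec t 0) as [->|Ht0]; [apply B; ring|]. apply HMt; auto. lra. }
    assert (HRE : forall M, lattice M -> (0 < t -> ~ M (t * w)%C) ->
      rder (fun s : R => lattice_series M 2 (s * w)) t (- INR 2 * lattice_series M 3 (t * w) * w)%C).
    { intros M HM HMt. apply (rder_comp (lattice_series M 2) (fun s : R => (s * w)%C)); auto.
      apply cder_lattice_series; auto. }
    eapply rder_rcont, rder_plus; apply HRE; auto; intros; apply HN; lra. }
  destruct (lattice_series_taylor L HL) as (K1 & d1 & HK1 & Hd1 & T1).
  destruct (lattice_series_taylor L' HL') as (K2 & d2 & HK2 & Hd2 & T2).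
  rewrite <- E4, <- E6 in T2.
  pose proof (proj1 (Cmod_gt_0 w) Hw) as W.
  set (t0 := Rmin d1 d2 / (2 * Cmod w)).
  pose proof (Rmin_pos _ _ Hd1 Hd2) as Hd.
  assert (Ht0 : 0 < t0) by (apply Rdiv_lt_0_compat; lra).
  set (B := (K1 + K2) * Cmod w ^ 5).
  assert (HB : 0 <= B) by (apply Rmult_le_pos; [lra|left; now apply pow_lt]).
  assert (HO : forall t, 0 < t <= T -> t <= t0 -> Cmod (Y t) <= B * t ^ 5 /\ Cmod (Z t) <= 2 * B * t ^ 4).
  { intros t Ht Htt0.
    assert (Hm : Cmod (t * w)%C = t * Cmod w) by (rewrite Cmod_mult, Cmod_R, Rabs_pos_eq; lra).
    assert (Hlt : t * Cmod w < Rmin d1 d2).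
    { apply Rle_lt_trans with (t0 * Cmod w); [apply Rmult_le_compat_r; lra|].
      unfold t0. replace (Rmin d1 d2 / (2 * Cmod w) * Cmod w) with (Rmin d1 d2 / 2) by (field; lra). lra. }
    pose proof (Rmin_l d1 d2). pose proof (Rmin_r d1 d2).
    destruct (T1 (t * w)%C ltac:(lra)) as (_ & _ & A3 & A2).
    destruct (T2 (t * w)%C ltac:(lra)) as (_ & _ & B3 & B2).
    rewrite Hm in *. rewrite !Rpow_mult_distr in *.
    split.
    - unfold Y, P, Q, pole_series.
      match type of A2 with Cmod ?a <= _ => match type of B2 with Cmod ?b <= _ =>
        match goal with |- Cmod ?c <= _ => replace c with (a - b)%C by ring end end end.
      eapply Rle_trans; [apply Cmod_triangle_minus|]. unfold B. lra.
    - unfold Z, pole_series. rewrite !Cmod_mult.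
      match type of A3 with Cmod ?a <= _ => match type of B3 with Cmod ?b <= _ =>
        match goal with |- _ * Cmod ?c <= _ => replace c with (a - b)%C by ring;
          pose proof (Cmod_triangle_minus a b) as AB end end end.
      rewrite Cmod_R. replace (Rabs (-2)) with 2 by (rewrite Rabs_left; lra).
      unfold B. replace (2 * ((K1 + K2) * Cmod w ^ 5) * t ^ 4)
        with (2 * Cmod w * ((K1 + K2) * (t ^ 4 * Cmod w ^ 4))) by ring.
      apply Rmult_le_compat_l; lra. }
  assert (Sq : forall z b, Cmod z <= b -> Re z ^ 2 + Im z ^ 2 <= b ^ 2).
  { intros z b Hz. rewrite <- Cmod2_alt. apply pow_incr. split; auto using Cmod_ge_0. }
  destruct (singular_ode_unique (fun t => Re (Y t)) (fun t => Im (Y t)) (fun t => Re (Z t))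
    (fun t => Im (Z t)) (fun t => Re (e t)) (fun t => Im (e t)) T t0 K (4 * B ^ 2)) as [Y1 Y2]; auto.
  - pose proof (pow2_ge_0 B). lra.
  - intros t Ht. destruct (DY t Ht) as [D1 D2]. destruct (DZ t Ht) as [D3 D4].
    split; [exact D1|]. split; [exact D2|]. split.
    + match type of D3 with is_derive _ _ ?v => match goal with |- is_derive _ _ ?v' =>
        replace v' with v; [exact D3|] end end.
      unfold Re, Im, Cplus, Cmult, RtoC; simpl. ring.
    + match type of D4 with is_derive _ _ ?v => match goal with |- is_derive _ _ ?v' =>
        replace v' with v; [exact D4|] end end.
      unfold Re, Im, Cplus, Cmult, RtoC; simpl. ring.
  - intros t Ht. apply HKb. lra.
  - intros t Ht Htt0. destruct (HO t Ht Htt0) as [O1 O2]. split.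
    + eapply Rle_trans; [apply (Sq _ _ O1)|]. rewrite Rpow_mult_distr.
      replace ((t ^ 5) ^ 2) with (t ^ 10) by ring. apply Rmult_le_compat_r.
      * left. apply pow_lt. lra.
      * pose proof (pow2_ge_0 B). lra.
    + eapply Rle_trans; [apply (Sq _ _ O2)|]. right. ring.
  - assert (E : Y T = 0). { rewrite (surjective_pairing (Y T)). unfold RtoC. f_equal; assumption. }
    unfold Y in E. replace (P (T * w)%C) with (P (T * w)%C + -1 * Q (T * w)%C + Q (T * w)%C)%C by ring.
    rewrite E. ring.
Qed.

(* Along the ray through [w] the two Weierstrass functions agree up to the first pole of
   either of them, so that this is a pole of both; for primitive [w] it is [w]. *)
Lemma lattice_point_of_invariants (L L' : C -> Prop) (w : C) : lattice L -> lattice L' -> L w -> w <> 0 ->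
  lattice_series L 4 0 = lattice_series L' 4 0 -> lattice_series L 6 0 = lattice_series L' 6 0 ->
  (forall t, 0 < t < 1 -> ~ L (t * w)%C) -> L' w.
Proof.
  intros HL HL' Hw Nw E4 E6 Hprim.
  pose proof (proj1 (Cmod_gt_0 w) Nw) as W.
  assert (E1 : (1 * w)%C = w) by ring.
  set (S := fun z => L z \/ L' z).
  destruct (locally_finite_union L L' (lattice_locally_finite L HL) (lattice_locally_finite L' HL') (Cmod w))
    as (l & Hl).
  destruct (finite_min (map (fun x => Cmod x / Cmod w) l) (fun t => 0 < t <= 1 /\ S (t * w)%C))
    as (t1 & [Ht1 HS1] & Hmin).
  - intros t [Ht HSt].
    assert (Hm : Cmod (t * w)%C = t * Cmod w) by (rewrite Cmod_mult, Cmod_R, Rabs_pos_eq; lra).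
    replace t with (Cmod (t * w)%C / Cmod w) by (rewrite Hm; field; lra).
    apply (in_map (fun x => Cmod x / Cmod w)). apply Hl; auto. rewrite Hm. nra.
  - exists 1. split; [lra|]. left. now rewrite E1.
  - assert (Heq : forall t, 0 < t < t1 -> pole_series L 2 (t * w) = pole_series L' 2 (t * w)).
    { intros t Ht. apply weierstrass_p_eq_on_ray; auto; [lra|].
      intros s Hs. split; intros F; assert (t1 <= s) by (apply Hmin; unfold S; split; auto; lra); lra. }
    destruct (classic (L (t1 * w)%C)) as [A|A]; destruct (classic (L' (t1 * w)%C)) as [B|B].
    + destruct (Rle_lt_or_eq_dec t1 1) as [F|F]; [lra| |].
      * exfalso. apply (Hprim t1); auto. lra.
      * rewrite F, E1 in B. exact B.
    + exfalso. apply (pole_ne_regular L L' w t1); auto. lra.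
    + exfalso. apply (pole_ne_regular L' L w t1); auto; [lra|]. intros t Ht. symmetry. auto.
    + destruct HS1; tauto.
Qed.

(** * The conjugate lattice and real periods *)

Definition conj_lattice (L : C -> Prop) (z : C) : Prop := L (Cconj z).

Lemma Cconj_RtoC (r : R) : Cconj r = r.
Proof. unfold Cconj, RtoC; simpl. f_equal. ring. Qed.

Lemma Cconj_eq_0 z : Cconj z = 0 -> z = 0.
Proof. intros H. rewrite <- (Cconj_conj z), H. apply Cconj_RtoC. Qed.

Lemma lattice_conj (L : C -> Prop) : lattice L -> lattice (conj_lattice L).
Proof.
  intros (w1 & w2 & Hi & H). exists (Cconj w1), (Cconj w2). split.
  - intros s t E. apply Hi. apply Cconj_eq_0.
    rewrite Cplus_conj, !Cmult_conj, !Cconj_RtoC. exact E.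
  - intros z. unfold conj_lattice. rewrite H. split; intros (m & n & E); exists m, n.
    + rewrite <- (Cconj_conj z), E. rewrite Cplus_conj, !Cmult_conj, !Cconj_RtoC. reflexivity.
    + rewrite E. rewrite Cplus_conj, !Cmult_conj, !Cconj_RtoC, !Cconj_conj. reflexivity.
Qed.

Lemma lattice_series_conj (L : C -> Prop) k z : lattice L -> (1 <= k)%nat -> ~ nonzero_of L z ->
  lattice_series (conj_lattice L) k (Cconj z) = Cconj (lattice_series L k z).
Proof.
  intros HL Hk Hz. apply sum_over_eq.
  apply is_sum_over_ext with (fun w => Cconj (mittag_leffler k z (Cconj w))).
  - intros w _. now rewrite <- mittag_leffler_conj, Cconj_conj.
  - apply (is_sum_over_reindex (nonzero_of L) (nonzero_of (conj_lattice L))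
      (fun w => Cconj (mittag_leffler k z w)) _ Cconj Cconj); try apply Cconj_conj.
    + intros w [A B]. split; auto. intros F. apply B. now apply Cconj_eq_0.
    + intros w [A B]. split.
      * unfold conj_lattice. now rewrite Cconj_conj.
      * intros F. apply B. now apply Cconj_eq_0.
    + now apply is_sum_over_conj, lattice_series_correct.
Qed.

Section RealInvariants.

Variable L : C -> Prop.
Hypothesis HL : lattice L.
Hypothesis Hg2 : Im (g2 L) = 0.
Hypothesis Hg3 : Im (g3 L) = 0.

Lemma conj_eq_of_Im_0 (a : R) (z : C) : a <> 0 -> Im (a * z)%C = 0 -> Cconj z = z.
Proof.
  intros Ha H. destruct z as [x y]. unfold Im, Cmult, RtoC in H; simpl in H.
  unfold Cconj; simpl. f_equal. nra.
Qed.

(** The conjugate lattice has the conjugate, hence the same, invariants. The generators [2 * w1] and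
    [2 * w2] are primitive, so their conjugates lie in [L] by [lattice_point_of_invariants]; integer
    combinations follow. *)
Lemma lattice_conj_invariant z : L z -> L (Cconj z).
Proof.
  assert (HL' := lattice_conj L HL).
  assert (E : forall k, (1 <= k)%nat -> Cconj (lattice_series L k 0) = lattice_series L k 0 ->
     lattice_series L k 0 = lattice_series (conj_lattice L) k 0).
  { intros k Hk F. rewrite <- F, <- lattice_series_conj; auto; [|apply not_nonzero_of_0].
    now rewrite Cconj_RtoC. }
  assert (E4 : lattice_series L 4 0 = lattice_series (conj_lattice L) 4 0).
  { apply E; [lia|]. rewrite g2_series in Hg2 by auto. apply (conj_eq_of_Im_0 60); auto; lra. }
  assert (E6 : lattice_series L 6 0 = lattice_series (conj_lattice L) 6 0).
  { apply E; [lia|]. rewrite g3_series in Hg3 by auto. apply (conj_eq_of_Im_0 140); auto; lra. }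
  pose proof HL as (w1 & w2 & Hi & H).
  assert (K : forall w, L w -> w <> 0 -> (forall t, 0 < t < 1 -> ~ L (t * w)%C) -> L (Cconj w)).
  { intros w Hw Nw Hp. exact (lattice_point_of_invariants L (conj_lattice L) w HL HL' Hw Nw E4 E6 Hp). }
  assert (NZ : forall m t, 0 < t < 1 -> t = IZR m -> False).
  { intros m t Ht Em. rewrite Em in Ht. destruct Ht as [A B]. apply lt_IZR in A. apply lt_IZR in B. lia. }
  assert (K1 : L (Cconj (2 * w1)%C)).
  { apply K.
    - apply H. exists 1%Z, 0%Z. ring.
    - intros F. destruct (Hi 2 0) as [G _]; [|lra]. rewrite F. ring.
    - intros t Ht F. apply H in F. destruct F as (m & n & F).
      destruct (Hi (2 * (t - IZR m)) (- (2 * IZR n))) as [G _].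
      { rewrite RtoC_opp, !RtoC_mult, RtoC_minus.
        replace (2 * (t - IZR m) * w1 + - (2 * IZR n) * w2)%C
          with (t * (2 * w1) - (2 * IZR m * w1 + 2 * IZR n * w2))%C by ring. rewrite F. ring. }
      apply (NZ m t Ht). lra. }
  assert (K2 : L (Cconj (2 * w2)%C)).
  { apply K.
    - apply H. exists 0%Z, 1%Z. ring.
    - intros F. destruct (Hi 0 2) as [_ G]; [|lra]. rewrite F. ring.
    - intros t Ht F. apply H in F. destruct F as (m & n & F).
      destruct (Hi (- (2 * IZR m)) (2 * (t - IZR n))) as [_ G].
      { rewrite RtoC_opp, !RtoC_mult, RtoC_minus.
        replace (- (2 * IZR m) * w1 + 2 * (t - IZR n) * w2)%C
          with (t * (2 * w2) - (2 * IZR m * w1 + 2 * IZR n * w2))%C by ring. rewrite F. ring. }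
      apply (NZ n t Ht). lra. }
  intros Hz. apply H in Hz. destruct Hz as (m & n & ->).
  apply H in K1, K2. destruct K1 as (a & b & K1). destruct K2 as (c & d & K2).
  apply H. exists (m * a + n * c)%Z, (m * b + n * d)%Z.
  replace (2 * IZR m * w1 + 2 * IZR n * w2)%C with (IZR m * (2 * w1) + IZR n * (2 * w2))%C by ring.
  rewrite Cplus_conj, (Cmult_conj (IZR m)), (Cmult_conj (IZR n)), K1, K2, !Cconj_RtoC.
  rewrite !plus_IZR, !mult_IZR, !RtoC_plus, !RtoC_mult. ring.
Qed.

Lemma pole_series_conj k z : (1 <= k)%nat -> ~ L z ->
  pole_series L k (Cconj z) = Cconj (pole_series L k z).
Proof.
  intros Hk Hz.
  assert (E : conj_lattice L = L).
  { apply functional_extensionality. intros x. apply propositional_extensionality.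
    unfold conj_lattice. split; intros H.
    - rewrite <- (Cconj_conj x). now apply lattice_conj_invariant.
    - now apply lattice_conj_invariant. }
  unfold pole_series. rewrite Cplus_conj, Cinv_conj', Cpow_conj.
  rewrite <- E at 1. rewrite lattice_series_conj; auto.
  now apply not_lattice_not_nonzero_of.
Qed.

(** [w + Cconj w] is real and lies in [L]. It is nonzero for one of the generators, since two purely
    imaginary generators would be dependent over the reals. *)
Lemma real_period_exists : exists x : R, 0 < x /\ L x.
Proof.
  pose proof HL as (w1 & w2 & Hi & H).
  assert (K : forall w, L w -> Re w <> 0 -> exists x : R, 0 < x /\ L x).
  { intros w Hw Nw.
    assert (P : L (RtoC (2 * Re w))).
    { replace (RtoC (2 * Re w)) with (w + Cconj w)%C.
      - apply lattice_plus; auto. now apply lattice_conj_invariant.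
      - destruct w as [x y]. unfold Cconj, Cplus, RtoC, Re; simpl. f_equal; ring. }
    destruct (Rlt_le_dec 0 (Re w)) as [G|G].
    - exists (2 * Re w). split; [lra|auto].
    - exists (- (2 * Re w)). split; [lra|]. rewrite RtoC_opp. now apply lattice_opp. }
  destruct (Req_dec (Re w1) 0) as [A|A].
  - destruct (Req_dec (Re w2) 0) as [B|B].
    + exfalso. destruct w1 as [x1 y1], w2 as [x2 y2]. unfold Re in A, B; simpl in A, B. subst.
      destruct (Hi y2 (- y1)) as [F G].
      { unfold Cplus, Cmult, RtoC; simpl. f_equal; ring. }
      destruct (Hi 1 0) as [U _]; [|lra].
      unfold Cplus, Cmult, RtoC; simpl. f_equal; nra.
    + apply (K (2 * w2)%C).
      * apply H. exists 0%Z, 1%Z. ring.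
      * unfold Re, Cmult, RtoC in *; simpl in *. lra.
  - apply (K (2 * w1)%C).
    + apply H. exists 1%Z, 0%Z. ring.
    + unfold Re, Cmult, RtoC in *; simpl in *. lra.
Qed.

Lemma minimal_real_period : exists x : R, 0 < x /\ L x /\ forall y : R, 0 < y < x -> ~ L y.
Proof.
  destruct real_period_exists as (x & Hx & Lx).
  destruct (lattice_locally_finite L HL x) as (l & Hl).
  destruct (finite_min (map Re l) (fun t => 0 < t <= x /\ L t)) as (m & [Hm Lm] & Hmin).
  - intros t [Ht Lt]. apply (in_map Re l (RtoC t)). apply Hl; auto. rewrite Cmod_R, Rabs_pos_eq; lra.
  - exists x. split; [lra|auto].
  - exists m. split; [lra|]. split; auto. intros y Hy Ly.
    assert (m <= y) by (apply Hmin; split; auto; lra). lra.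
Qed.

End RealInvariants.

(** ** The reciprocal of [phi] *)

(** [C_lim] takes the limits of the two components along the horizontal line through [z]; a limit in
    the plane restricts to that line. *)
Lemma C_lim_eq f z l : clim f z l -> C_lim f z = l.
Proof.
  intros H. unfold C_lim.
  assert (K : forall e, 0 < e -> exists d, 0 < d /\ forall x, Rabs (x - fst z) < d -> x <> fst z ->
     Cmod (f (x, snd z) - l) < e).
  { intros e He. destruct (H e He) as (d & Hd & K). exists d. split; auto. intros x Hx Nx.
    apply K.
    - intros E. apply Nx. now rewrite <- E.
    - replace ((x, snd z) - z)%C with (RtoC (x - fst z)).
      + now rewrite Cmod_R.
      + destruct z as [u v]. unfold Cminus, Cplus, Copp, RtoC; simpl. f_equal; ring. }
  assert (R : forall g m, (forall e, 0 < e -> exists d, 0 < d /\ forall x, Rabs (x - fst z) < d ->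
     x <> fst z -> Rabs (g x - m) < e) -> real (Lim g (fst z)) = m).
  { intros g m Hg. change m with (real (Finite m)). f_equal.
    apply is_lim_unique, is_lim_spec. intros [e He]. destruct (Hg e He) as (d & Hd & Kd).
    exists (mkposreal d Hd). intros y Hy Ny. apply Kd; auto. }
  rewrite (surjective_pairing l). f_equal; apply R; intros e He;
    destruct (K e He) as (d & Hd & Kd); exists d; (split; [auto|]); intros x Hx Nx;
    (eapply Rle_lt_trans; [|exact (Kd x Hx Nx)]).
  - apply (re_le_Cmod (f (x, snd z) - l)).
  - apply (im_le_Cmod (f (x, snd z) - l)).
Qed.

Lemma clim_taylor_2 (f f1 : C -> C) (l : C) : f 0 = 0 -> f1 0 = 0 ->
  near 0 (fun z => cder f z (f1 z)) -> cder f 0 (f1 0) -> cder f1 0 l ->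
  clim (fun z => f z / z ^ 2)%C 0 (l / 2)%C.
Proof.
  intros F0 F1 (d1 & Hd1 & Hf) Hf0 Hf1 e He.
  destruct (cder_eps _ _ _ (e / 2) Hf1 ltac:(lra)) as (d2 & Hd2 & K).
  set (d := Rmin d1 d2). assert (Hd : 0 < d) by now apply Rmin_pos.
  pose proof (Rmin_l d1 d2) as M1. pose proof (Rmin_r d1 d2) as M2. fold d in M1, M2.
  assert (N2 : RtoC 2 <> 0) by (intros E; apply RtoC_inj in E; lra).
  assert (G : forall z, Cmod z < d -> Cmod (f z - l / 2 * z ^ 2)%C <= e / 2 * Cmod z ^ 2).
  { apply (pow_bound_of_cder _ (fun z => f1 z - l * z)%C d (e / 2) 1).
    - rewrite F0. ring.
    - intros z Hz. eapply cder_eq.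
      + apply (cder_minus f (fun z => l / 2 * z ^ 2)%C z (f1 z)).
        * destruct (classic (z = 0)) as [->|Nz]; [exact Hf0|]. apply Hf; auto.
          replace (z - 0)%C with z by ring. lra.
        * apply cder_scal, (cder_pow (fun w => w) z 1 2), cder_id.
      + simpl INR. simpl pred. rewrite RtoC_plus. field. auto.
    - intros z Hz. specialize (K z ltac:(lra)). rewrite F1 in K.
      replace (0 + z)%C with z in K by ring.
      replace (f1 z - 0 - l * z)%C with (f1 z - l * z)%C in K by ring. lra.
    - lra. }
  exists d. split; auto. intros w Nw Hw. replace (w - 0)%C with w in Hw by ring.
  specialize (G w Hw). pose proof (proj1 (Cmod_gt_0 w) Nw) as W.
  assert (Nw2 : (w ^ 2)%C <> 0) by now apply Cpow_nz.
  replace (f w / w ^ 2 - l / 2)%C with ((f w - l / 2 * w ^ 2) / w ^ 2)%C by (field; auto).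
  rewrite Cmod_div, Cmod_pow by auto.
  assert (0 < Cmod w ^ 2) by now apply pow_lt.
  apply Rlt_div_l; auto. nra.
Qed.

Section Phi.

Variable L : C -> Prop.
Hypothesis HL : lattice L.
Variable b : R.

Notation W := (pole_series L).

Definition dphi (z : C) : C := (8 * W 3 z)%C.

(** The linear coefficient of the cubic in [dphi_ode], called [A] in the overview. *)
Definition phi_coef : C := (- 3 * b ^ 2 + 4 * g2 L)%C.

Hypothesis Hb : (b ^ 3 - 4 * g2 L * b - 16 * g3 L = 1)%C.

Lemma phi_pole_series z : phi L b z = (b - 4 * W 2 z)%C.
Proof. reflexivity. Qed.

Lemma cder_phi z : ~ L z -> cder (phi L b) z (dphi z).
Proof.
  intros Hz. eapply cder_eq.
  - apply cder_minus; [apply cder_const|]. apply cder_scal. apply (cder_pole_series L HL 2); auto.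
  - unfold dphi. simpl INR. rewrite RtoC_plus. ring.
Qed.

Lemma cder_dphi z : ~ L z ->
  cder dphi z (phi_coef / 2 + 3 * b * phi L b z - 3 / 2 * phi L b z ^ 2)%C.
Proof.
  intros Hz. eapply cder_eq.
  - apply cder_scal. apply (cder_pole_series L HL 3); auto.
  - rewrite pole_series_4_ode by auto. unfold phi_coef. rewrite phi_pole_series, g2_series by auto.
    simpl INR. rewrite !RtoC_plus. field.
Qed.

Lemma dphi_ode z : ~ L z ->
  (dphi z ^ 2 = 1 + phi_coef * phi L b z + 3 * b * phi L b z ^ 2 - phi L b z ^ 3)%C.
Proof.
  intros Hz. unfold dphi.
  replace ((8 * W 3 z) ^ 2)%C with (64 * W 3 z ^ 2)%C by ring.
  rewrite pole_series_3_ode by auto. unfold phi_coef. rewrite phi_pole_series, <- Hb.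
  rewrite g2_series, g3_series by auto. ring.
Qed.

Lemma phi_periodic z v : ~ L z -> L v -> phi L b (z + v) = phi L b z.
Proof. intros. unfold phi. rewrite <- !pole_series_2, pole_series_periodic; auto. Qed.

Lemma dphi_periodic z v : ~ L z -> L v -> dphi (z + v) = dphi z.
Proof. intros. unfold dphi. rewrite pole_series_periodic; auto. Qed.

Lemma phi_opp z : ~ L z -> phi L b (- z) = phi L b z.
Proof. intros. unfold phi. rewrite <- !pole_series_2, pole_series_opp by auto. ring. Qed.

Lemma dphi_opp z : ~ L z -> dphi (- z) = (- dphi z)%C.
Proof. intros. unfold dphi. rewrite pole_series_opp by auto. ring. Qed.

Lemma dphi_at_zero z : ~ L z -> phi L b z = 0 -> dphi z = 1 \/ dphi z = (- (1))%C.
Proof.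
  intros Hz E. pose proof (dphi_ode z Hz) as F. rewrite E in F.
  destruct (classic (dphi z = 1)) as [G|G]; [now left|right].
  apply Cminus_neq_0 in G.
  replace (dphi z) with ((dphi z ^ 2 - 1) / (dphi z - 1) - 1)%C by (field; auto).
  rewrite F. field. auto.
Qed.

Lemma clim_phi_0 : clim (fun x => x ^ 2 * phi L b x)%C 0 (-4)%C.
Proof.
  apply clim_ext with (fun x => b * x ^ 2 - 4 * (x ^ 2 * W 2 x))%C.
  { intros w _. rewrite phi_pole_series. ring. }
  eapply clim_eq.
  - apply clim_minus; (apply clim_mult; [apply clim_const|]).
    + apply clim_pow, clim_id.
    + apply clim_pole_series_0; auto.
  - ring.
Qed.

Lemma clim_inv_phi_0 : clim (fun x => / phi L b x)%C 0 0.
Proof.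
  assert (N4 : RtoC (-4) <> 0) by (intros E; apply RtoC_inj in E; lra).
  apply clim_ext_near with (fun x => x ^ 2 / (x ^ 2 * phi L b x))%C.
  - apply (near_mono _ _ _ (clim_neq_0 _ _ _ clim_phi_0 N4)). intros w Hw N.
    assert (phi L b w <> 0). { intros E. apply N. rewrite E. ring. }
    field. split; auto.
  - eapply clim_eq.
    + apply clim_div; [apply clim_pow, clim_id|apply clim_phi_0|auto].
    + field.
Qed.

(** Otherwise [1 / phi] would be elliptic, without poles and with limit 0 on [L], hence identically
    zero. *)
Lemma phi_has_zero : exists a, ~ L a /\ phi L b a = 0.
Proof.
  apply NNPP. intros N.
  assert (NZ : forall z, ~ L z -> phi L b z <> 0) by (intros z Hz E; apply N; eauto).
  destruct (exists_not_lattice L HL) as (z & Hz).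
  assert (E : (/ phi L b z)%C = 0).
  { apply (elliptic_constant L L (fun x => / phi L b x)%C (fun x => - dphi x / phi L b x ^ 2)%C); auto.
    - now apply lattice_locally_finite.
    - exists 0. now apply lattice_0.
    - intros. now apply lattice_plus.
    - intros x Hx. specialize (NZ x Hx). pose proof (cder_phi x Hx) as D. split.
      + now apply cder_inv.
      + apply ccont_mult.
        * apply ccont_opp. eapply cder_cont. now apply cder_dphi.
        * apply ccont_inv; [|now apply Cpow_nz]. apply ccont_pow. eapply cder_cont, D.
    - intros x v Hx Hv. now rewrite phi_periodic.
    - intros p Hp. apply clim_periodic with (S := L) (v := (- p)%C).
      + now apply lattice_locally_finite.
      + intros x Hx. rewrite phi_periodic; auto. now apply lattice_opp.
      + replace (p + - p)%C with (RtoC 0) by ring. apply clim_inv_phi_0. }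
  pose proof (NZ z Hz) as NZz. 
  assert (F : (phi L b z * / phi L b z)%C = 1) by (field; auto).
  rewrite E in F. replace (phi L b z * 0)%C with (RtoC 0) in F by ring.
  apply RtoC_inj in F. lra.
Qed.

(** Oddness of [phi'] lets the sign be normalised. With this choice [1 / phi] has residue 1 at [a],
    so that [a] is a simple zero of the Gauss map and [- a] a simple pole. *)
Lemma phi_zero_dphi_1 : exists a, ~ L a /\ phi L b a = 0 /\ dphi a = 1.
Proof.
  destruct phi_has_zero as (a & Ha & E).
  destruct (dphi_at_zero a Ha E) as [F|F]; [eauto|].
  exists (- a)%C. rewrite lattice_opp_iff by auto. rewrite phi_opp, dphi_opp, F by auto.
  repeat split; auto. ring.
Qed.

Variable a : C.
Hypothesis Ha : ~ L a.
Hypothesis Hphia : phi L b a = 0.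
Hypothesis Hdphia : dphi a = 1.

(* The zeros of [phi], which are the zeros and poles of the Gauss map. *)
Definition branch (z : C) : Prop := L (z - a)%C \/ L (z + a)%C.

(* The partial fraction decomposition of [1 / phi], including its removable values on [L]:
   see [phi_mult_recip_phi]. *)
Definition recip_phi (z : C) : C := (W 1 (z - a) - W 1 (z + a) + 2 * W 1 a)%C.

(** At a half period the odd periodic function [phi'] vanishes. Hence the two families of points in
    [branch] are disjoint. *)
Lemma double_a_not_lattice : ~ L (a + a)%C.
Proof.
  intros H. pose proof (dphi_opp a Ha) as E.
  assert (F : dphi a = (- dphi a)%C).
  { rewrite <- E. rewrite <- (dphi_periodic (- a) (a + a)); auto.
    - f_equal. ring.
    - now rewrite lattice_opp_iff. }
  apply Ceq_opp_0 in F. rewrite F in Hdphia. apply RtoC_inj in Hdphia. lra.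
Qed.

Lemma branch_locally_finite : locally_finite branch.
Proof.
  apply locally_finite_union.
  - apply (locally_finite_translate L a). now apply lattice_locally_finite.
  - apply (locally_finite_mono (fun z => L (z - - a)%C)).
    + apply locally_finite_translate. now apply lattice_locally_finite.
    + intros z Hz. now replace (z - - a)%C with (z + a)%C by ring.
Qed.

Lemma branch_shift z v : L v -> branch (z + v)%C <-> branch z.
Proof.
  intros Hv. unfold branch.
  replace (z + v - a)%C with (z - a + v)%C by ring.
  replace (z + v + a)%C with (z + a + v)%C by ring.
  now rewrite !lattice_shift by auto.
Qed.

Lemma lattice_not_branch z : L z -> ~ branch z.
Proof.
  intros Hz [H|H]; apply Ha.
  - replace a with (z - (z - a))%C by ring. now apply lattice_minus.
  - replace a with (z + a - z)%C by ring. now apply lattice_minus.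
Qed.

Lemma cder_recip_phi z : ~ branch z -> cder recip_phi z (W 2 (z + a) - W 2 (z - a))%C.
Proof.
  intros Hz. eapply cder_eq.
  - apply cder_plus; [|apply cder_const]. apply cder_minus.
    + apply (cder_shift (W 1) (- a)%C z (- INR 1 * W 2 (z - a))%C).
      apply (cder_pole_series L HL 1); auto. intros F. apply Hz. now left.
    + apply (cder_shift (W 1) a z (- INR 1 * W 2 (z + a))%C).
      apply (cder_pole_series L HL 1); auto. intros F. apply Hz. now right.
  - simpl INR. ring.
Qed.

Lemma recip_phi_cont z : ~ branch z -> ccont recip_phi z.
Proof. intros. eapply cder_cont, cder_recip_phi; auto. Qed.

Lemma recip_phi_periodic z v : ~ branch z -> L v -> recip_phi (z + v) = recip_phi z.
Proof.
  intros Hz Hv. destruct (zeta_quasi_periodic L HL v Hv) as (eta & He).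
  unfold recip_phi.
  replace (z + v - a)%C with (z - a + v)%C by ring.
  replace (z + v + a)%C with (z + a + v)%C by ring.
  rewrite !He by (intros F; apply Hz; (now left) || (now right)).
  ring.
Qed.

Lemma recip_phi_0 : recip_phi 0 = 0.
Proof.
  unfold recip_phi. replace (0 - a)%C with (- a)%C by ring. replace (0 + a)%C with a by ring.
  rewrite pole_series_opp by auto. ring.
Qed.

(** The value and the first derivative at 0 vanish by the parity of [zeta] and [wp]. The second
    derivative is [- 4 * W 3 a = - dphi a / 2], and half of it is the inverse of the coefficient -4
    in [phi ~ -4 / z^2]. *)
Lemma clim_recip_phi_0 : clim (fun z => recip_phi z / z ^ 2)%C 0 (- / 4)%C.
Proof.
  assert (N0 : ~ branch 0) by (apply lattice_not_branch; now apply lattice_0).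
  assert (Nma : ~ L (- a)%C) by now rewrite lattice_opp_iff.
  assert (N2 : RtoC 2 <> 0) by (intros E; apply RtoC_inj in E; lra).
  assert (N4 : RtoC 4 <> 0) by (intros E; apply RtoC_inj in E; lra).
  eapply clim_eq.
  - apply (clim_taylor_2 recip_phi (fun z => W 2 (z + a) - W 2 (z - a))%C (- 4 * W 3 a)%C).
    + apply recip_phi_0.
    + replace (0 - a)%C with (- a)%C by ring. replace (0 + a)%C with a by ring.
      rewrite pole_series_opp by auto. ring.
    + apply (near_mono _ _ _ (locally_finite_near branch 0 branch_locally_finite)).
      intros w _ Hw. now apply cder_recip_phi.
    + now apply cder_recip_phi.
    + eapply cder_eq.
      * apply cder_minus.
        -- apply (cder_shift (W 2) a 0 (- INR 2 * W 3 (0 + a))%C).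
           apply (cder_pole_series L HL 2); auto. now replace (0 + a)%C with a by ring.
        -- apply (cder_shift (W 2) (- a)%C 0 (- INR 2 * W 3 (0 + - a))%C).
           apply (cder_pole_series L HL 2); auto. now replace (0 + - a)%C with (- a)%C by ring.
      * replace (0 + a)%C with a by ring. replace (0 + - a)%C with (- a)%C by ring.
        rewrite pole_series_opp by auto. simpl INR. rewrite RtoC_plus. ring.
  - replace (W 3 a) with (/ 8 * dphi a)%C.
    + rewrite Hdphia. field.
    + unfold dphi. field.
Qed.

Lemma clim_residue_recip_phi : clim (fun z => (z - a) * recip_phi z)%C a 1.
Proof.
  assert (C1 : ccont (fun z => W 1 (z + a)) a).
  { eapply cder_cont, (cder_shift (W 1) a a), (cder_pole_series L HL 1); auto.
    apply double_a_not_lattice. }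
  apply clim_ext with (fun z => (z + - a) ^ 1 * W 1 (z + - a) + (z - a) * (2 * W 1 a - W 1 (z + a)))%C.
  { intros w _. unfold recip_phi, Cminus. simpl. ring. }
  eapply clim_eq.
  - apply clim_plus.
    + apply (clim_shift (fun x => x ^ 1 * W 1 x)%C). replace (a + - a)%C with (RtoC 0) by ring.
      now apply clim_pole_series_0.
    + apply clim_mult.
      * apply clim_minus; [apply clim_id|apply clim_const].
      * apply clim_minus; [apply clim_const|apply C1].
  - ring.
Qed.

Lemma recip_phi_opp z : ~ branch z -> recip_phi (- z) = recip_phi z.
Proof.
  intros Hz. unfold recip_phi.
  replace (- z - a)%C with (- (z + a))%C by ring. replace (- z + a)%C with (- (z - a))%C by ring.
  rewrite !pole_series_opp; auto; [ring| |]; intros F; apply Hz; [now left|now right].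
Qed.

(** The product is elliptic and tends to 1 at all its singularities: at 0 by the leading
    coefficients, at [a] because [phi'] and the residue of [recip_phi] are both 1, at [- a] by
    evenness, and elsewhere by periodicity. *)
Lemma phi_mult_recip_phi z : ~ L z -> ~ branch z -> (phi L b z * recip_phi z)%C = 1.
Proof.
  intros Hz Bz.
  set (S := fun x => L x \/ branch x).
  assert (HS : locally_finite S).
  { apply locally_finite_union; [now apply lattice_locally_finite|apply branch_locally_finite]. }
  set (h := fun x => (phi L b x * recip_phi x)%C).
  assert (Hper : forall x v, ~ S x -> L v -> h (x + v)%C = h x).
  { intros x v Hx Hv. unfold h. rewrite phi_periodic, recip_phi_periodic; auto;
      intros F; apply Hx; unfold S; auto. }
  assert (Lima : clim h a 1).
  { apply clim_ext with (fun z => ((phi L b z - phi L b a) / (z - a)) * ((z - a) * recip_phi z))%C.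
    { intros w Hw. rewrite Hphia. unfold h. field. now apply Cminus_neq_0. }
    eapply clim_eq.
    - apply clim_mult; [exact (cder_phi a Ha)|exact clim_residue_recip_phi].
    - rewrite Hdphia. ring. }
  apply (elliptic_constant L S h (fun x => dphi x * recip_phi x + phi L b x * (W 2 (x + a) - W 2 (x - a)))%C).
  - auto.
  - auto.
  - exists 0. left. now apply lattice_0.
  - intros x v Hv [F|F]; [left; now apply lattice_plus|right; now apply branch_shift].
  - intros x Hx. assert (Lx : ~ L x) by (intros F; apply Hx; now left).
    assert (Bx : ~ branch x) by (intros F; apply Hx; now right). split.
    + apply cder_mult; [now apply cder_phi|now apply cder_recip_phi].
    + assert (CW : forall v, ~ L (x + v)%C -> ccont (fun y => W 2 (y + v)) x).
      { intros v Hv. eapply cder_cont, (cder_shift (W 2) v x), (cder_pole_series L HL 2); auto. }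
      apply ccont_plus; apply ccont_mult.
      * eapply cder_cont. now apply cder_dphi.
      * now apply recip_phi_cont.
      * eapply cder_cont. now apply cder_phi.
      * apply ccont_minus; apply CW; intros F; apply Bx; [now right|now left].
  - auto.
  - intros p [Hp|[Hp|Hp]].
    + apply clim_periodic with (S := S) (v := (- p)%C); auto.
      { intros x Hx. apply Hper; auto. now apply lattice_opp. }
      replace (p + - p)%C with (RtoC 0) by ring.
      apply clim_ext with (fun x => (x ^ 2 * phi L b x) * (recip_phi x / x ^ 2))%C.
      { intros w Hw. unfold h. field. auto. }
      eapply clim_eq.
      * apply clim_mult; [apply clim_phi_0|apply clim_recip_phi_0].
      * field.
    + apply clim_periodic with (S := S) (v := (- (p - a))%C); auto.
      { intros x Hx. apply Hper; auto. now apply lattice_opp. }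
      now replace (p + - (p - a))%C with a by ring.
    + apply clim_periodic with (S := S) (v := (- (p + a))%C); auto.
      { intros x Hx. apply Hper; auto. now apply lattice_opp. }
      replace (p + - (p + a))%C with (- a)%C by ring.
      apply clim_ext_near with (fun x => h (- x)%C).
      * apply (near_mono _ _ _ (locally_finite_near S (- a) HS)). intros w _ Hw. unfold h.
        rewrite phi_opp, recip_phi_opp; auto; intros F; apply Hw; [now right|now left].
      * apply (clim_comp h (fun x => - x)%C (- a)%C a 1).
        -- eapply clim_eq; [apply clim_opp, clim_id|ring].
        -- exact Lima.
        -- left. apply (near_mono _ _ _ (near_neq (- a)%C)). intros w _ Hw E. apply Hw.
           rewrite <- E. ring.
  - intros [F|F]; auto.
Qed.

Lemma phi_branch z : branch z -> phi L b z = 0.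
Proof.
  intros [H|H].
  - replace z with (a + (z - a))%C by ring. now rewrite phi_periodic.
  - replace z with (- a + (z + a))%C by ring. rewrite phi_periodic, phi_opp; auto.
    now rewrite lattice_opp_iff.
Qed.

Lemma branch_not_lattice z : branch z -> ~ L z.
Proof. intros H F. exact (lattice_not_branch z F H). Qed.

(** The identity with the partial fractions replaces a count of the zeros of an elliptic function:
    [phi] has an inverse off [branch]. *)
Lemma phi_neq_0 z : ~ L z -> ~ branch z -> phi L b z <> 0.
Proof.
  intros Hz Bz E. pose proof (phi_mult_recip_phi z Hz Bz) as F. rewrite E in F.
  replace (0 * recip_phi z)%C with (RtoC 0) in F by ring. apply RtoC_inj in F. lra.
Qed.

Lemma recip_phi_eq z : ~ L z -> ~ branch z -> recip_phi z = (/ phi L b z)%C.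
Proof.
  intros Hz Bz. pose proof (phi_neq_0 z Hz Bz).
  replace (recip_phi z) with (phi L b z * recip_phi z / phi L b z)%C by (field; auto).
  rewrite phi_mult_recip_phi by auto. field. auto.
Qed.

Lemma inv_phi_domain_iff z : inv_phi_domain L b z <-> ~ branch z.
Proof.
  unfold inv_phi_domain. split.
  - intros [H|H]; [now apply lattice_not_branch|]. intros F. apply H. now apply phi_branch.
  - intros H. destruct (classic (L z)) as [F|F]; [now left|right]. now apply phi_neq_0.
Qed.

Lemma removable_ext_inv_phi z : ~ branch z -> removable_ext (fun nu => / phi L b nu)%C z = recip_phi z.
Proof.
  intros Hz. apply C_lim_eq. apply clim_ext_near with recip_phi; [|now apply recip_phi_cont].
  destruct (near_and _ _ _ (locally_finite_near branch z branch_locally_finite)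
     (locally_finite_near L z (lattice_locally_finite L HL))) as (d & Hd & K).
  exists d. split; auto. intros w Hw Hwd. destruct (K w Hw Hwd). now apply recip_phi_eq.
Qed.

End Phi.

(** ** The Gauss map *)

Section Gauss.

Variable L : C -> Prop.
Hypothesis HL : lattice L.
Variable b : R.
Variable a : C.
Hypothesis Ha : ~ L a.
Hypothesis Hphia : phi L b a = 0.
Hypothesis Hdphia : dphi L a = 1.

Notation W := (pole_series L).
Notation U := (fun z => ~ branch L a z).
Notation B := (recip_phi L a).

Definition partial_factor (p q c z : C) : C := ((z - p) / (z - q) * Cexp (c * z))%C.

Lemma cder_partial_factor p q c z : z <> p -> z <> q ->
  cder (partial_factor p q c) z ((/ (z - p) - / (z - q) + c) * partial_factor p q c z)%C.
Proof.
  intros Hp Hq. apply Cminus_neq_0 in Hp, Hq. eapply cder_eq.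
  - apply cder_mult.
    + apply cder_mult.
      * apply cder_minus; [apply cder_id|apply cder_const].
      * apply cder_inv; [apply cder_minus; [apply cder_id|apply cder_const]|exact Hq].
    + apply (cder_comp Cexp (fun x => c * x)%C); [apply cder_scal, cder_id|apply cder_Cexp].
  - unfold partial_factor. field. auto.
Qed.

(** Up to constant factors, the finite products of [exp (2 zeta(a) z) sigma(z - a) / sigma(z + a)].
    The exponent [- 2 * a / w ^ 2] is the difference of the correcting terms of [zeta] at [z - a]
    and at [z + a]. *)
Fixpoint partial_product (l : list C) (z : C) : C :=
  match l with
  | nil => partial_factor a (- a) (2 * W 1 a) z
  | w :: l => partial_factor (a + w) (- a + w) (- 2 * a / w ^ 2) z * partial_product l z
  end%C.

Fixpoint partial_sum (l : list C) (z : C) : C :=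
  match l with
  | nil => / (z - a) - / (z - - a) + 2 * W 1 a
  | w :: l => (/ (z - (a + w)) - / (z - (- a + w)) + - 2 * a / w ^ 2) + partial_sum l z
  end%C.

Lemma not_branch_neq z w : ~ branch L a z -> L w -> z <> (a + w)%C /\ z <> (- a + w)%C.
Proof.
  intros Hz Hw. split; intros ->; apply Hz.
  - left. now replace (a + w - a)%C with w by ring.
  - right. now replace (- a + w + a)%C with w by ring.
Qed.

Lemma not_branch_neq_0 z : ~ branch L a z -> z <> a /\ z <> (- a)%C.
Proof.
  intros Hz. destruct (not_branch_neq z 0 Hz (lattice_0 L HL)) as [A A'].
  split; intros E; [apply A|apply A']; rewrite E; ring.
Qed.

Lemma cder_partial_product l z : finite_in (nonzero_of L) l -> ~ branch L a z ->
  cder (partial_product l) z (partial_sum l z * partial_product l z)%C.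
Proof.
  intros [_ Hl] Hz. induction Hl as [|w l [Hw _] _ IH]; simpl.
  - apply cder_partial_factor; now apply not_branch_neq_0.
  - eapply cder_eq.
    + apply cder_mult; [apply cder_partial_factor; now apply not_branch_neq|exact IH].
    + ring.
Qed.

Lemma partial_product_neq_0 l z : finite_in (nonzero_of L) l -> ~ branch L a z ->
  partial_product l z <> 0.
Proof.
  intros [_ Hl] Hz.
  assert (K : forall p q c, z <> p -> z <> q -> partial_factor p q c z <> 0).
  { intros p q c Hp Hq. apply Cminus_neq_0 in Hp, Hq. unfold partial_factor, Cdiv.
    apply Cmult_neq_0; [|apply Cexp_neq_0]. apply Cmult_neq_0; auto.
    intros E. assert (F : ((z - q) * / (z - q))%C = 1) by (field; auto).
    rewrite E in F. replace ((z - q) * 0)%C with (RtoC 0) in F by ring. apply RtoC_inj in F. lra. }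
  induction Hl as [|w l [Hw _] _ IH]; simpl.
  - apply K; now apply not_branch_neq_0.
  - apply Cmult_neq_0; auto. apply K; now apply not_branch_neq.
Qed.

Lemma partial_sum_cont l z : finite_in (nonzero_of L) l -> ~ branch L a z -> ccont (partial_sum l) z.
Proof.
  intros [_ Hl] Hz.
  assert (K : forall p q c, z <> p -> z <> q -> ccont (fun z => / (z - p) - / (z - q) + c)%C z).
  { intros p q c Hp Hq. apply Cminus_neq_0 in Hp, Hq.
    apply ccont_plus; [|apply ccont_const]. apply ccont_minus; apply ccont_inv; auto;
    (apply ccont_minus; [apply ccont_id|apply ccont_const]). }
  induction Hl as [|w l [Hw _] _ IH]; simpl.
  - apply K; now apply not_branch_neq_0.
  - apply ccont_plus; auto. apply K; now apply not_branch_neq.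
Qed.

Lemma partial_sum_series l z : finite_in (nonzero_of L) l -> ~ branch L a z ->
  partial_sum l z = (/ (z - a) - / (z + a) + 2 * W 1 a
    + (finite_sum (mittag_leffler 1 (z - a)) l - finite_sum (mittag_leffler 1 (z + a)) l))%C.
Proof.
  intros [_ Hl] Hz. induction Hl as [|w l [Hw Nw] _ IH]; simpl.
  - replace (z - - a)%C with (z + a)%C by ring. ring.
  - rewrite IH. destruct (not_branch_neq z w Hz Hw) as [A A'].
    apply Cminus_neq_0 in A, A'.
    replace (z - a - w)%C with (z - (a + w))%C by ring.
    replace (z + a - w)%C with (z - (- a + w))%C by ring.
    replace (- 2 * a / w ^ 2)%C with ((z - a) / w ^ 2 - (z + a) / w ^ 2)%C by (field; auto).
    unfold Cdiv. simpl. ring.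
Qed.

Lemma partial_sum_uniform r e : 0 < e -> exists l0, finite_in (nonzero_of L) l0 /\
  forall l z, finite_in (nonzero_of L) l -> incl l0 l -> Cmod z <= r -> ~ branch L a z ->
    Cmod (B z - partial_sum l z) <= e.
Proof.
  intros He. destruct (lattice_series_1_uniform L HL (r + Cmod a) (e / 2)) as (l0 & Hl0 & K); [lra|].
  exists l0. split; auto. intros l z Hl I Hr Hz.
  assert (K1 := K l (z - a)%C Hl I). assert (K2 := K l (z + a)%C Hl I).
  pose proof (Cmod_triangle z a). pose proof (Cmod_triangle_minus z a).
  specialize (K1 ltac:(lra) ltac:(intros [F _]; apply Hz; now left)).
  specialize (K2 ltac:(lra) ltac:(intros [F _]; apply Hz; now right)).
  rewrite partial_sum_series by auto. unfold recip_phi. unfold pole_series at 1 2.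
  match type of K1 with Cmod ?x <= _ => match type of K2 with Cmod ?y <= _ =>
    match goal with |- Cmod ?w <= _ => replace w with (x - y)%C; 
      [pose proof (Cmod_triangle_minus x y); lra|] end end end.
  simpl Cpow. rewrite !Cmult_1_r. ring.
Qed.

Lemma path_integral_partial_sum c d I e : 0 < e -> path_integral U B c d I ->
  exists l0, finite_in (nonzero_of L) l0 /\ forall l, finite_in (nonzero_of L) l -> incl l0 l ->
    exists J, path_integral U (partial_sum l) c d J /\ Cmod (I - J) <= e.
Proof.
  intros He HI. revert e He.
  induction HI as [c Hc | c d f gam dgam I J Hgam HI HJ IH]; intros e He.
  - exists nil. split; [apply finite_in_nil|]. intros l Hl _. exists (RtoC 0). split; [now constructor|].
    replace (0 - 0)%C with (RtoC 0) by ring. rewrite Cmod_0. lra.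
  - assert (HBc : forall z, ~ branch L a z -> ccont B z) by (intros; now apply (recip_phi_cont L HL a)).
    destruct (C1_path_primitive U B _ _ _ _ Hgam HBc) as (K & K0 & K1 & K2).
    pose proof Hgam as (G1 & G2 & _ & _ & G5).
    destruct (rcont_bounded gam 1) as (r & Hr & Hrb); [lra| |].
    { intros t _. eapply rder_rcont, is_derive_C_rder, G1. }
    destruct (rcont_bounded dgam 1) as (m & Hm & Hmb); [lra| |].
    { intros t _. apply continuous_C_rcont, G2. }
    (* The path has modulus at most [2 * r] and its velocity at most [2 * m], so this tolerance
       costs at most [e / 2] on the first piece; the induction spends the other half. *)
    destruct (partial_sum_uniform (2 * r) (e / (4 * m + 2))) as (l1 & Hl1 & Hu).
    { apply Rdiv_lt_0_compat; lra. }
    destruct (IH (e / 2)) as (l2 & Hl2 & Hi); [lra|].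
    destruct (finite_in_union _ _ _ Hl1 Hl2) as (l0 & Hl0 & I1 & I2).
    exists l0. split; auto. intros l Hl Il.
    destruct (Hi l Hl) as (J' & HJ' & EJ'). { intros w Hw. auto. }
    destruct (C1_path_primitive U (partial_sum l) _ _ _ _ Hgam) as (K' & K0' & K1' & K2').
    { intros z Hz. now apply partial_sum_cont. }
    exists (K' 1 + J')%C. split; [eapply path_integral_cons; eauto|].
    rewrite (is_RIntC_unique _ _ _ _ _ HI K2).
    assert (E : Cmod (K 1 - K' 1) <= e / 2).
    { pose proof (mean_value_rder (fun t => K t + -1 * K' t)%C
        (fun t => (B (gam t) - partial_sum l (gam t)) * dgam t)%C (e / 2) 0 1 ltac:(lra)) as M.
      cbv beta in M. rewrite K0, K0' in M.
      replace (K 1 + -1 * K' 1 - (0 + -1 * 0))%C with (K 1 - K' 1)%C in M by ring.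
      replace (e / 2 * (1 - 0)) with (e / 2) in M by ring. apply M.
      - intros t Ht. eapply rder_eq.
        + apply rder_plus; [apply K1, Ht|]. apply rder_mult; [apply rder_const|apply K1', Ht].
        + cbv beta. ring.
      - intros t Ht. rewrite Cmod_mult. destruct (Hrb t Ht). destruct (Hmb t Ht).
        pose proof (Cmod_le_components (gam t)). pose proof (Cmod_le_components (dgam t)).
        replace (e / 2) with (e / (4 * m + 2) * (2 * m + 1)) by (field; lra).
        apply Rmult_le_compat; auto using Cmod_ge_0; [|lra].
        apply Hu; auto; [|lra]. intros w Hw. auto. }
    replace (K 1 + J - (K' 1 + J'))%C with ((K 1 - K' 1) + (J - J'))%C by ring.
    eapply Rle_trans; [apply Cmod_triangle|]. lra.
Qed.

(* No sigma function is needed: the integral of [recip_phi] is the limit of the integrals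
   of the partial sums, whose exponentials are ratios of values of the partial products. *)
Lemma Cexp_path_integral_unique c d I J : path_integral U B c d I -> path_integral U B c d J ->
  Cexp I = Cexp J.
Proof.
  intros HI HJ.
  assert (E : Cexp (I - J) = 1).
  { apply Cmod_eq_of_le. intros e He.
    destruct (ccont_eps Cexp 0 e (cder_cont _ _ _ (cder_Cexp 0)) He) as (d0 & Hd & K).
    destruct (path_integral_partial_sum c d I (d0 / 4) ltac:(lra) HI) as (l1 & Hl1 & K1).
    destruct (path_integral_partial_sum c d J (d0 / 4) ltac:(lra) HJ) as (l2 & Hl2 & K2).
    destruct (finite_in_union _ _ _ Hl1 Hl2) as (l & Hl & I1 & I2).
    destruct (K1 l Hl I1) as (I' & HI' & EI). destruct (K2 l Hl I2) as (J' & HJ' & EJ).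
    pose proof (partial_product_neq_0 l c Hl (path_integral_start _ _ _ _ _ HI)) as Nc.
    assert (Hlog : forall X, path_integral U (partial_sum l) c d X ->
       partial_product l d = (partial_product l c * Cexp X)%C).
    { intros X HX. apply (path_integral_log U (partial_sum l)); auto; intros z Hz.
      - now apply partial_sum_cont.
      - now apply cder_partial_product. }
    assert (E1 : Cexp I' = Cexp J').
    { pose proof (Hlog _ HI') as A. rewrite (Hlog _ HJ') in A.
      replace (Cexp I') with (partial_product l c * Cexp I' / partial_product l c)%C by (field; auto).
      rewrite <- A. field. auto. }
    assert (E2 : Cexp (I - J) = Cexp ((I - I') - (J - J'))%C).
    { replace (I - J)%C with (((I - I') - (J - J')) + (I' + - J'))%C by ring.
      rewrite Cexp_plus, (Cexp_plus I'), Cexp_opp, E1. field. apply Cexp_neq_0. }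
    rewrite E2, <- Cexp_0. left. apply K.
    replace (I - I' - (J - J') - 0)%C with ((I - I') - (J - J'))%C by ring.
    eapply Rle_lt_trans; [apply Cmod_triangle_minus|]. lra. }
  replace I with (I - J + J)%C by ring. rewrite Cexp_plus, E. ring.
Qed.

(** The domain and the integrand in the definition of [gauss] agree with the complement of [branch]
    and with [recip_phi]; path independence then makes the described value unique. *)
Lemma gauss_eq (g0 : R) z I : path_integral U B 0 z I -> gauss L b g0 z = (g0 * Cexp I)%C.
Proof.
  intros HI. unfold gauss.
  assert (EU : inv_phi_domain L b = U).
  { apply functional_extensionality. intros x. apply propositional_extensionality.
    now apply inv_phi_domain_iff. }
  rewrite EU.
  assert (K : forall J, path_integral U (removable_ext (fun nu => / phi L b nu)%C) 0 z J <->
     path_integral U B 0 z J).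
  { intros J. split; apply path_integral_ext; intros x Hx; [|symmetry];
      now apply removable_ext_inv_phi. }
  apply (iota_unique (V := C_R_CompleteNormedModule)).
  - intros y (J & HJ & ->). apply K in HJ. f_equal. now apply (Cexp_path_integral_unique 0 z).
  - exists I. split; auto. now apply K.
Qed.

Variable g0 : R.
Hypothesis Hg0 : 0 < g0.
Notation g := (gauss L b g0).

Lemma not_branch_0 : ~ branch L a 0.
Proof. apply lattice_not_branch; auto. now apply lattice_0. Qed.

Lemma recip_phi_path z z' : ~ branch L a z -> ~ branch L a z' -> exists I, path_integral U B z z' I.
Proof.
  intros. apply path_integral_exists; auto.
  - now apply branch_locally_finite.
  - intros. now apply recip_phi_cont.
Qed.

Lemma gauss_path z z' I : path_integral U B z z' I -> g z' = (g z * Cexp I)%C.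
Proof.
  intros HI.
  destruct (recip_phi_path 0 z not_branch_0 (path_integral_start _ _ _ _ _ HI)) as (J & HJ).
  rewrite (gauss_eq g0 z J HJ), (gauss_eq g0 z' (J + I)%C), Cexp_plus.
  - ring.
  - eapply path_integral_app; eauto.
Qed.

Lemma gauss_0 : g 0 = g0.
Proof. rewrite (gauss_eq g0 0 0). - rewrite Cexp_0. ring. - constructor. apply not_branch_0. Qed.

Lemma gauss_neq_0 z : ~ branch L a z -> g z <> 0.
Proof.
  intros Hz. destruct (recip_phi_path 0 z not_branch_0 Hz) as (J & HJ).
  rewrite (gauss_eq g0 z J HJ). apply Cmult_neq_0; [|apply Cexp_neq_0].
  intros E. apply RtoC_inj in E. lra.
Qed.

(** A path from 0 to [z], translated by [v], leads from [v] to [z + v] with the same integral; the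
    multiplier is therefore the value at [v] divided by the value at 0. *)
Lemma gauss_quasi_periodic z v : ~ branch L a z -> L v -> g (z + v) = (g v / g0 * g z)%C.
Proof.
  intros Hz Hv. destruct (recip_phi_path 0 z not_branch_0 Hz) as (J & HJ).
  pose proof (path_integral_shift U B 0 z J v) as HS.
  rewrite (gauss_path (0 + v)%C (z + v)%C J).
  - rewrite (gauss_eq g0 z J HJ). replace (0 + v)%C with v by ring. field.
    intros E. apply RtoC_inj in E. lra.
  - apply HS; auto.
    + intros x Hx. now rewrite branch_shift.
    + intros x Hx. now apply recip_phi_periodic.
Qed.

(** In a disc off [branch] the value at [z + h] is [g z * Cexp k], with [k] the integral over the
    segment. Here [k] is [B z * h] up to [e1 * Cmod h], and [Cexp k] is [1 + k] up to
    [e2 * Cmod k]. *)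
Lemma cder_gauss z : ~ branch L a z -> cder g z (g z * B z)%C.
Proof.
  intros Hz.
  destruct (locally_finite_gap (branch L a) z (branch_locally_finite L HL a)) as (d0 & Hd0 & Hgap).
  assert (HUz : forall w, Cmod (w - z) < d0 -> ~ branch L a w).
  { intros w Hw F. destruct (classic (w = z)) as [->|N]; [auto|].
    specialize (Hgap w F N). rewrite Cmod_minus_sym in Hgap. lra. }
  apply cder_of_eps. intros e He.
  pose proof (Cmod_ge_0 (g z)) as Gz. pose proof (Cmod_ge_0 (B z)) as Bz.
  set (e1 := Rmin 1 (e / (2 * (Cmod (g z) + 1)))).
  assert (He1 : 0 < e1).
  { apply Rmin_pos; [lra|]. apply Rdiv_lt_0_compat; lra. }
  set (e2 := e1 / (Cmod (B z) + 1)).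
  assert (He2 : 0 < e2) by (apply Rdiv_lt_0_compat; lra).
  destruct (ccont_eps B z e1 (recip_phi_cont L HL a z Hz) He1) as (d1 & Hd1 & K1).
  destruct (cder_eps Cexp 0 (Cexp 0) e2 (cder_Cexp 0) He2) as (d2 & Hd2 & K2).
  rewrite Cexp_0 in K2.
  set (d := Rmin (Rmin d0 d1) (d2 / (Cmod (B z) + 1))).
  exists d. split.
  { apply Rmin_pos; [now apply Rmin_pos|]. apply Rdiv_lt_0_compat; lra. }
  intros h Hh.
  pose proof (Rmin_l (Rmin d0 d1) (d2 / (Cmod (B z) + 1))) as M1.
  pose proof (Rmin_r (Rmin d0 d1) (d2 / (Cmod (B z) + 1))) as M2.
  pose proof (Rmin_l d0 d1). pose proof (Rmin_r d0 d1). fold d in M1, M2.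
  pose proof (Rmin_l 1 (e / (2 * (Cmod (g z) + 1)))) as M3.
  pose proof (Rmin_r 1 (e / (2 * (Cmod (g z) + 1)))) as M4. fold e1 in M3, M4.
  assert (Hseg : forall t, 0 <= t <= 1 -> Cmod (seg z (z + h) t - z) < d).
  { intros t Ht. eapply Rle_lt_trans; [now apply seg_in_ball|]. now replace (z + h - z)%C with h by ring. }
  destruct (path_integral_seg U B z (z + h)%C) as (J & J0 & J1 & HJ).
  { intros t Ht. apply HUz. specialize (Hseg t Ht). lra. }
  { intros. now apply recip_phi_cont. }
  rewrite (gauss_path _ _ _ HJ).
  set (k := J 1) in *. pose proof (Cmod_ge_0 h) as H0h.
  assert (Ek : Cmod (k - B z * h) <= e1 * Cmod h).
  { pose proof (mean_value_rder (fun t => J t + (- (B z * h)) * t)%C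
      (fun t => (B (seg z (z + h) t) - B z) * h)%C (e1 * Cmod h) 0 1 ltac:(lra)) as M.
    cbv beta in M. rewrite J0 in M. fold k in M.
    replace (k + - (B z * h) * 1 - (0 + - (B z * h) * 0))%C with (k - B z * h)%C in M by ring.
    replace (e1 * Cmod h * (1 - 0)) with (e1 * Cmod h) in M by ring. apply M.
    - intros t Ht. eapply rder_eq.
      + apply rder_plus; [apply J1, Ht|]. apply rder_mult; [apply rder_const|apply rder_RtoC].
      + cbv beta. ring.
    - intros t Ht. rewrite Cmod_mult. apply Rmult_le_compat_r; auto. left. apply K1.
      specialize (Hseg t Ht). lra. }
  assert (Hk : Cmod k <= (Cmod (B z) + 1) * Cmod h).
  { replace k with (k - B z * h + B z * h)%C by ring.
    eapply Rle_trans; [apply Cmod_triangle|]. rewrite (Cmod_mult (B z)). nra. }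
  assert (Hk2 : Cmod k < d2).
  { apply Rle_lt_trans with (1 := Hk). apply Rlt_le_trans with ((Cmod (B z) + 1) * (d2 / (Cmod (B z) + 1))).
    - apply Rmult_lt_compat_l; lra.
    - right. field. lra. }
  specialize (K2 k Hk2). replace (0 + k)%C with k in K2 by ring.
  replace (g z * Cexp k - g z - g z * B z * h)%C
    with (g z * ((Cexp k - 1 - 1 * k) + (k - B z * h)))%C by ring.
  rewrite Cmod_mult.
  assert (T : Cmod ((Cexp k - 1 - 1 * k) + (k - B z * h))%C <= 2 * e1 * Cmod h).
  { eapply Rle_trans; [apply Cmod_triangle|].
    assert (e2 * Cmod k <= e1 * Cmod h); [|lra].
    apply Rle_trans with (e2 * ((Cmod (B z) + 1) * Cmod h)); [apply Rmult_le_compat_l; lra|].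
    right. unfold e2. field. lra. }
  apply Rle_trans with (Cmod (g z) * (2 * e1 * Cmod h)); [apply Rmult_le_compat_l; auto|].
  assert (Q : e1 * (2 * (Cmod (g z) + 1)) <= e) by (apply Rle_div_r; lra).
  assert (Cmod (g z) * (2 * e1) <= e) by nra.
  nra.
Qed.

End Gauss.

(** ** Removable singularities *)

(** If [p] lies on the segment, the detour goes through the image of [z] under a quarter turn about
    [p], which stays at the same distance from [p]. Otherwise [z] itself serves as the corner. *)
Lemma segments_avoiding_point (p z z' : C) : z <> p -> z' <> p ->
  exists m, Cmod (m - p) <= Cmod (z - p) /\
    (forall t, 0 <= t <= 1 -> seg z m t <> p) /\ (forall t, 0 <= t <= 1 -> seg m z' t <> p).
Proof.
  intros Hz Hz'. apply Cminus_neq_0 in Hz, Hz'.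
  set (x := (z - p)%C) in *. set (y := (z' - p)%C) in *.
  destruct (classic (exists t, 0 <= t <= 1 /\ seg z z' t = p)) as [(t & Ht & Et)|N].
  - assert (E : (RtoC (1 - t) * x + t * y = 0)%C).
    { unfold x, y. rewrite RtoC_minus.
      replace ((1 - t) * (z - p) + t * (z' - p))%C with (seg z z' t - p)%C by (unfold seg; ring).
      rewrite Et. ring. }
    assert (Ht0 : 0 < t).
    { destruct (Req_dec t 0) as [->|F]; [|lra]. exfalso. apply Hz.
      rewrite <- E. replace (1 - 0) with 1 by ring. ring. }
    assert (Nt : RtoC t <> 0) by (intros F; apply RtoC_inj in F; lra).
    assert (Ey : y = (- RtoC ((1 - t) / t) * x)%C).
    { rewrite RtoC_div by lra. replace y with ((RtoC (1 - t) * x + t * y - RtoC (1 - t) * x) / t)%C by (field; auto).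
      rewrite E. field. auto. }
    assert (Q : forall u v : R, (u <> 0 \/ v <> 0) -> ((u, v) : C) <> 0).
    { intros u v H F. injection F as A B. destruct H; auto. }
    exists (p + Ci * x)%C. split; [|split].
    + replace (p + Ci * x - p)%C with (Ci * x)%C by ring. rewrite Cmod_mult, Cmod_Ci. lra.
    + intros s Hs F.
      assert (G : ((((1 - s)%R, s) : C) * x)%C = 0).
      { replace (((1 - s)%R, s) : C) with (RtoC (1 - s) + Ci * s)%C.
        - rewrite RtoC_minus. replace ((1 - s + Ci * s) * x)%C with (seg z (p + Ci * x) s - p)%C
            by (unfold seg, x; ring). rewrite F. ring.
        - unfold RtoC, Ci, Cplus, Cmult; simpl. f_equal; ring. }
      revert G. apply Cmult_neq_0; auto. apply Q. destruct (Req_dec s 0); [left; lra|now right].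
    + intros s Hs F.
      assert (G : ((((- (s * ((1 - t) / t)))%R, (1 - s)%R) : C) * x)%C = 0).
      { replace (((- (s * ((1 - t) / t)))%R, (1 - s)%R) : C)
          with (Ci * RtoC (1 - s) + s * - RtoC ((1 - t) / t))%C.
        - rewrite RtoC_minus.
          replace ((Ci * (1 - s) + s * - RtoC ((1 - t) / t)) * x)%C
            with (Ci * (1 - s) * x + s * (- RtoC ((1 - t) / t) * x))%C by ring.
          rewrite <- Ey. replace (Ci * (1 - s) * x + s * y)%C with (seg (p + Ci * x) z' s - p)%C
            by (unfold seg, y; ring). rewrite F. ring.
        - unfold RtoC, Ci, Cplus, Cmult, Copp; simpl. f_equal; ring. }
      revert G. apply Cmult_neq_0; auto. apply Q.
      destruct (Req_dec s 1) as [->|F1]; [left|right; lra].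
      intros F1. assert (F2 : (1 - t) / t = 0) by lra.
      rewrite F2 in Ey. apply Hz'. rewrite Ey. ring.
  - exists z. split; [fold x; lra|]. split; intros t Ht E; [|apply N; eauto].
    apply Hz. unfold x. rewrite <- E. unfold seg. ring.
Qed.

Lemma seg_in_ball_center (p z z' : C) r t : Cmod (z - p) <= r -> Cmod (z' - p) <= r ->
  0 <= t <= 1 -> Cmod (seg z z' t - p) <= r.
Proof.
  intros Hz Hz' Ht.
  replace (seg z z' t - p)%C with (RtoC (1 - t) * (z - p) + t * (z' - p))%C
    by (unfold seg; rewrite RtoC_minus; ring).
  eapply Rle_trans; [apply Cmod_triangle|]. rewrite !Cmod_mult, !Cmod_R, !Rabs_pos_eq by lra. nra.
Qed.

Lemma clim_exists_cauchy (f : C -> C) p :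
  (forall e, 0 < e -> exists d, 0 < d /\ forall z z', z <> p -> z' <> p ->
     Cmod (z - p) < d -> Cmod (z' - p) < d -> Cmod (f z - f z') < e) ->
  exists l, clim f p l.
Proof.
  intros H.
  assert (FF : ProperFilter (near p)).
  { split.
    - intros P HP. destruct (near_exists p P HP) as (w & _ & Hw). eauto.
    - split.
      + exists 1. split; [lra|auto].
      + intros P Q HP HQ. now apply near_and.
      + intros P Q HPQ HP. apply (near_mono p P Q HP). auto. }
  destruct (proj1 (filterlim_locally_cauchy (F := near p) (U := C_R_CompleteNormedModule) f)) as (l & Hl).
  - intros [e He]. destruct (H e He) as (d & Hd & K).
    exists (fun z => z <> p /\ Cmod (z - p) < d). split.
    + exists d. split; auto.
    + intros u v [Hu Hu'] [Hv Hv']. apply C_NormedModule_mixin_compat1. simpl. now apply K.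
  - exists l. intros e He. assert (He' : 0 < e / 2) by lra.
    destruct (proj1 (filterlim_locally _ _) Hl (mkposreal _ He')) as (d & Hd & K).
    exists d. split; auto. intros w Hw Hwd. specialize (K w Hw Hwd).
    apply C_NormedModule_mixin_compat2 in K. simpl in K.
    apply Rlt_le_trans with (1 := K).
    assert (sqrt 2 <= 2). { rewrite <- (sqrt_square 2) at 2 by lra. apply sqrt_le_1; lra. }
    nra.
Qed.

(** Along at most two segments the mean value inequality bounds the oscillation near [p] by a
    multiple of the radius, so the values are Cauchy. *)
Lemma clim_exists_of_bounded_derivative (f f1 : C -> C) p M :
  near p (fun w => cder f w (f1 w) /\ Cmod (f1 w) <= M) -> exists l, clim f p l.
Proof.
  intros (d & Hd & K). apply clim_exists_cauchy. intros e He.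
  pose proof (Rabs_pos M). pose proof (Rle_abs M).
  set (r := Rmin (d / 2) (e / (8 * (Rabs M + 1)))).
  assert (Hr : 0 < r) by (apply Rmin_pos; [lra|]; apply Rdiv_lt_0_compat; lra).
  pose proof (Rmin_l (d / 2) (e / (8 * (Rabs M + 1)))) as M1.
  pose proof (Rmin_r (d / 2) (e / (8 * (Rabs M + 1)))) as M2. fold r in M1, M2.
  exists r. split; auto. intros z z' Hz Hz' Hzr Hzr'.
  destruct (segments_avoiding_point p z z' Hz Hz') as (m & Hm & S1 & S2).
  assert (B : forall x y, Cmod (x - p) <= r -> Cmod (y - p) <= r ->
     (forall t, 0 <= t <= 1 -> seg x y t <> p) -> Cmod (f y - f x) <= (Rabs M + 1) * (2 * r)).
  { intros x y Hx Hy Hs. eapply Rle_trans.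
    - apply (mean_value_seg f f1 x y M); intros t Ht; apply K; auto;
        pose proof (seg_in_ball_center p x y r t Hx Hy Ht); lra.
    - assert (Cmod (y - x) <= 2 * r).
      { replace (y - x)%C with ((y - p) - (x - p))%C by ring.
        eapply Rle_trans; [apply Cmod_triangle_minus|]. lra. }
      pose proof (Cmod_ge_0 (y - x)). nra. }
  pose proof (B z m ltac:(lra) ltac:(lra) S1) as B1. pose proof (B m z' ltac:(lra) ltac:(lra) S2) as B2.
  assert (r * (8 * (Rabs M + 1)) <= e) by (apply Rle_div_r; lra).
  replace (f z - f z')%C with (- ((f m - f z) + (f z' - f m)))%C by ring. rewrite Cmod_opp.
  eapply Rle_lt_trans; [apply Cmod_triangle|]. nra.
Qed.

(** Integrating [q] along a segment changes [u] by at most the factor [X]. Two segments from a fixed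
    point [z] bound [u] by [Cmod (u z) * X * X], and then [q * u] is a bounded derivative. *)
Lemma clim_exists_of_bounded_log_derivative (u q : C -> C) p K :
  near p (fun w => cder u w (q w * u w)%C /\ ccont q w /\ Cmod (q w) <= K) -> exists l, clim u p l.
Proof.
  intros (d & Hd & H).
  set (r := d / 2). set (z := (p + r)%C).
  assert (Ez : (z - p)%C = r) by (unfold z; ring).
  assert (Hzr : Cmod (z - p) <= r) by (rewrite Ez, Cmod_R, Rabs_pos_eq; unfold r; lra).
  assert (Hz : z <> p).
  { intros F. assert (F' : RtoC r = 0) by (rewrite <- Ez, F; ring). apply RtoC_inj in F'. unfold r in F'. lra. }
  set (U := fun w => w <> p /\ Cmod (w - p) <= r).
  assert (HU : forall w, U w -> cder u w (q w * u w)%C /\ ccont q w /\ Cmod (q w) <= K).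
  { intros w [A B]. apply H; auto. unfold r in B. lra. }
  pose proof (Rabs_pos K). pose proof (Rle_abs K).
  assert (G : forall x y, U x -> U y -> (forall t, 0 <= t <= 1 -> seg x y t <> p) ->
    Cmod (u y) <= Cmod (u x) * exp (Rabs K * (2 * r))).
  { intros x y [Nx Hx] [Ny Hy] Hs.
    destruct (path_integral_seg U q x y) as (J & J0 & J1 & HJ).
    { intros t Ht. split; auto. now apply seg_in_ball_center. }
    { intros w Hw. now apply HU. }
    rewrite (path_integral_log U q u x y (J 1)); auto; [|intros; now apply HU|intros; now apply HU].
    rewrite Cmod_mult, Cmod_Cexp. apply Rmult_le_compat_l; [apply Cmod_ge_0|].
    assert (Re (J 1) <= Rabs K * (2 * r)).
    { eapply Rle_trans; [apply Rle_abs|]. eapply Rle_trans; [apply re_le_Cmod|].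
      pose proof (mean_value_rder J (fun t => q (seg x y t) * (y - x))%C (Rabs K * (2 * r)) 0 1 ltac:(lra) J1) as M.
      rewrite J0 in M. replace (J 1 - 0)%C with (J 1) in M by ring.
      replace (Rabs K * (2 * r) * (1 - 0)) with (Rabs K * (2 * r)) in M by ring. apply M.
      intros t Ht. rewrite Cmod_mult. apply Rmult_le_compat; auto using Cmod_ge_0.
      - assert (Ut : U (seg x y t)) by (split; [auto|now apply seg_in_ball_center]).
        destruct (HU _ Ut) as (_ & _ & Q). lra.
      - replace (y - x)%C with ((y - p) - (x - p))%C by ring.
        eapply Rle_trans; [apply Cmod_triangle_minus|]. lra. }
    destruct (Rle_lt_or_eq_dec _ _ H2) as [F|F]; [left; now apply exp_increasing|right; now rewrite F]. }
  set (X := exp (Rabs K * (2 * r))) in *.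
  assert (HX : 0 < X) by apply exp_pos.
  set (M := Cmod (u z) * X * X).
  apply (clim_exists_of_bounded_derivative u (fun w => q w * u w)%C p (Rabs K * M)).
  exists r. split; [unfold r; lra|]. intros w Nw Hw.
  assert (Uw : U w) by (split; [auto|lra]). assert (Uz : U z) by (split; auto).
  destruct (HU w Uw) as (D & _ & Q). split; auto.
  destruct (segments_avoiding_point p z w Hz Nw) as (m & Hm & S1 & S2).
  assert (Um : U m).
  { split; [|lra]. replace m with (seg z m 1) by (unfold seg; ring). apply S1. lra. }
  pose proof (G z m Uz Um S1) as G1. pose proof (G m w Um Uw S2) as G2.
  rewrite Cmod_mult. apply Rmult_le_compat; auto using Cmod_ge_0; [lra|].
  unfold M. eapply Rle_trans; [exact G2|]. apply Rmult_le_compat_r; lra.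
Qed.

(** The mean value inequality holds on the segment from [p + s * h] to [p + h], which stays off [p];
    the bound passes to the limit as [s] tends to 0. *)
Lemma cder_removable (f f1 F : C -> C) p l : near p (fun w => cder f w (f1 w)) -> clim f1 p l ->
  clim f p (F p) -> near p (fun w => F w = f w) -> cder F p l.
Proof.
  intros H1 H2 HF (d1 & Hd1 & EF). apply cder_of_eps. intros e He.
  destruct (near_and _ _ _ H1 (clim_near _ _ _ e H2 He)) as (d & Hd & K).
  exists (Rmin d d1). split; [now apply Rmin_pos|]. intros h Hh.
  pose proof (Rmin_l d d1). pose proof (Rmin_r d d1).
  destruct (classic (h = 0)) as [->|Nh].
  { replace (p + 0)%C with p by ring. replace (F p - F p - l * 0)%C with (RtoC 0) by ring.
    rewrite Cmod_0. lra. }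
  assert (Npt : forall s : R, 0 < s -> (p + s * h)%C <> p).
  { intros s Hs E. assert (E' : (s * h)%C = 0).
    { replace (s * h)%C with (p + s * h - p)%C by ring. rewrite E. ring. }
    revert E'. apply Cmult_neq_0; auto. intros G. apply RtoC_inj in G. lra. }
  assert (B : forall s, 0 < s <= 1 ->
     Cmod ((f (p + h) - l * (p + h)) - (f (p + s * h) - l * (p + s * h)))%C <= e * Cmod h).
  { intros s Hs. eapply Rle_trans.
    - apply (mean_value_seg (fun w => f w - l * w)%C (fun w => f1 w - l)%C (p + s * h)%C (p + h)%C e).
      + intros t Ht. 
        assert (E : seg (p + s * h) (p + h) t = (p + RtoC (s + t * (1 - s)) * h)%C)
          by (unfold seg; rewrite RtoC_plus, RtoC_mult, RtoC_minus; ring).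
        rewrite E. eapply cder_eq.
        * apply cder_minus; [apply K|apply cder_scal, cder_id].
          -- apply Npt. nra.
          -- replace (p + RtoC (s + t * (1 - s)) * h - p)%C with (RtoC (s + t * (1 - s)) * h)%C by ring.
             rewrite Cmod_mult, Cmod_R, Rabs_pos_eq by nra. pose proof (Cmod_ge_0 h).
             assert (s + t * (1 - s) <= 1) by nra. nra.
        * cbv beta. ring.
      + intros t Ht. 
        assert (E : seg (p + s * h) (p + h) t = (p + RtoC (s + t * (1 - s)) * h)%C)
          by (unfold seg; rewrite RtoC_plus, RtoC_mult, RtoC_minus; ring).
        rewrite E. left. apply K.
        * apply Npt. nra.
        * replace (p + RtoC (s + t * (1 - s)) * h - p)%C with (RtoC (s + t * (1 - s)) * h)%C by ring.
          rewrite Cmod_mult, Cmod_R, Rabs_pos_eq by nra. pose proof (Cmod_ge_0 h).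
          assert (s + t * (1 - s) <= 1) by nra. nra.
    - replace (p + h - (p + s * h))%C with (RtoC (1 - s) * h)%C by (rewrite RtoC_minus; ring).
      apply Rmult_le_compat_l; [lra|]. rewrite Cmod_mult, Cmod_R, Rabs_pos_eq by lra.
      pose proof (Cmod_ge_0 h). nra. }
  rewrite EF.
  2:{ replace (p + h)%C with (p + 1 * h)%C by ring. apply Npt. lra. }
  2:{ replace (p + h - p)%C with h by ring. lra. }
  apply Rnot_lt_le. intros G.
  set (x := (f (p + h) - F p - l * h)%C) in *. set (e' := Cmod x - e * Cmod h).
  pose proof (Cmod_ge_0 l) as Hl0. pose proof (proj1 (Cmod_gt_0 h) Nh) as Hh0.
  destruct (HF (e' / 2)) as (d3 & Hd3 & K3); [unfold e'; lra|].
  (* [e'] is the supposed excess. This [s] keeps the error of [f (p + s * h)] below [e' / 2] and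
     that of the linear term below or at [e' / 4], which together do not reach it. *)
  set (s := Rmin 1 (Rmin (d3 / (2 * Cmod h)) (e' / (4 * ((Cmod l + 1) * Cmod h))))).
  assert (Q : 0 < (Cmod l + 1) * Cmod h) by (apply Rmult_lt_0_compat; lra).
  assert (Hs : 0 < s).
  { apply Rmin_pos; [lra|]. apply Rmin_pos; apply Rdiv_lt_0_compat; unfold e'; lra. }
  pose proof (Rmin_l 1 (Rmin (d3 / (2 * Cmod h)) (e' / (4 * ((Cmod l + 1) * Cmod h))))) as M1.
  pose proof (Rmin_r 1 (Rmin (d3 / (2 * Cmod h)) (e' / (4 * ((Cmod l + 1) * Cmod h))))) as M2.
  pose proof (Rmin_l (d3 / (2 * Cmod h)) (e' / (4 * ((Cmod l + 1) * Cmod h)))) as M3.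
  pose proof (Rmin_r (d3 / (2 * Cmod h)) (e' / (4 * ((Cmod l + 1) * Cmod h)))) as M4.
  fold s in M1, M2.
  assert (A1 : s * (2 * Cmod h) <= d3) by (apply Rle_div_r; lra).
  assert (A2 : s * (4 * ((Cmod l + 1) * Cmod h)) <= e') by (apply Rle_div_r; lra).
  specialize (B s ltac:(lra)). specialize (K3 (p + s * h)%C (Npt s Hs)).
  replace (p + s * h - p)%C with (s * h)%C in K3 by ring.
  assert (Em : Cmod (s * h)%C = s * Cmod h) by (rewrite Cmod_mult, Cmod_R, Rabs_pos_eq; lra).
  rewrite Em in K3. specialize (K3 ltac:(lra)).
  assert (Ex : x = ((f (p + h) - l * (p + h) - (f (p + s * h) - l * (p + s * h)))
     + (f (p + s * h) - F p) - l * (s * h))%C) by (unfold x; ring).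
  assert (Hx : Cmod x <= e * Cmod h + Cmod (f (p + s * h)%C - F p) + Cmod l * (s * Cmod h)).
  { rewrite Ex. eapply Rle_trans; [apply Cmod_triangle_minus|]. rewrite (Cmod_mult l), Em.
    pose proof (Cmod_triangle (f (p + h) - l * (p + h) - (f (p + s * h) - l * (p + s * h)))%C (f (p + s * h) - F p)%C).
    lra. }
  assert (Cmod l * (s * Cmod h) <= e' / 4) by nra.
  unfold e' in *. lra.
Qed.

Lemma removable_ext_eq f z l : clim f z l -> removable_ext f z = l.
Proof. apply C_lim_eq. Qed.

(** At a point of [P] convergence of [f1] bounds the derivative of [f], so [f] converges as well and
    its extension is differentiable there. In the application [S] is the lattice and [P] the zeros
    of [phi]. *)
Lemma removable_ext_primitive (S P : C -> Prop) (f f1 : C -> C) : locally_finite S -> locally_finite P ->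
  (forall z, ~ S z -> ~ P z -> cder f z (f1 z) /\ ccont f1 z) ->
  (forall z, ~ S z -> P z -> exists l, clim f1 z l) ->
  forall z, ~ S z -> cder (removable_ext f) z (removable_ext f1 z) /\ ccont (removable_ext f1) z /\
    clim f1 z (removable_ext f1 z) /\ (~ P z -> removable_ext f z = f z).
Proof.
  intros HS HP Hf Hlim z Hz.
  assert (Hreg : near z (fun w => ~ S w /\ ~ P w)).
  { apply near_and; now apply locally_finite_near. }
  assert (Ef : forall w, ~ S w -> ~ P w -> removable_ext f w = f w).
  { intros w A B. apply removable_ext_eq. eapply cder_cont. now apply Hf. }
  assert (Ef1 : forall w, ~ S w -> ~ P w -> removable_ext f1 w = f1 w).
  { intros w A B. apply removable_ext_eq. now apply Hf. }
  assert (L1 : exists l, clim f1 z l).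
  { destruct (classic (P z)) as [F|F]; auto. exists (f1 z). now apply Hf. }
  destruct L1 as (l1 & L1). rewrite (removable_ext_eq f1 z l1 L1).
  assert (L0 : exists l, clim f z l).
  { apply (clim_exists_of_bounded_derivative f f1 z (Cmod l1 + 1)).
    destruct (near_and _ _ _ Hreg (clim_bounded _ _ _ L1)) as (d & Hd & K).
    exists d. split; auto. intros w Hw Hwd. destruct (K w Hw Hwd) as [[A B] D]. split; auto. now apply Hf. }
  destruct L0 as (l0 & L0).
  split; [|split; [|split]]; auto.
  - apply (cder_removable f f1); auto.
    + apply (near_mono _ _ _ Hreg). intros w _ [A B]. now apply Hf.
    + now rewrite (removable_ext_eq f z l0 L0).
    + apply (near_mono _ _ _ Hreg). intros w _ [A B]. now apply Ef.
  - unfold ccont. rewrite (removable_ext_eq f1 z l1 L1).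
    apply clim_ext_near with f1; auto. apply (near_mono _ _ _ Hreg). intros w _ [A B].
    symmetry. now apply Ef1.
Qed.

Lemma Re_primitive_eq (S : C -> Prop) (f F : C -> C) z0 z : locally_finite S -> ~ S z0 -> ~ S z ->
  (forall w, ~ S w -> cder F w (f w) /\ ccont f w) ->
  Re_primitive (fun w => ~ S w) f z0 z = Re (F z) - Re (F z0).
Proof.
  intros HS H0 Hz HF. unfold Re_primitive.
  apply (iota_unique (V := R_CompleteNormedModule)).
  - intros y (I & HI & ->).
    rewrite (path_integral_primitive (fun w => ~ S w) f F z0 z I); auto; intros w Hw; now apply HF.
  - destruct (path_integral_exists S f z0 z HS H0 Hz) as (I & HI). { intros w Hw; now apply HF. }
    exists I. split; auto.
    rewrite (path_integral_primitive (fun w => ~ S w) f F z0 z I); auto; intros w Hw; now apply HF.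
Qed.

(** ** Primitives of the Weierstrass data *)

Section Data.

Variable L : C -> Prop.
Hypothesis HL : lattice L.
Variable b : R.
Hypothesis Hb : (b ^ 3 - 4 * g2 L * b - 16 * g3 L = 1)%C.
Variable a : C.
Hypothesis Ha : ~ L a.
Hypothesis Hphia : phi L b a = 0.
Hypothesis Hdphia : dphi L a = 1.
Variable g0 : R.
Hypothesis Hg0 : 0 < g0.

Notation g := (gauss L b g0).
Notation ph := (phi L b).
Notation dph := (dphi L).
Notation A := (phi_coef L b).

(* Since [dphi ^ 2] is a cubic in [phi] with constant term 1 and [g' = g / phi], the
   forms [g phi dz] and [phi / g dz] have primitives rational in [g], [phi], [dphi]. *)
Definition prim_mul (z : C) : C := (- g z * (2 * (dph z + 1) / ph z + A))%C.
Definition prim_div (z : C) : C := (/ g z * (A - 2 * (dph z - 1) / ph z))%C.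

Let bnear p : near p (fun w => ~ L w /\ ~ branch L a w).
Proof.
  apply near_and; apply locally_finite_near; [now apply lattice_locally_finite|].
  now apply branch_locally_finite.
Qed.

Lemma cder_gauss_phi z : ~ L z -> ~ branch L a z -> cder g z (g z / ph z)%C.
Proof.
  intros Hz Bz. unfold Cdiv. rewrite <- (recip_phi_eq L HL b a) by auto.
  now apply (cder_gauss L HL b a).
Qed.

Lemma gauss_nz z : ~ branch L a z -> g z <> 0.
Proof. now apply (gauss_neq_0 L HL b a). Qed.

Lemma phi_nz z : ~ L z -> ~ branch L a z -> ph z <> 0.
Proof. now apply (phi_neq_0 L HL b a). Qed.

Lemma cder_prim_mul z : ~ L z -> ~ branch L a z -> cder prim_mul z (g z * ph z)%C.
Proof.
  intros Hz Bz. pose proof (phi_nz z Hz Bz) as Np.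
  eapply cder_eq.
  - apply cder_mult; [apply cder_opp, cder_gauss_phi; auto|]. apply cder_plus; [|apply cder_const].
    apply cder_mult; [|apply cder_inv; [now apply cder_phi|auto]].
    apply cder_scal, cder_plus; [now apply (cder_dphi L HL b)|apply cder_const].
  - pose proof (dphi_ode L HL b Hb z Hz) as O. cbv beta.
    (* In this form [dph z] occurs only squared, where the cubic equation can be substituted. *)
    transitivity (- g z * (2 / ph z ^ 2 + 2 * A / ph z + 6 * b - 3 * ph z - 2 * (dph z ^ 2) / ph z ^ 2))%C.
    + field. auto.
    + rewrite O. field. auto.
Qed.

Lemma cder_prim_div z : ~ L z -> ~ branch L a z -> cder prim_div z (ph z / g z)%C.
Proof.
  intros Hz Bz. pose proof (phi_nz z Hz Bz) as Np. pose proof (gauss_nz z Bz) as Ng.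
  eapply cder_eq.
  - apply cder_mult; [apply cder_inv; [apply cder_gauss_phi; auto|auto]|].
    apply cder_minus; [apply cder_const|].
    apply cder_mult; [|apply cder_inv; [now apply cder_phi|auto]].
    apply cder_scal, cder_minus; [now apply (cder_dphi L HL b)|apply cder_const].
  - pose proof (dphi_ode L HL b Hb z Hz) as O. cbv beta.
    transitivity (/ g z * (- 2 / ph z ^ 2 - 2 * A / ph z - 6 * b + 3 * ph z + 2 * (dph z ^ 2) / ph z ^ 2))%C.
    + field. auto.
    + rewrite O. field. auto.
Qed.

Lemma clim_log_pair (u q : C -> C) p l : clim q p l ->
  near p (fun w => cder u w (q w * u w)%C /\ ccont q w /\ u w <> 0) ->
  (exists m, clim u p m) /\ (exists m, clim (fun w => / u w)%C p m).
Proof.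
  intros Hq H. destruct (near_and _ _ _ H (clim_bounded _ _ _ Hq)) as (d & Hd & K). split.
  - apply (clim_exists_of_bounded_log_derivative u q p (Cmod l + 1)).
    exists d. split; auto. intros w Hw Hwd. destruct (K w Hw Hwd) as [(D & Q & N) B]. auto.
  - apply (clim_exists_of_bounded_log_derivative (fun w => / u w)%C (fun w => - q w)%C p (Cmod l + 1)).
    exists d. split; auto. intros w Hw Hwd. destruct (K w Hw Hwd) as [(D & Q & N) B].
    split; [|split].
    + eapply cder_eq; [exact (cder_inv u w _ D N)|]. field. auto.
    + now apply ccont_opp.
    + now rewrite Cmod_opp.
Qed.

(** Where [phi' = 1] the Gauss map has a simple zero, and [g / phi] has the logarithmic derivative
    [(1 - phi') / phi], which converges; so [g / phi] and its inverse converge, and [g phi] is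
    [g / phi] times [phi^2]. Where [phi' = -1] there is a simple pole, and [g phi] takes the place
    of [g / phi]. *)
Lemma clim_data_at_branch p : branch L a p ->
  (exists l, clim (fun z => g z * ph z)%C p l) /\ (exists l, clim (fun z => ph z / g z)%C p l).
Proof.
  intros Hp.
  assert (Lp : ~ L p) by now apply (branch_not_lattice L HL a Ha).
  pose proof (phi_branch L HL b a Ha Hphia p Hp) as P0.
  pose proof (cder_phi L HL b p Lp) as Dp.
  pose proof (cder_dphi L HL b p Lp) as DDp.
  assert (Cphi : clim ph p 0) by (eapply clim_eq; [eapply cder_cont, Dp | exact P0]).
  assert (Hq : forall e : C, dph p = e -> e <> 0 -> exists l, clim (fun w => (dph w - e) / ph w)%C p l).
  { intros e He Ne.
    (* L'Hopital's rule: the numerator and [ph] both vanish at [p], so the quotient is that of the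
       two difference quotients. *)
    assert (R : clim (fun w => (dph w - dph p) / (w - p) / ((ph w - ph p) / (w - p)))%C p
      ((A / 2 + 3 * b * ph p - 3 / 2 * ph p ^ 2) / dph p)%C).
    { apply clim_div; auto. congruence. }
    eexists. apply clim_ext_near with (2 := R).
    apply (near_mono _ _ _ (bnear p)). intros w Hw [Lw Bw].
    pose proof (phi_nz w Lw Bw). rewrite P0, He. field. repeat split; auto.
    now apply Cminus_neq_0. }
  assert (Hc : forall e w, ~ L w -> ~ branch L a w -> ccont (fun w => (dph w - e) / ph w)%C w).
  { intros e w Lw Bw. apply ccont_mult.
    - apply ccont_minus; [eapply cder_cont; now apply (cder_dphi L HL b)|apply ccont_const].
    - apply ccont_inv; [eapply cder_cont; now apply cder_phi|now apply phi_nz]. }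
  assert (N1 : RtoC 1 <> 0) by (intros E; apply RtoC_inj in E; lra).
  destruct (dphi_at_zero L HL b Hb p Lp P0) as [E|E].
  - destruct (Hq 1 E N1) as (l & Hl).
    destruct (clim_log_pair (fun w => g w / ph w)%C (fun w => - ((dph w - 1) / ph w))%C p (- l)%C)
      as [(m & Hm) (m' & Hm')].
    + now apply clim_opp.
    + apply (near_mono _ _ _ (bnear p)). intros w Hw [Lw Bw].
      pose proof (phi_nz w Lw Bw) as Np. pose proof (gauss_nz w Bw) as Ng. split; [|split].
      * eapply cder_eq.
        -- apply cder_mult; [now apply cder_gauss_phi|apply cder_inv; [now apply cder_phi|auto]].
        -- cbv beta. field. auto.
      * apply ccont_opp. now apply Hc.
      * intros F. apply Ng. replace (g w) with (g w / ph w * ph w)%C by (field; auto). rewrite F. ring.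
    + split.
      * eexists. apply clim_ext_near with (fun w => (g w / ph w) * ph w ^ 2)%C.
        -- apply (near_mono _ _ _ (bnear p)). intros w Hw [Lw Bw]. field. now apply phi_nz.
        -- apply clim_mult; [exact Hm|]. apply clim_pow, Cphi.
      * exists m'. apply clim_ext_near with (2 := Hm').
        apply (near_mono _ _ _ (bnear p)). intros w Hw [Lw Bw].
        pose proof (phi_nz w Lw Bw). pose proof (gauss_nz w Bw). field. auto.
  - assert (N2 : (- (1))%C <> 0).
    { intros F. apply N1. replace (RtoC 1) with (- - (1))%C by ring. rewrite F. ring. }
    destruct (Hq _ E N2) as (l & Hl).
    destruct (clim_log_pair (fun w => g w * ph w)%C (fun w => (dph w - - (1)) / ph w)%C p l)
      as [(m & Hm) (m' & Hm')]; auto.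
    + apply (near_mono _ _ _ (bnear p)). intros w Hw [Lw Bw].
      pose proof (phi_nz w Lw Bw) as Np. pose proof (gauss_nz w Bw) as Ng. split; [|split].
      * eapply cder_eq.
        -- apply cder_mult; [now apply cder_gauss_phi|now apply cder_phi].
        -- cbv beta. field. auto.
      * now apply Hc.
      * now apply Cmult_neq_0.
    + split; [eauto|].
      eexists. apply clim_ext_near with (fun w => / (g w * ph w) * ph w ^ 2)%C.
      * apply (near_mono _ _ _ (bnear p)). intros w Hw [Lw Bw].
        pose proof (phi_nz w Lw Bw). pose proof (gauss_nz w Bw). field. auto.
      * apply clim_mult; [exact Hm'|]. apply clim_pow, Cphi.
Qed.

Lemma prim_mul_removable z : ~ L z ->
  cder (removable_ext prim_mul) z (removable_ext (fun w => g w * ph w)%C z) /\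
  ccont (removable_ext (fun w => g w * ph w)%C) z /\
  clim (fun w => g w * ph w)%C z (removable_ext (fun w => g w * ph w)%C z) /\
  (~ branch L a z -> removable_ext prim_mul z = prim_mul z).
Proof.
  apply (removable_ext_primitive L (branch L a)).
  - now apply lattice_locally_finite.
  - now apply branch_locally_finite.
  - intros w Lw Bw. split; [now apply cder_prim_mul|].
    apply ccont_mult; eapply cder_cont; [now apply cder_gauss_phi|now apply cder_phi].
  - intros w Lw Bw. now apply clim_data_at_branch.
Qed.

Lemma prim_div_removable z : ~ L z ->
  cder (removable_ext prim_div) z (removable_ext (fun w => ph w / g w)%C z) /\
  ccont (removable_ext (fun w => ph w / g w)%C) z /\
  clim (fun w => ph w / g w)%C z (removable_ext (fun w => ph w / g w)%C z) /\
  (~ branch L a z -> removable_ext prim_div z = prim_div z).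
Proof.
  apply (removable_ext_primitive L (branch L a)).
  - now apply lattice_locally_finite.
  - now apply branch_locally_finite.
  - intros w Lw Bw. split; [now apply cder_prim_div|].
    apply ccont_mult; [eapply cder_cont; now apply cder_phi|].
    apply ccont_inv; [eapply cder_cont; now apply cder_gauss_phi|now apply gauss_nz].
  - intros w Lw Bw. now apply clim_data_at_branch.
Qed.

Definition primitive_1 (z : C) : C := (/ 2 * (removable_ext prim_div z - removable_ext prim_mul z))%C.
Definition primitive_2 (z : C) : C := (Ci / 2 * (removable_ext prim_div z + removable_ext prim_mul z))%C.
Definition primitive_3 (z : C) : C := (b * z + 4 * pole_series L 1 z)%C.

Lemma cder_primitive_1 z : ~ L z -> cder primitive_1 z (Phi1 L b g0 z) /\ ccont (Phi1 L b g0) z.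
Proof.
  assert (E : forall w, ~ L w -> Phi1 L b g0 w
     = (/ 2 * (removable_ext (fun w => ph w / g w) w - removable_ext (fun w => g w * ph w) w))%C).
  { intros w Lw. apply removable_ext_eq.
    apply clim_ext with (fun w => / 2 * (ph w / g w - g w * ph w))%C. { intros; unfold Cdiv; ring. }
    apply clim_mult; [apply clim_const|]. apply clim_minus.
    - now apply prim_div_removable.
    - now apply prim_mul_removable. }
  intros Lz. destruct (prim_div_removable z Lz) as (D1 & C1 & _). destruct (prim_mul_removable z Lz) as (D2 & C2 & _).
  split.
  - rewrite E by auto. now apply cder_scal, cder_minus.
  - unfold ccont. rewrite E by auto.
    apply clim_ext_near with (fun w => / 2 * (removable_ext (fun w => ph w / g w) w - removable_ext (fun w => g w * ph w) w))%C.
    + apply (near_mono _ _ _ (bnear z)). intros w _ [Lw _]. symmetry. now apply E.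
    + apply clim_mult; [apply clim_const|]. now apply clim_minus.
Qed.

Lemma cder_primitive_2 z : ~ L z -> cder primitive_2 z (Phi2 L b g0 z) /\ ccont (Phi2 L b g0) z.
Proof.
  assert (E : forall w, ~ L w -> Phi2 L b g0 w
     = (Ci / 2 * (removable_ext (fun w => ph w / g w) w + removable_ext (fun w => g w * ph w) w))%C).
  { intros w Lw. apply removable_ext_eq.
    apply clim_ext with (fun w => Ci / 2 * (ph w / g w + g w * ph w))%C. { intros; unfold Cdiv; ring. }
    apply clim_mult; [apply clim_const|]. apply clim_plus.
    - now apply prim_div_removable.
    - now apply prim_mul_removable. }
  intros Lz. destruct (prim_div_removable z Lz) as (D1 & C1 & _). destruct (prim_mul_removable z Lz) as (D2 & C2 & _).
  split.
  - rewrite E by auto. now apply cder_scal, cder_plus.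
  - unfold ccont. rewrite E by auto.
    apply clim_ext_near with (fun w => Ci / 2 * (removable_ext (fun w => ph w / g w) w + removable_ext (fun w => g w * ph w) w))%C.
    + apply (near_mono _ _ _ (bnear z)). intros w _ [Lw _]. symmetry. now apply E.
    + apply clim_mult; [apply clim_const|]. now apply clim_plus.
Qed.

Lemma cder_primitive_3 z : ~ L z -> cder primitive_3 z (phi L b z) /\ ccont (phi L b) z.
Proof.
  intros Lz. split; [|eapply cder_cont; now apply cder_phi].
  eapply cder_eq.
  - apply cder_plus; apply cder_scal; [apply cder_id|]. apply (cder_pole_series L HL 1); auto.
  - rewrite phi_pole_series. simpl INR. ring.
Qed.

Lemma Psi_eq z0 z : ~ L z0 -> ~ L z -> Psi L b g0 z0 z =
  (Re (primitive_1 z) - Re (primitive_1 z0), Re (primitive_2 z) - Re (primitive_2 z0),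
   Re (primitive_3 z) - Re (primitive_3 z0)).
Proof.
  intros H0 Hz. unfold Psi, Phi3. pose proof (lattice_locally_finite L HL).
  f_equal; [f_equal|]; apply Re_primitive_eq; auto.
  - apply cder_primitive_1.
  - apply cder_primitive_2.
  - apply cder_primitive_3.
Qed.

End Data.

(** ** Periods *)

(** The values [c z ~ X / z] are purely imaginary. Approaching 0 in the direction [u] shows that the
    real part of [Cconj u * X] is 0, and the directions 1 and [Ci] give both parts of [X]. *)
Lemma clim_orthogonal_0 (k c : C -> C) (X : C) : clim k 0 X ->
  near 0 (fun z => k z = (z * c z)%C /\ Re (c z) = 0) -> X = 0.
Proof.
  intros Hk Hn.
  assert (K : forall u : C, Cmod u = 1 -> Rabs (Re (Cconj u * X)%C) <= 0).
  { intros u Hu. apply Rnot_lt_le. intros G.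
    destruct (near_and _ _ _ Hn (clim_near _ _ _ _ Hk G)) as (d & Hd & K).
    set (w := (RtoC (d / 2) * u)%C).
    assert (Hw : Cmod w = d / 2) by (unfold w; rewrite Cmod_mult, Hu, Cmod_R, Rabs_pos_eq; lra).
    destruct (K w) as [[Ek Ec] Kw].
    - apply Cmod_gt_0. lra.
    - replace (w - 0)%C with w by ring. lra.
    - rewrite Ek in Kw.
      assert (E : Re (Cconj u * X)%C = - Re (Cconj u * (w * c w - X))%C).
      { replace (Cconj u * (w * c w - X))%C with (RtoC (d / 2) * (u * Cconj u) * c w - Cconj u * X)%C
          by (unfold w; ring).
        rewrite <- Cmod2_conj, Hu.
        replace (RtoC (d / 2) * RtoC (1 ^ 2) * c w - Cconj u * X)%C
          with (RtoC (d / 2 * 1 ^ 2) * c w - Cconj u * X)%C by (rewrite RtoC_mult; ring).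
        revert Ec. unfold Re, Cmult, Cminus, Cplus, Copp, RtoC; simpl. intros ->. ring. }
      rewrite E, Rabs_Ropp in Kw.
      pose proof (re_le_Cmod (Cconj u * (w * c w - X))%C) as R.
      rewrite Cmod_mult, Cmod_conj, Hu in R. lra. }
  pose proof (K 1 Cmod_1) as K1. pose proof (K Ci Cmod_Ci) as K2.
  assert (E1 : Re (Cconj 1 * X)%C = Re X) by (unfold Re, Cconj, Cmult, RtoC; simpl; ring).
  assert (E2 : Re (Cconj Ci * X)%C = Im X) by (unfold Re, Im, Cconj, Ci, Cmult; simpl; ring).
  rewrite E1 in K1. rewrite E2 in K2.
  assert (Z : forall r, Rabs r <= 0 -> r = 0).
  { intros r H. apply Rabs_eq_0. pose proof (Rabs_pos r). lra. }
  rewrite (surjective_pairing X). unfold RtoC. f_equal; now apply Z.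
Qed.

Section Periods.

Variable L : C -> Prop.
Hypothesis HL : lattice L.
Variable b : R.
Hypothesis Hb : (b ^ 3 - 4 * g2 L * b - 16 * g3 L = 1)%C.
Variable a : C.
Hypothesis Ha : ~ L a.
Hypothesis Hphia : phi L b a = 0.
Hypothesis Hdphia : dphi L a = 1.
Variable g0 : R.
Hypothesis Hg0 : 0 < g0.

Notation g := (gauss L b g0).

Lemma clim_cube_dphi_0 : clim (fun z => z ^ 3 * dphi L z)%C 0 8.
Proof.
  apply clim_ext with (fun z => 8 * (z ^ 3 * pole_series L 3 z))%C.
  { intros w _. unfold dphi. ring. }
  eapply clim_eq.
  - apply clim_mult; [apply clim_const|]. apply (clim_pole_series_0 L 3); auto.
  - ring.
Qed.

Lemma clim_gauss_0 : clim g 0 g0.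
Proof.
  eapply clim_eq; [|exact (gauss_0 L HL b a Ha Hphia Hdphia g0)].
  eapply cder_cont, (cder_gauss L HL b a); auto. now apply not_branch_0.
Qed.

Lemma g0_neq_0 : RtoC g0 <> 0.
Proof. intros E. apply RtoC_inj in E. lra. Qed.

(** Covers both primitives, [s = 1] for [prim_mul] and [s = -1] for [prim_div]. From
    [phi' ~ 8 / z^3] and [phi ~ -4 / z^2] one gets [2 phi' / phi ~ -4 / z]. *)
Lemma clim_id_mult_prim (s t : C) (h : C -> C) (l : C) : clim h 0 l ->
  clim (fun z => z * (h z * (t + s * (2 * (dphi L z + s) / phi L b z))))%C 0 (- (4 * s) * l)%C.
Proof.
  intros Hh.
  assert (N4 : RtoC (-4) <> 0) by (intros E; apply RtoC_inj in E; lra).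
  apply clim_ext_near with
    (fun z => h z * (t * z + s * (2 * (z ^ 3 * dphi L z + s * z ^ 3) / (z ^ 2 * phi L b z))))%C.
  - apply (near_mono _ _ _ (clim_neq_0 _ _ _ (clim_phi_0 L HL b) N4)). intros w Hw N.
    assert (phi L b w <> 0). { intros E. apply N. rewrite E. ring. }
    field. auto.
  - eapply clim_eq.
    + apply clim_mult; [exact Hh|]. apply clim_plus; (apply clim_mult; [apply clim_const|]).
      * apply clim_id.
      * apply clim_div; [|apply (clim_phi_0 L HL b)|auto].
        apply clim_mult; [apply clim_const|]. apply clim_plus; [apply clim_cube_dphi_0|].
        apply clim_mult; [apply clim_const|]. apply clim_pow, clim_id.
    + field.
Qed.

Lemma clim_id_mult_prim_mul : clim (fun z => z * prim_mul L b g0 z)%C 0 (4 * g0)%C.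
Proof.
  eapply clim_eq.
  - eapply clim_ext.
    2:{ apply (clim_id_mult_prim 1 (phi_coef L b) (fun z => - g z)%C (- g0)%C).
        apply clim_opp, clim_gauss_0. }
    intros w _. unfold prim_mul, Cdiv. ring.
  - ring.
Qed.

Lemma clim_id_mult_prim_div : clim (fun z => z * prim_div L b g0 z)%C 0 (4 / g0)%C.
Proof.
  eapply clim_eq.
  - eapply clim_ext.
    2:{ apply (clim_id_mult_prim (-1) (phi_coef L b) (fun z => / g z)%C (/ g0)%C).
        apply clim_inv; [apply clim_gauss_0|apply g0_neq_0]. }
    intros w _. unfold prim_div, Cdiv. ring.
  - unfold Cdiv. ring.
Qed.

Lemma prim_mul_quasi_periodic z v : ~ L z -> ~ branch L a z -> L v ->
  prim_mul L b g0 (z + v) = (g v / g0 * prim_mul L b g0 z)%C.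
Proof.
  intros Hz Bz Hv. unfold prim_mul.
  rewrite (gauss_quasi_periodic L HL b a), phi_periodic, dphi_periodic by auto. ring.
Qed.

Lemma prim_div_quasi_periodic z v : ~ L z -> ~ branch L a z -> L v ->
  prim_div L b g0 (z + v) = (g0 / g v * prim_div L b g0 z)%C.
Proof.
  intros Hz Bz Hv. unfold prim_div.
  rewrite (gauss_quasi_periodic L HL b a), phi_periodic, dphi_periodic by auto.
  pose proof (gauss_neq_0 L HL b a Ha Hphia Hdphia g0 Hg0) as N.
  pose proof (N v (lattice_not_branch L HL a Ha v Hv)). pose proof (N z Bz). pose proof g0_neq_0.
  replace (/ (g v / g0 * g z))%C with (g0 / g v * / g z)%C by (field; auto). ring.
Qed.

(* Near the origin [prim_mul z ~ 4 g0 / z] and [prim_div z ~ 4 / (g0 z)], so invariance of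
   the first two coordinates forces the multiplier [g v / g0] of the Gauss map to be 1. *)
Lemma gauss_period_of_Psi z0 v : ~ L z0 -> L v ->
  (forall z, ~ L z -> Psi L b g0 z0 (z + v) = Psi L b g0 z0 z) -> g v = g0.
Proof.
  intros H0 Hv HPsi.
  pose proof (gauss_neq_0 L HL b a Ha Hphia Hdphia g0 Hg0 v (lattice_not_branch L HL a Ha v Hv)) as Nv.
  pose proof g0_neq_0 as N0.
  set (mu := (g0 / g v - 1)%C). set (nu := (g v / g0 - 1)%C).
  set (G := prim_mul L b g0) in *. set (H := prim_div L b g0) in *.
  (* The two expressions are twice the increments along [v] of the holomorphic primitives of the
     first two coordinates. *)
  assert (HR : near 0 (fun z => Re (mu * H z - nu * G z)%C = 0 /\ Re (Ci * (mu * H z + nu * G z))%C = 0)).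
  { destruct (near_and 0 _ _ (locally_finite_near L 0 (lattice_locally_finite L HL))
       (locally_finite_near _ 0 (branch_locally_finite L HL a))) as (d & Hd & K).
    exists d. split; auto. intros z Nz Hz. destruct (K z Nz Hz) as [Lz Bz].
    assert (Lzv : ~ L (z + v)%C) by (rewrite lattice_shift; auto).
    assert (Bzv : ~ branch L a (z + v)%C) by (rewrite branch_shift; auto).
    specialize (HPsi z Lz). rewrite !(Psi_eq L HL b Hb a) in HPsi by auto.
    pose proof (f_equal x1 HPsi) as E1. pose proof (f_equal x2 HPsi) as E2.
    unfold x1, x2 in E1, E2. cbn [fst snd] in E1, E2. unfold primitive_1, primitive_2 in E1, E2.
    destruct (prim_mul_removable L HL b Hb a Ha Hphia Hdphia g0 Hg0 z Lz) as (_ & _ & _ & M1).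
    destruct (prim_mul_removable L HL b Hb a Ha Hphia Hdphia g0 Hg0 _ Lzv) as (_ & _ & _ & M2).
    destruct (prim_div_removable L HL b Hb a Ha Hphia Hdphia g0 Hg0 z Lz) as (_ & _ & _ & M3).
    destruct (prim_div_removable L HL b Hb a Ha Hphia Hdphia g0 Hg0 _ Lzv) as (_ & _ & _ & M4).
    rewrite M1, M2, M3, M4 in E1, E2 by auto.
    rewrite prim_mul_quasi_periodic, prim_div_quasi_periodic in E1, E2 by auto.
    fold (G z) in E1, E2. fold (H z) in E1, E2.
    assert (RB : forall u w : C, Re (u - w)%C = Re u - Re w) by reflexivity.
    split.
    - replace (mu * H z - nu * G z)%C with
        (2 * (/ 2 * (g0 / g v * H z - g v / g0 * G z) - / 2 * (H z - G z)))%C by (unfold mu, nu; field; auto).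
      assert (R2 : forall u, Re (2 * u)%C = 2 * Re u) by (intros u; unfold Re, Cmult, RtoC; simpl; ring).
      rewrite R2, RB. lra.
    - replace (Ci * (mu * H z + nu * G z))%C with
        (2 * (Ci / 2 * (g0 / g v * H z + g v / g0 * G z) - Ci / 2 * (H z + G z)))%C by (unfold mu, nu; field; auto).
      assert (R2 : forall u, Re (2 * u)%C = 2 * Re u) by (intros u; unfold Re, Cmult, RtoC; simpl; ring).
      rewrite R2, RB. lra. }
  pose proof clim_id_mult_prim_mul as LG. pose proof clim_id_mult_prim_div as LH.
  fold G in LG. fold H in LH.
  assert (X1 : (mu * (4 / g0) - nu * (4 * g0))%C = 0).
  { apply (clim_orthogonal_0 (fun z => mu * (z * H z) - nu * (z * G z))%C (fun z => mu * H z - nu * G z)%C).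
    - apply clim_minus; (apply clim_mult; [apply clim_const|auto]).
    - apply (near_mono _ _ _ HR). intros z _ [E _]. split; [ring|auto]. }
  assert (X2 : (Ci * (mu * (4 / g0) + nu * (4 * g0)))%C = 0).
  { apply (clim_orthogonal_0 (fun z => Ci * (mu * (z * H z) + nu * (z * G z)))%C
      (fun z => Ci * (mu * H z + nu * G z))%C).
    - apply clim_mult; [apply clim_const|]. apply clim_plus; (apply clim_mult; [apply clim_const|auto]).
    - apply (near_mono _ _ _ HR). intros z _ [_ E]. split; [ring|auto]. }
  assert (ECi : (Ci * Ci)%C = (- (1))%C) by (unfold Ci, Cmult, RtoC, Copp; simpl; f_equal; ring).
  assert (Z : nu = 0).
  { replace nu with ((- (Ci * Ci) * (mu * (4 / g0) + nu * (4 * g0)) - (mu * (4 / g0) - nu * (4 * g0))) / (8 * g0))%C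
      by (rewrite ECi; field; auto).
    replace (- (Ci * Ci) * (mu * (4 / g0) + nu * (4 * g0)))%C
      with (- Ci * (Ci * (mu * (4 / g0) + nu * (4 * g0))))%C by ring.
    rewrite X1, X2. field. auto. }
  replace (g v) with ((nu + 1) * g0)%C by (unfold nu; field; auto). rewrite Z. ring.
Qed.

Lemma primitive_3_quasi_periodic v : L v -> exists c, forall z, ~ L z ->
  primitive_3 L b (z + v) = (primitive_3 L b z + c)%C.
Proof.
  intros Hv. destruct (zeta_quasi_periodic L HL v Hv) as (eta & He).
  exists (b * v + 4 * eta)%C. intros z Hz. unfold primitive_3. rewrite He by auto. ring.
Qed.

Lemma primitive_3_opp z : ~ L z -> primitive_3 L b (- z) = (- primitive_3 L b z)%C.
Proof. intros Hz. unfold primitive_3. rewrite pole_series_opp by auto. ring. Qed.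

(** The linear parts of the three terms cancel, so [zeta] may be replaced by [primitive_3], which
    can be periodic along [x] where [zeta] is only quasi-periodic. *)
Lemma recip_phi_primitive_3 z : 
  recip_phi L a z = (/ 4 * (primitive_3 L b (z - a) - primitive_3 L b (z + a) + 2 * primitive_3 L b a))%C.
Proof. unfold recip_phi, primitive_3. field. Qed.

End Periods.

(** * The multiplier along a real period, and the index of a sublattice *)

Lemma horizontal_line_avoiding (L : C -> Prop) (x : R) : lattice L -> 0 < x -> L x ->
  exists y : R, forall t : R, ~ L (t, y).
Proof.
  (* Translation by a multiple of [x] brings any lattice point at a height in [0, 1] into the ball
     of radius [x + 1], so only finitely many heights are excluded. *)
  intros HL Hx Lx. destruct (lattice_locally_finite L HL (x + 1)) as (l & Hl).
  destruct (exists_not_in_list (map Im l) 0 1 Rlt_0_1) as (y & Hy & Ny).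
  exists y. intros t Lt. apply Ny.
  assert (LZ : forall n : Z, L (IZR n * x)%C).
  { intros n. pose proof HL as (w1 & w2 & _ & H). apply H in Lx. destruct Lx as (m & k & E).
    apply H. exists (n * m)%Z, (n * k)%Z. rewrite E, !mult_IZR, !RtoC_mult. ring. }
  destruct (archimed (t / x)) as [A1 A2]. set (n := (up (t / x) - 1)%Z).
  assert (En : IZR n = IZR (up (t / x)) - 1) by (unfold n; now rewrite minus_IZR).
  set (w := ((t - IZR n * x)%R, y) : C).
  assert (Ew : w = ((t, y) - IZR n * x)%C).
  { unfold w, Cminus, Cplus, Copp, Cmult, RtoC; simpl. f_equal; ring. }
  change y with (Im w). apply in_map. apply Hl.
  - rewrite Ew. apply lattice_minus; auto.
  - eapply Rle_trans; [apply Cmod_le_components|]. unfold w, Re, Im; simpl.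
    assert (Ht : t = t / x * x) by (field; lra).
    assert (0 <= t - IZR n * x <= x) by (split; rewrite Ht at 1; nra).
    rewrite !Rabs_pos_eq; lra.
Qed.

(* Integrate [recip_phi], a difference of two translates of a periodic function plus a
   constant, along a period of a horizontal line. *)
Lemma gauss_real_period (L : C -> Prop) (b r x g0 : R) : lattice L -> ~ L r -> phi L b r = 0 ->
  dphi L r = 1 -> 0 < g0 -> 0 < x -> L x ->
  (forall z, ~ L z -> primitive_3 L b (z + x) = primitive_3 L b z) ->
  gauss L b g0 x = (g0 * Cexp (x / 2 * primitive_3 L b r))%C.
Proof.
  intros HL Hr Hphi Hdphi Hg0 Hx Lx HF.
  destruct (horizontal_line_avoiding L x HL Hx Lx) as (y & Hy).
  set (F := primitive_3 L b) in *.
  set (p := ((0, y) : C)).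
  assert (Eline : forall t : R, (p + t * x)%C = (t * x, y)).
  { intros t. unfold p, Cplus, Cmult, RtoC; simpl. f_equal; ring. }
  assert (Eline' : forall t s : R, (p + t * x + s)%C = (t * x + s, y)).
  { intros t s. rewrite Eline. unfold Cplus, RtoC; simpl. f_equal; ring. }
  assert (HU : forall t : R, ~ branch L r (p + t * x)%C).
  { intros t [H|H].
    - apply (Hy (t * x + - r)). rewrite <- Eline'. now rewrite RtoC_opp.
    - apply (Hy (t * x + r)). now rewrite <- Eline'. }
  set (h := fun t : R => F (p + t * x)%C).
  assert (Hline : forall t, rder (fun t : R => (p + t * x)%C) t x).
  { intros t. eapply rder_eq.
    - apply rder_plus; [apply rder_const|]. apply rder_mult; [apply rder_RtoC|apply rder_const].
    - cbv beta. ring. }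
  assert (Hh : forall t, rcont h t).
  { intros t. eapply rder_rcont, (rder_comp F (fun t : R => (p + t * x)%C) t (phi L b (p + t * x))); auto.
    apply cder_primitive_3; auto. rewrite Eline. apply Hy. }
  assert (Hper : forall t, h (t + 1) = h t).
  { intros t. unfold h. rewrite <- (HF (p + t * x)%C) by (rewrite Eline; apply Hy).
    f_equal. rewrite RtoC_plus. ring. }
  destruct (rcont_primitive h Hh) as (Jh & _ & DJ & _).
  (* The integral of a function of period 1 over a unit interval does not depend on the interval.
     Hence the two translates in [recip_phi] cancel and only the constant contributes. *)
  assert (Hshift : forall s, (Jh (s + 1)%R - Jh s)%C = (Jh 1 - Jh 0)%C).
  { assert (Dd : forall s, rder (fun s => Jh (s + 1)%R + -1 * Jh s)%C s 0).
    { intros s. eapply rder_eq.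
      - apply rder_plus.
        + apply rder_eps. intros e He. destruct (proj1 (rder_eps _ _ _) (DJ (s + 1)) e He) as (d & Hd & K).
          exists d. split; auto. intros u Hu. replace (s + u + 1) with (s + 1 + u) by ring. apply K, Hu.
        + apply rder_mult; [apply rder_const|apply DJ].
      - cbv beta. rewrite Hper. ring. }
    assert (K : forall s s', s <= s' -> (Jh (s' + 1)%R + -1 * Jh s')%C = (Jh (s + 1)%R + -1 * Jh s)%C).
    { intros s s' Hs. apply Cmod_eq_of_le. intros e He.
      pose proof (mean_value_rder (fun s => Jh (s + 1)%R + -1 * Jh s)%C (fun _ => RtoC 0) 0 s s' Hs) as M.
      eapply Rle_trans; [apply M|lra].
      - intros; apply Dd.
      - intros. rewrite Cmod_0. lra. }
    intros s. replace (Jh 1) with (Jh (0 + 1)%R) by (f_equal; ring).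
    replace (Jh (s + 1)%R - Jh s)%C with (Jh (s + 1)%R + -1 * Jh s)%C by ring.
    replace (Jh (0 + 1)%R - Jh 0)%C with (Jh (0 + 1)%R + -1 * Jh 0)%C by ring.
    destruct (Rle_dec 0 s) as [A|A]; [now apply K|]. symmetry. apply K. lra. }
  assert (Hseg : forall t : R, seg p (p + x) t = (p + t * x)%C) by (intros t; unfold seg; ring).
  destruct (path_integral_seg (fun z => ~ branch L r z) (recip_phi L r) p (p + x)%C) as (J & J0 & J1 & HJ).
  { intros t _. rewrite Hseg. apply HU. }
  { intros. now apply recip_phi_cont. }
  (* As [r] is real, translation by [r] stays on the horizontal line and is a shift of the parameter
     by [s]. *)
  set (s := r / x).
  assert (Es : (s * x)%C = r) by (unfold s; rewrite RtoC_div by lra; field; intros E; apply RtoC_inj in E; lra).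
  assert (Dshift : forall c t, rder (fun t => Jh (t + c)%R) t (h (t + c))).
  { intros c t. apply rder_eps. intros e He. destruct (proj1 (rder_eps _ _ _) (DJ (t + c)) e He) as (d & Hd & K).
    exists d. split; auto. intros u Hu. replace (t + u + c) with (t + c + u) by ring. apply K, Hu. }
  assert (EJ : J 1 = (x / 2 * F r)%C).
  { set (Q := fun t : R => (J t + (- (x / 4)) * (Jh (t + - s)%R + -1 * Jh (t + s)%R) + (- (x / 2 * F r)) * t)%C).
    assert (E : Cmod (Q 1 - Q 0)%C <= 0 * (1 - 0)).
    { apply (mean_value_rder Q (fun _ => RtoC 0)); [lra| |].
      - intros t Ht. eapply rder_eq.
        + apply rder_plus; [apply rder_plus; [apply J1, Ht|]|].
          * apply rder_mult; [apply rder_const|]. apply rder_plus; [apply Dshift|].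
            apply rder_mult; [apply rder_const|apply Dshift].
          * apply rder_mult; [apply rder_const|apply rder_RtoC].
        + cbv beta. rewrite Hseg, (recip_phi_primitive_3 L b). fold F. unfold h.
          replace (p + RtoC (t + - s) * x)%C with (p + t * x - r)%C
            by (rewrite RtoC_plus, RtoC_opp, <- Es; ring).
          replace (p + RtoC (t + s) * x)%C with (p + t * x + r)%C by (rewrite RtoC_plus, <- Es; ring).
          field.
      - intros. rewrite Cmod_0. lra. }
    replace (0 * (1 - 0)) with 0 in E by ring.
    assert (E' : Q 1 = Q 0) by (apply Cmod_eq_of_le; intros; lra).
    unfold Q in E'. rewrite J0 in E'.
    pose proof (Hshift (- s)) as H1. pose proof (Hshift s) as H2.
    replace (- s + 1) with (1 + - s) in H1 by ring. replace (s + 1) with (1 + s) in H2 by ring.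
    replace (0 + - s) with (- s) in E' by ring. replace (0 + s) with s in E' by ring.
    assert (H3 : (Jh (1 + - s)%R - Jh (- s)%R - (Jh (1 + s)%R - Jh s))%C = 0) by (rewrite H1, H2; ring).
    replace (J 1) with ((J 1 + - (x / 4) * (Jh (1 + - s)%R + -1 * Jh (1 + s)%R) + - (x / 2 * F r) * 1)
      + x / 4 * (Jh (1 + - s)%R + -1 * Jh (1 + s)%R) + x / 2 * F r)%C by ring.
    rewrite E'.
    replace (0 + - (x / 4) * (Jh (- s)%R + -1 * Jh s) + - (x / 2 * F r) * 0
      + x / 4 * (Jh (1 + - s)%R + -1 * Jh (1 + s)%R) + x / 2 * F r)%C
      with (x / 4 * (Jh (1 + - s)%R - Jh (- s)%R - (Jh (1 + s)%R - Jh s)) + x / 2 * F r)%C by ring.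
    rewrite H3. ring. }
  assert (Hp : ~ branch L r p).
  { replace p with (p + 0 * x)%C by ring. apply HU. }
  pose proof (gauss_path L HL b r Hr Hphi Hdphi g0 _ _ _ HJ) as G1.
  rewrite (gauss_quasi_periodic L HL b r) in G1 by auto.
  pose proof (gauss_neq_0 L HL b r Hr Hphi Hdphi g0 Hg0 p Hp) as Np.
  assert (N0 : RtoC g0 <> 0) by (intros E; apply RtoC_inj in E; lra).
  replace (gauss L b g0 x) with (gauss L b g0 x / g0 * gauss L b g0 p * g0 / gauss L b g0 p)%C by (field; auto).
  rewrite G1, EJ. fold F. field. auto.
Qed.

(** Cramer's rule over the integers: with [D] the determinant of a basis of [Lam] expressed in one
    of [L], multiplication by [D] maps [L] into [Lam]. If [D] were 0, all four coefficients would
    vanish and so would a basis vector of [Lam]. *)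
Lemma sublattice_index (L Lam : C -> Prop) : lattice L -> lattice Lam -> (forall z, Lam z -> L z) ->
  exists n : nat, (1 <= n)%nat /\ forall z, L z -> Lam (INR n * z)%C.
Proof.
  intros (w1 & w2 & Hi & HL) HLam Hsub. pose proof HLam as (u1 & u2 & Hj & HM).
  assert (U1 : L (2 * u1)%C) by (apply Hsub, HM; exists 1%Z, 0%Z; ring).
  assert (U2 : L (2 * u2)%C) by (apply Hsub, HM; exists 0%Z, 1%Z; ring).
  apply HL in U1, U2. destruct U1 as (p & q & E1). destruct U2 as (r & s & E2).
  set (D := (p * s - q * r)%Z).
  assert (ED : IZR D = IZR p * IZR s - IZR q * IZR r) by (unfold D; now rewrite minus_IZR, !mult_IZR).
  assert (F1 : (IZR D * (2 * w1))%C = (2 * IZR s * u1 + 2 * IZR (- q) * u2)%C).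
  { rewrite opp_IZR, ED, RtoC_minus, !RtoC_mult, RtoC_opp.
    replace (2 * IZR s * u1 + 2 * - IZR q * u2)%C with (IZR s * (2 * u1) - IZR q * (2 * u2))%C by ring.
    rewrite E1, E2. ring. }
  assert (F2 : (IZR D * (2 * w2))%C = (2 * IZR (- r) * u1 + 2 * IZR p * u2)%C).
  { rewrite opp_IZR, ED, RtoC_minus, !RtoC_mult, RtoC_opp.
    replace (2 * - IZR r * u1 + 2 * IZR p * u2)%C with (IZR p * (2 * u2) - IZR r * (2 * u1))%C by ring.
    rewrite E1, E2. ring. }
  assert (HD : D <> 0%Z).
  { intros Z. rewrite Z in F1, F2.
    assert (A : forall x y : R, (2 * x * u1 + 2 * y * u2)%C = 0 -> x = 0 /\ y = 0).
    { intros x y H. destruct (Hj (2 * x) (2 * y)); [rewrite !RtoC_mult; exact H|]. split; lra. }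
    destruct (A (IZR s) (IZR (- q))) as [S Q]. { rewrite <- F1. ring. }
    destruct (A (IZR (- r)) (IZR p)) as [R' P]. { rewrite <- F2. ring. }
    rewrite opp_IZR in Q, R'. assert (Q' : IZR q = 0) by lra.
    rewrite P, Q' in E1. 
    destruct (Hj 1 0) as [X _]; [|lra].
    replace (1 * u1 + 0 * u2)%C with (/ 2 * (2 * u1))%C by field. rewrite E1. ring. }
  exists (Z.abs_nat D). split; [lia|].
  assert (HDz : forall z, L z -> Lam (IZR D * z)%C).
  { intros z Hz. apply HL in Hz. destruct Hz as (m & n & ->).
    apply HM. exists (m * s - n * r)%Z, (- m * q + n * p)%Z.
    replace (IZR D * (2 * IZR m * w1 + 2 * IZR n * w2))%C
      with (IZR m * (IZR D * (2 * w1)) + IZR n * (IZR D * (2 * w2)))%C by ring.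
    rewrite F1, F2, !opp_IZR, minus_IZR, plus_IZR, !mult_IZR, !opp_IZR.
    rewrite !RtoC_minus, !RtoC_plus, !RtoC_mult, !RtoC_opp. ring. }
  intros z Hz. rewrite INR_IZR_INZ, Zabs2Nat.id_abs.
  destruct (Z.abs_spec D) as [[_ ->]|[_ ->]]; auto.
  rewrite opp_IZR, RtoC_opp. replace (- IZR D * z)%C with (- (IZR D * z))%C by ring.
  apply lattice_opp; auto.
Qed.

(** * Zeros of [phi] on the real axis *)

Section Contradiction.

Variable L : C -> Prop.
Hypothesis HL : lattice L.
Hypothesis Hg2 : Im (g2 L) = 0.
Hypothesis Hg3 : Im (g3 L) = 0.
Variable b : R.
Hypothesis Hb : (b ^ 3 - 4 * g2 L * b - 16 * g3 L = 1)%C.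
Variable g0 : R.
Hypothesis Hg0 : 0 < g0.

Lemma Im_phi_real (t : R) : ~ L t -> Im (phi L b t) = 0.
Proof.
  intros Ht. pose proof (pole_series_conj L HL Hg2 Hg3 2 t ltac:(lia) Ht) as E.
  rewrite Cconj_RtoC in E. rewrite phi_pole_series.
  assert (E' : Im (pole_series L 2 t) = 0).
  { apply (f_equal Im) in E. rewrite im_conj in E. lra. }
  revert E'. generalize (pole_series L 2 t). intros [u v]. unfold Im, Cminus, Cplus, Copp, Cmult, RtoC; simpl.
  intros ->. ring.
Qed.

Lemma primitive_3_conj z : ~ L z -> primitive_3 L b (Cconj z) = Cconj (primitive_3 L b z).
Proof.
  intros Hz. unfold primitive_3. rewrite pole_series_conj by auto.
  rewrite Cplus_conj, !Cmult_conj, !Cconj_RtoC. reflexivity.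
Qed.

Lemma C_eq_0_of_Re_Im (z : C) : Re z = 0 -> Im z = 0 -> z = 0.
Proof. intros A B. rewrite (surjective_pairing z). unfold RtoC. f_equal; auto. Qed.

Variable x : R.
Hypothesis Hx : 0 < x.
Hypothesis Lx : L x.
Hypothesis Hmin : forall y : R, 0 < y < x -> ~ L y.
Hypothesis HF : forall z, ~ L z -> primitive_3 L b (z + x) = primitive_3 L b z.
Hypothesis Hg : Cmod (gauss L b g0 x) = g0.

Lemma no_real_zero_lt_half (y : R) : 0 < y < x / 2 -> phi L b y <> 0.
Proof.
  intros Hy Hphi. assert (Ly : ~ L y) by (apply Hmin; lra).
  (* [gauss_real_period] asks for a zero with [phi' = 1], which is [y] or [- y]; since [F] is odd,
     the conclusion about [Re F] carries over to [y]. *)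
  assert (Hr : exists r : R, (r = y \/ r = - y) /\ phi L b r = 0 /\ dphi L r = 1).
  { destruct (dphi_at_zero L HL b Hb y Ly Hphi) as [E|E]; [now exists y; auto|].
    exists (- y). split; [auto|]. rewrite RtoC_opp, phi_opp, dphi_opp, E by auto. split; [auto|ring]. }
  destruct Hr as (r & Hry & Hphir & Hdphir).
  assert (Lr : ~ L r).
  { destruct Hry as [->| ->]; auto. rewrite RtoC_opp, lattice_opp_iff; auto. }
  set (F := primitive_3 L b) in *.
  assert (RF : Re (F r) = 0).
  { pose proof (gauss_real_period L b r x g0 HL Lr Hphir Hdphir Hg0 Hx Lx HF) as G. fold F in G.
    pose proof Hg as Hg'. rewrite G, Cmod_mult, Cmod_R, Rabs_pos_eq, Cmod_Cexp in Hg' by lra.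
    assert (X : exp (Re (x / 2 * F r)%C) = exp 0).
    { rewrite exp_0. apply Rmult_eq_reg_l with g0; lra. }
    apply exp_inv in X. 
    assert (Y : Re (x / 2 * F r)%C = x / 2 * Re (F r)).
    { replace (x / 2)%C with (RtoC (x / 2)) by (rewrite RtoC_div; auto; lra).
      unfold Re, Cmult, RtoC; simpl. ring. }
    rewrite Y in X. nra. }
  assert (RFy : Re (F y) = 0).
  { destruct Hry as [->| ->]; auto. rewrite RtoC_opp in RF. unfold F in *. rewrite primitive_3_opp in RF by auto.
    assert (E : forall z, Re (- z)%C = - Re z) by reflexivity. rewrite E in RF. lra. }
  assert (Lh : ~ L (RtoC (x / 2))) by (apply Hmin; lra).
  assert (RFh : Re (F (RtoC (x / 2))) = 0).
  { assert (E : F (RtoC (x / 2)) = (- F (RtoC (x / 2)))%C).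
    { unfold F at 2. rewrite <- primitive_3_opp by auto. fold F.
      rewrite <- (HF (- RtoC (x / 2))%C).
      - f_equal. rewrite <- RtoC_opp, <- RtoC_plus. f_equal. field.
      - rewrite lattice_opp_iff; auto. }
    apply Ceq_opp_0 in E. now rewrite E. }
  destruct (MVT_cor2 (fun t => Re (F (RtoC t))) (fun t => Re (phi L b t)) y (x / 2)) as (c & Ec & Hc); [lra| |].
  - intros t Ht. apply is_derive_Reals.
    refine (proj1 (rder_eq _ t (phi L b t * 1)%C (phi L b t) _ ltac:(ring))).
    apply (rder_comp F RtoC); [apply rder_RtoC|]. apply cder_primitive_3; auto. apply Hmin. lra.
  - assert (Rc : Re (phi L b c) = 0).
    { rewrite RFy, RFh in Ec. apply Rmult_eq_reg_r with (x / 2 - y); lra. }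
    assert (Lc : ~ L c) by (apply Hmin; lra).
    (* Modulo [L] the zeros of [phi] are [y] and [- y]. Since [y < c < x / 2], both [c - y] and
       [c + y] lie strictly between 0 and [x], hence off [L]. *)
    apply (phi_neq_0 L HL b r Lr Hphir Hdphir c Lc).
    + assert (A1 : ~ L (c - y)%C) by (rewrite <- RtoC_minus; apply Hmin; lra).
      assert (A2 : ~ L (c + y)%C) by (rewrite <- RtoC_plus; apply Hmin; lra).
      destruct Hry as [->| ->]; intros [H|H]; auto.
      * apply A2. rewrite RtoC_opp in H. now replace (c - - y)%C with (c + y)%C in H by ring.
      * apply A1. rewrite RtoC_opp in H. exact H.
    + apply C_eq_0_of_Re_Im; auto. now apply Im_phi_real.
Qed.

(** The reflection [y -> x - y] carries zeros in the upper half to the lower one. At [x / 2] the odd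
    periodic [phi'] vanishes, which is impossible at a zero of [phi]. *)
Lemma no_real_zero (y : R) : 0 < y < x -> phi L b y <> 0.
Proof.
  intros Hy Hphi. assert (Ly : ~ L y) by (apply Hmin; lra).
  destruct (Rtotal_order y (x / 2)) as [A|[A|A]].
  - apply (no_real_zero_lt_half y); auto. lra.
  - assert (E : dphi L y = (- dphi L y)%C).
    { rewrite <- dphi_opp by auto. rewrite <- (dphi_periodic L HL (- y)%C x); auto.
      - f_equal. rewrite <- RtoC_opp, <- RtoC_plus. f_equal. lra.
      - rewrite lattice_opp_iff; auto. }
    apply Ceq_opp_0 in E.
    destruct (dphi_at_zero L HL b Hb y Ly Hphi) as [F|F]; rewrite E in F.
    + apply RtoC_inj in F. lra.
    + rewrite <- RtoC_opp in F. apply RtoC_inj in F. lra.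
  - apply (no_real_zero_lt_half (x - y)); [lra|].
    rewrite RtoC_minus. replace (x - y)%C with (- y + x)%C by ring.
    rewrite phi_periodic, phi_opp; auto. rewrite lattice_opp_iff; auto.
Qed.

Lemma real_period_contradiction : False.
Proof.
  destruct (phi_zero_dphi_1 L HL b Hb) as (a & La & Hphia & Hdphia).
  assert (Hseg : forall t : R, seg 0 x t = RtoC (t * x)) by (intros t; unfold seg; rewrite RtoC_mult; ring).
  assert (HU : forall t, 0 <= t <= 1 -> ~ branch L a (RtoC (t * x))).
  { intros t Ht Bt.
    pose proof (branch_not_lattice L HL a La _ Bt) as Lt.
    pose proof (phi_branch L HL b a La Hphia _ Bt) as E.
    assert (t <> 0). { intros ->. apply Lt. replace (0 * x) with 0 by ring. now apply lattice_0. }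
    assert (t <> 1). { intros ->. apply Lt. now replace (1 * x) with x by ring. }
    apply (no_real_zero (t * x)); auto. split; nra. }
  destruct (path_integral_seg (fun z => ~ branch L a z) (recip_phi L a) 0 x) as (J & J0 & J1 & HJ).
  { intros t Ht. rewrite Hseg. auto. }
  { intros. now apply recip_phi_cont. }
  assert (RJ : Re (J 1) = 0).
  { pose proof Hg as Hg'. rewrite (gauss_eq L HL b a La Hphia Hdphia g0 x _ HJ) in Hg'.
    rewrite Cmod_mult, Cmod_R, Rabs_pos_eq, Cmod_Cexp in Hg' by lra.
    apply exp_inv. rewrite exp_0. apply Rmult_eq_reg_l with g0; lra. }
  (* The argument on the constant sign of [1 / phi] becomes a mean value argument: at some [c] the
     real part of [1 / phi] is 0, although its product with the real number [phi] is 1. *)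
  destruct (MVT_cor2 (fun t => Re (J t)) (fun t => Re (recip_phi L a (seg 0 x t) * (x - 0))%C) 0 1)
    as (c & Ec & Hc); [lra| |].
  - intros t Ht. apply is_derive_Reals. exact (proj1 (J1 t Ht)).
  - rewrite RJ, J0, Hseg in Ec.
    assert (Lc : ~ L (RtoC (c * x))) by (apply Hmin; split; nra).
    pose proof (phi_mult_recip_phi L HL b a La Hphia Hdphia _ Lc (HU c ltac:(lra))) as E.
    pose proof (Im_phi_real _ Lc) as I. 
    set (u := phi L b (RtoC (c * x))) in *. set (v := recip_phi L a (RtoC (c * x))) in *.
    destruct u as [u1 u2], v as [v1 v2]. unfold Im in I. simpl in I. subst u2.
    unfold Re, Cmult, Cminus, Cplus, Copp, RtoC in Ec, E. simpl in Ec.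
    injection E as E1 E2.
    assert (V : v1 = 0) by nra. rewrite V in E1. lra.
Qed.

End Contradiction.

(** * Descent from the quotient *)

Lemma quotient_map_eq (L Lam : C -> Prop) (z w : punctured L) : lattice Lam ->
  Lam (proj1_sig w - proj1_sig z)%C -> quotient_map L Lam w = quotient_map L Lam z.
Proof.
  intros HLam H. unfold quotient_map. apply subset_eq_compat.
  apply functional_extensionality. intros p. apply propositional_extensionality. unfold coset.
  replace (proj1_sig p - proj1_sig z)%C
    with (proj1_sig p - proj1_sig w + (proj1_sig w - proj1_sig z))%C by ring.
  symmetry. now apply lattice_shift.
Qed.

Theorem theorem1 :
  forall (L : C -> Prop), lattice L ->
  Im (g2 L) = 0 -> Im (g3 L) = 0 ->
  forall (b : R), b ^ 3 - 4 * Re (g2 L) * b - 16 * Re (g3 L) = 1 ->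
  forall (g0 : R), 0 < g0 ->
  forall (z0 : C), ~ L z0 ->
  forall (Lam : C -> Prop), lattice Lam -> (forall z : C, Lam z -> L z) ->
  ~ exists Psihat : quotient L Lam -> R3,
      conformal_minimal_immersion_quotient L Lam Psihat /\
      forall z : punctured L,
        Psihat (quotient_map L Lam z) = Psi L b g0 z0 (proj1_sig z).
Proof.
  intros L HL Hg2 Hg3 b Hb g0 Hg0 z0 Hz0 Lam HLam Hsub (Psihat & _ & HPsi).
  assert (HbC : (b ^ 3 - 4 * g2 L * b - 16 * g3 L)%C = 1).
  { assert (E : forall z, Im z = 0 -> z = RtoC (Re z)).
    { intros [u v] E. unfold Im in E; simpl in E. now rewrite E. }
    rewrite (E _ Hg2), (E _ Hg3), <- Hb, !RtoC_minus, !RtoC_mult, RtoC_pow. reflexivity. }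
  assert (Hper : forall v z, Lam v -> ~ L z -> Psi L b g0 z0 (z + v) = Psi L b g0 z0 z).
  { intros v z Hv Hz.
    assert (Hzv : ~ L (z + v)%C) by (rewrite lattice_shift; auto).
    rewrite <- (HPsi (exist _ z Hz)) at 1. change (z + v)%C with (proj1_sig (exist (fun z => ~ L z) (z + v)%C Hzv)).
    rewrite <- HPsi. f_equal. apply quotient_map_eq; auto. simpl.
    now replace (z + v - z)%C with v by ring. }
  destruct (minimal_real_period L HL Hg2 Hg3) as (x & Hx & Lx & Hmin).
  destruct (sublattice_index L Lam HL HLam Hsub) as (n & Hn & Hidx).
  pose proof (Hidx _ Lx) as Lamx.
  destruct (phi_zero_dphi_1 L HL b HbC) as (a & La & Hphia & Hdphia).
  assert (Nn : INR n <> 0) by (apply not_0_INR; lia).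
  destruct (exists_not_lattice L HL) as (p & Lp).
  apply (real_period_contradiction L HL Hg2 Hg3 b HbC g0 Hg0 x Hx Lx Hmin).
  - destruct (primitive_3_quasi_periodic L HL b x Lx) as (c & Hc).
    (* Invariance is available along [n * x] only; increments of [primitive_3] add up, so that the
       known one is [INR n * c]. *)
    assert (Hk : forall k z, ~ L z -> primitive_3 L b (z + INR k * x) = (primitive_3 L b z + INR k * c)%C).
    { induction k as [|k IH]; intros z Hz.
      - simpl INR. replace (z + 0 * x)%C with z by ring. ring.
      - rewrite S_INR, RtoC_plus. replace (z + (INR k + 1) * x)%C with (z + INR k * x + x)%C by ring.
        rewrite Hc, IH by (auto; rewrite lattice_shift; auto; now apply lattice_mult_nat). ring. }
    assert (Rc : Re c = 0).
    { pose proof (Hper _ p Lamx Lp) as E.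
      rewrite !(Psi_eq L HL b HbC a) in E by (auto; rewrite lattice_shift; auto).
      apply (f_equal x3) in E. unfold x3 in E. cbn [snd] in E. rewrite Hk in E by auto.
      assert (E' : Re (primitive_3 L b p + INR n * c)%C = Re (primitive_3 L b p) + INR n * Re c)
        by (unfold Re, Cplus, Cmult, RtoC; simpl; ring).
      rewrite E' in E. apply Rmult_eq_reg_l with (INR n); auto. lra. }
    (* Comparing the increments at [p] and at [Cconj p] shows that [c] is its own conjugate. *)
    assert (Ic : Im c = 0).
    { assert (Lcp : ~ L (Cconj p)).
      { intros F. apply Lp. rewrite <- (Cconj_conj p). now apply lattice_conj_invariant. }
      pose proof (Hc _ Lcp) as E.
      replace (Cconj p + x)%C with (Cconj (p + x)) in E by (now rewrite Cplus_conj, Cconj_RtoC).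
      rewrite !primitive_3_conj in E by (auto; rewrite lattice_shift; auto).
      rewrite Hc in E by auto. rewrite Cplus_conj in E. apply (f_equal Im) in E.
      unfold Im, Cplus, Cconj in E; simpl in E. unfold Im. lra. }
    intros z Hz. rewrite Hc by auto. rewrite (C_eq_0_of_Re_Im c Rc Ic). ring.
  - pose proof (gauss_period_of_Psi L HL b HbC a La Hphia Hdphia g0 Hg0 z0 _ Hz0
      (Hsub _ Lamx) (fun z Hz => Hper _ z Lamx Hz)) as E.
    assert (N0 : RtoC g0 <> 0) by (intros F; apply RtoC_inj in F; lra).
    set (lam := (gauss L b g0 x / g0)%C).
    (* Multipliers are multiplicative, so invariance along [n * x] says that [lam] is an [n]-th root
       of unity, and its modulus is 1. *)
    assert (Hk : forall k, gauss L b g0 (INR k * x) = (g0 * lam ^ k)%C).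
    { induction k as [|k IH].
      - simpl INR. rewrite Cmult_0_l, (gauss_0 L HL b a) by auto. simpl. ring.
      - rewrite S_INR, RtoC_plus. replace ((INR k + 1) * x)%C with (INR k * x + x)%C by ring.
        assert (Lkx : L (INR k * x)%C) by now apply lattice_mult_nat.
        rewrite (gauss_quasi_periodic L HL b a), IH by (auto; now apply lattice_not_branch).
        unfold lam. simpl Cpow. ring. }
    rewrite Hk in E.
    assert (E1 : (lam ^ n)%C = 1).
    { replace (lam ^ n)%C with (g0 * lam ^ n / g0)%C by (field; auto). rewrite E. field. auto. }
    apply (f_equal Cmod) in E1. rewrite Cmod_pow, Cmod_1 in E1.
    destruct (pow_R1 _ _ E1) as [F|F]; [|lia].
    rewrite (Rabs_pos_eq _ (Cmod_ge_0 _)) in F.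
    replace (gauss L b g0 x) with (g0 * lam)%C by (unfold lam; field; auto).
    rewrite Cmod_mult, F, Cmod_R, Rabs_pos_eq; lra.
Qed.
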